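(* Let $\mathcal M_1$ be the space of closed $G_2$-structures $\varphi_u$ on $\mathbb T^7$ induced by cohomogeneity-one hyper-symplectic structures (parametrised by positive smooth functions $u$ on $S^1$ with $\int_{S^1}u=1$), with Dirichlet metric $\mathcal G$ and volume functional $\mathrm{Vol}=\int_{S^1}u^{1/3}$. Then: (1) $\mathrm{Vol}$ is geodesically concave: $\frac{d^2}{dt^2}\mathrm{Vol}\le0$ along every canonical geodesic $u(t)$ in $\mathcal M_1$; (2) the gradient flow of $\mathrm{Vol}$ with respect to $\mathcal G$ decreases the distance: for any smooth two-parameter family $u(t,s)$, $s\in[0,1]$, such that for each $s$ the path $t\mapsto u(t,s)$ solves the gradient flow, $\mathcal G(u_s,u_s)$ is non-increasing in $t$, and hence so is the $\mathcal G$-length of the path $s\mapsto u(t,s)$; (3) the sectional curvature of $(\mathcal M_1,\mathcal G)$ is non-negative.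
   Context: Let $S^1=\mathbb R/\mathbb Z$ (unit length) with coordinate $x=x_0$, and $\mathbb T^7=\mathbb T^3\times\mathbb T^4$ with coordinates $\theta^1,\theta^2,\theta^3$ and $x^0,x^1,x^2,x^3$ (all circles of unit length). Elements of $\mathcal M_1$ are the closed $G_2$-structures $\varphi_u=d\theta^{123}-\sum_{i=1}^3d\theta^i\wedge\omega_i$, with $\omega_1=dx^{01}+dx^{23}$, $\omega_2=dx^{02}+dx^{31}$, $\omega_3=u\,dx^{03}+dx^{12}$, where $u=u(x_0)>0$ is smooth and $\int_{S^1}u=1$; they all lie in the class of the flat structure ($u=1$). A tangent vector is $X=-f\,d\theta^3\wedge dx^{03}$, identified with $f=\partial_tu\in C_0^\infty(S^1)$ (smooth, zero mean); a prime or subscript $x$ denotes $\partial_{x_0}$. For $f\in C^\infty_0(S^1)$ put $F(x)=\int_0^xf$ and $Q(f)=F-\big[\int_{S^1}u^{-1}F\big]\big[\int_{S^1}u^{-1}\big]^{-1}$, so that $Q(f)'=f$ and $\int_{S^1}u^{-1}Q(f)=0$. The Dirichlet metric is $\mathcal G_\varphi(X,Y)=\int_M g_\varphi(\delta\mathbf u,\delta\mathbf v)\,\mathrm{vol}_\varphi$, where $\mathbf u,\mathbf v$ are the $d$-exact $3$-forms with Hodge Laplacians $\Delta\mathbf u=X$, $\Delta\mathbf v=Y$; on $\mathcal M_1$ it equals $\mathcal G(f,g)=\int_{S^1}u^{-1}Q(f)Q(g)$. The canonical geodesics are the geodesics of its Levi-Civita connection: $u_t=f$, $f_t=\partial_x\big(\frac{2fQ(f)}{u}-\frac{Q(f)^2u_x}{u^2}\big)$.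 The gradient flow of $\mathrm{Vol}$ is $u_t=-(\chi_{uu}u\,u')'$ with $\chi(u)=u^{1/3}$. *)

(* Defs.v *)
(* Real analysis is done on Stdlib's R with Coquelicot; MathComp is used for the
   index types 'I_n, finite sums, and the 7 x 7 matrices of metrics. *)
From mathcomp Require Import all_boot all_algebra Rstruct.
From Stdlib Require Import Reals ClassicalEpsilon.
From Coquelicot Require Import Coquelicot.

Set Implicit Arguments.
Unset Strict Implicit.
Unset Printing Implicit Defensive.

Open Scope R_scope.

Definition upd n (p : 'I_n -> R) (i : 'I_n) (t : R) : 'I_n -> R :=
  fun j => if j == i then t else p j.

Definition partial n (i : 'I_n) (F : ('I_n -> R) -> R) : ('I_n -> R) -> R :=
  fun p => Derive (fun t => F (upd p i t)) (p i).

(* [partials [:: i1; ..; ik] F] is the iterated partial derivative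
   d_i1 (.. (d_ik F)). *)
Definition partials n (L : seq 'I_n) (F : ('I_n -> R) -> R) :
  ('I_n -> R) -> R := foldr (@partial n) F L.

(* F is C^infinity on a neighbourhood of D.  As F is a total function, a smooth
   function on a set D that is not open is one which has been extended smoothly
   to a neighbourhood; its partial derivatives on D are then the usual ones. *)
Definition smooth_on n (D : ('I_n -> R) -> Prop) (F : ('I_n -> R) -> R) : Prop :=
  forall p, D p -> locally p (fun q : 'I_n -> R =>
    forall L : seq 'I_n,
      continuous (partials L F) q /\
      forall i, ex_derive (fun t => partials L F (upd q i t)) (q i)).

Definition i0 n : 'I_n.+1 := ord0.
Definition i1 n : 'I_n.+2 := @Ordinal n.+2 1 isT.
Definition i2 n : 'I_n.+3 := @Ordinal n.+3 2 isT.

(* T^7 = R^7 / Z^7; a point of R^7 has the coordinates, in this order,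
   theta^1, theta^2, theta^3, x^0, x^1, x^2, x^3, and T^7 is oriented by it. *)

Definition pt := 'I_7 -> R.

Definition th1 : 'I_7 := @Ordinal 7 0 isT.
Definition th2 : 'I_7 := @Ordinal 7 1 isT.
Definition th3 : 'I_7 := @Ordinal 7 2 isT.
Definition x0 : 'I_7 := @Ordinal 7 3 isT.
Definition x1 : 'I_7 := @Ordinal 7 4 isT.
Definition x2 : 'I_7 := @Ordinal 7 5 isT.
Definition x3 : 'I_7 := @Ordinal 7 6 isT.

Notation "\rsum_ ( i < n ) F" := (\big[Rplus/0%R]_(i < n) F%R)
  (at level 41, F at level 41, i at level 50).

Fixpoint sum_idx (k : nat) (F : seq 'I_7 -> R) : R :=
  match k with
  | O => F [::]
  | S k' => \rsum_(i < 7) sum_idx k' (fun I => F (i :: I))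
  end.

(* A form is given by its components: for a k-form alpha and a multi-index
   I = [:: i1; ..; ik], [alpha I p] is alpha_p (d_i1, .., d_ik).  Components
   with multi-indices of any other length are irrelevant. *)
Definition form := seq 'I_7 -> pt -> R.

Definition form_eq (k : nat) (al be : form) : Prop :=
  forall I p, size I = k -> al I p = be I p.

Definition is_form (k : nat) (al : form) : Prop :=
  (forall I J a b p, size (I ++ a :: b :: J) = k ->
     al (I ++ a :: b :: J) p = - al (I ++ b :: a :: J) p) /\
  (forall I, size I = k ->
     smooth_on (fun _ : pt => True) (al I) /\
     forall p i, al I (upd p i (p i + 1)) = al I p).

Definition del (b : nat) (I : seq 'I_7) : seq 'I_7 := take b I ++ drop b.+1 I.

(* (dx^i /\ alpha) (d_I) = sum_b (-1)^b dx^i(d_{I_b}) alpha (d_{I minus I_b}) *)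
Definition wedge1 (i : 'I_7) (al : form) : form := fun I p =>
  \rsum_(b < size I)
     ((-1) ^ b * (if nth x0 I b == i then 1 else 0) * al (del b I) p).

(* dx^{i1 .. ik} *)
Definition dx (I : seq 'I_7) : form :=
  foldr wedge1 (fun J _ => if J is [::] then 1 else 0) I.

(* exterior derivative, d alpha = sum_i dx^i /\ d_i alpha *)
Definition ext (al : form) : form := fun I p =>
  \rsum_(b < size I)
     ((-1) ^ b * partial (nth x0 I b) (al (del b I)) p).

Definition exact_form (k : nat) (al : form) : Prop :=
  exists eta : form, is_form k.-1 eta /\ form_eq k al (ext eta).

Definition torus_int (F : pt -> R) : R :=
  foldr (fun i (H : pt -> R) p => RInt (fun t => H (upd p i t)) 0 1)
        F (enum 'I_7) (fun _ => 0).

Definition sgn_idx (I : seq 'I_7) : R :=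
  foldr Rmult 1
    [seq sign (INR (nth x0 I b) - INR (nth x0 I a))
      | b <- seq.iota 0 (size I), a <- seq.iota 0 b].

(* B_ij is the coefficient of d theta^{123} /\ dx^{0123} in
   (1/6) (i_{d_i} phi) /\ (i_{d_j} phi) /\ phi. *)
Definition g2_B (phi : form) (p : pt) : 'M[R]_7 :=
  \matrix_(i < 7, j < 7)
    (/ 144 * sum_idx 7 (fun K =>
       let k := nth x0 K in
       sgn_idx K * phi [:: i; k 0%nat; k 1%nat] p * phi [:: j; k 2%nat; k 3%nat] p
         * phi [:: k 4%nat; k 5%nat; k 6%nat] p)).

(* B = sqrt (det g_phi) g_phi, hence det B = (det g_phi)^{9/2} *)
Definition g2_metric (phi : form) (p : pt) : 'M[R]_7 :=
  \matrix_(i < 7, j < 7)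
    (g2_B phi p i j / Rpower (determinant (g2_B phi p)) (1 / 9)).

Definition g2_vol (phi : form) (p : pt) : R :=
  sqrt (determinant (g2_metric phi p)).

(* sum_J h_{i1 j1} .. h_{ik jk} al_{j1 .. jk}: raises all the indices when h is
   the inverse metric, and lowers them when h is the metric *)
Fixpoint contract (h : 'M[R]_7) (I : seq 'I_7) (al : seq 'I_7 -> R) : R :=
  match I with
  | [::] => al [::]
  | i :: I' => \rsum_(j < 7) (h i j * contract h I' (fun J => al (j :: J)))
  end.

Definition raise (phi al : form) : form := fun I p =>
  contract (invmx (g2_metric phi p)) I (fun J => al J p).

Definition lower (phi al : form) : form := fun I p =>
  contract (g2_metric phi p) I (fun J => al J p).

(* pointwise inner product of k-forms, normalised so that the dx^{i1 .. ik},
   i1 < .. < ik, are orthonormal for the Euclidean metric *)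
Definition inner (phi : form) (k : nat) (al be : form) (p : pt) : R :=
  / INR (k`!)%nat * sum_idx k (fun I => al I p * raise phi be I p).

(* the codifferential (formal adjoint of d),
   (delta al)^I = - (1/sqrt(det g)) sum_i d_i (sqrt(det g) al^{i I}) *)
Definition codiff (phi al : form) : form :=
  lower phi (fun I p =>
    - / g2_vol phi p *
      \rsum_(i < 7)
        partial i (fun q => g2_vol phi q * raise phi al (i :: I) q) p).

Definition laplacian (phi al : form) : form := fun I p =>
  ext (codiff phi al) I p + codiff phi (ext al) I p.

(* The d-exact 3-form with Laplacian X.  Two such forms have the same
   codifferential, so that [dirichlet] does not depend on the choice. *)
Definition exact_potential (phi X : form) : form :=
  epsilon (inhabits (fun _ _ => 0 : R)) (fun w : form =>
    is_form 3 w /\ exact_form 3 w /\ form_eq 3 (laplacian phi w) X).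

Definition dirichlet (phi X Y : form) : R :=
  torus_int (fun p =>
    inner phi 2 (codiff phi (exact_potential phi X))
                (codiff phi (exact_potential phi Y)) p * g2_vol phi p).

Definition circle_fun (f : R -> R) : Prop :=
  (forall n x, ex_derive_n f n x) /\ (forall x, f (x + 1) = f x).

Definition M1 (u : R -> R) : Prop :=
  circle_fun u /\ (forall x, 0 < u x) /\ RInt u 0 1 = 1.

(* C_0^infinity (S^1), the tangent space of M_1 at each of its points *)
Definition tangent (f : R -> R) : Prop := circle_fun f /\ RInt f 0 1 = 0.

Definition phi_of (u : R -> R) : form := fun I p =>
  dx [:: th1; th2; th3] I p
  - (dx [:: th1; x0; x1] I p + dx [:: th1; x2; x3] I p)
  - (dx [:: th2; x0; x2] I p + dx [:: th2; x3; x1] I p)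
  - (u (p x0) * dx [:: th3; x0; x3] I p + dx [:: th3; x1; x2] I p).

Definition tangent_form (f : R -> R) : form := fun I p =>
  - (f (p x0) * dx [:: th3; x0; x3] I p).

Definition G (u f g : R -> R) : R :=
  dirichlet (phi_of u) (tangent_form f) (tangent_form g).

Definition Vol (u : R -> R) : R := RInt (fun x => Rpower (u x) (1 / 3)) 0 1.

(* M_1 is an open subset of an affine space over C_0^infinity, so a connection
   is given by its Christoffel map Gam:
   (nabla_X Y)(u) = D_{X(u)} Y (u) + Gam_u (X(u), Y(u)).                     *)

Definition fadd (f g : R -> R) : R -> R := fun x => f x + g x.
Definition fscal (a : R) (f : R -> R) : R -> R := fun x => a * f x.

Definition christoffel := (R -> R) -> (R -> R) -> (R -> R) -> R -> R.

Definition is_levi_civita (Gam : christoffel) : Prop :=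
  forall u, M1 u -> forall f g h, tangent f -> tangent g -> tangent h ->
  [/\ tangent (Gam u f g),
      forall a x,
        Gam u (fadd (fscal a f) g) h x = a * Gam u f h x + Gam u g h x,
      forall x, Gam u f g x = Gam u g f x
    & is_derive (fun e => G (fadd u (fscal e f)) g h) 0
        (G u (Gam u f g) h + G u g (Gam u f h))].

Definition LC : christoffel :=
  epsilon (inhabits (fun _ _ _ _ => 0)) is_levi_civita.

(* R(f,g)h = nabla_f nabla_g h - nabla_g nabla_f h, for f, g, h extended to
   constant (in particular commuting) vector fields on M_1 *)
Definition curvature (u f g h : R -> R) : R -> R := fun x =>
  Derive (fun e => LC (fadd u (fscal e f)) g h x) 0
  - Derive (fun e => LC (fadd u (fscal e g)) f h x) 0
  + LC u f (LC u g h) x - LC u g (LC u f h) x.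

Definition lin_indep (f g : R -> R) : Prop :=
  forall a b : R, (forall x, a * f x + b * g x = 0) -> a = 0 /\ b = 0.

Definition sectional (u f g : R -> R) : R :=
  G u (curvature u f g g) f / (G u f f * G u g g - (G u f g) ^ 2).

Definition is_interval (J : R -> Prop) : Prop :=
  forall a b c, J a -> J b -> a <= c <= b -> J c.

Definition path_in_M1 (J : R -> Prop) (u : R -> R -> R) : Prop :=
  smooth_on (fun p : 'I_2 -> R => J (p (i0 1))) (fun p => u (p (i0 1)) (p (i1 0)))
  /\ forall t, J t -> M1 (u t).

Definition velocity (u : R -> R -> R) (t : R) : R -> R :=
  fun x => Derive (fun t' => u t' x) t.

(* The equation is nabla_{u_t} u_t = 0. *)
Definition canonical_geodesic (J : R -> Prop) (u : R -> R -> R) : Prop :=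
  path_in_M1 J u /\
  forall t, J t ->
    tangent (velocity u t) /\
    forall x, Derive_n (fun t' => u t' x) 2 t
              + LC (u t) (velocity u t) (velocity u t) x = 0.

(* v is the gradient of F at u with respect to G: dF_u (h) = G_u (v, h) *)
Definition is_gradient (F : (R -> R) -> R) (u v : R -> R) : Prop :=
  tangent v /\
  forall h, tangent h -> is_derive (fun e => F (fadd u (fscal e h))) 0 (G u v h).

(* u t s x, for t in J and s in [0,1]: at each s a gradient flow line of Vol *)
Definition gradient_flow_family (J : R -> Prop) (u : R -> R -> R -> R) : Prop :=
  smooth_on (fun p : 'I_3 -> R => J (p (i0 2)) /\ 0 <= p (i1 1) <= 1)
            (fun p => u (p (i0 2)) (p (i1 1)) (p (i2 0)))
  /\ forall t s, J t -> 0 <= s <= 1 ->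
       M1 (u t s) /\ is_gradient Vol (u t s) (velocity (fun t' => u t' s) t).

Definition path_length (c : R -> R -> R) : R :=
  RInt (fun s => sqrt (G (c s) (velocity c s) (velocity c s))) 0 1.

(* Main.v *)
Require Import Defs.
From mathcomp Require Import all_boot all_algebra Rstruct.
From Stdlib Require Import Reals Psatz FunctionalExtensionality ClassicalEpsilon.
From Coquelicot Require Import Coquelicot.

Set Implicit Arguments.
Unset Strict Implicit.
Unset Printing Implicit Defensive.

Open Scope R_scope.

(* Everything reduces to the circle.  For phi_u the G2-metric is diagonal, with
   entries u^(2/3) on theta^3, x^0, x^3 and u^(-1/3) on the other coordinates, and
   volume density u^(1/3).  Adjointness of d and the codifferential shows that the
   Dirichlet metric may be computed with any d-exact solution of the Laplace
   equation, and an explicit one, h(x^0) dx^0 /\ dtheta^3 /\ dx^3, gives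
   G(f, g) = int Q(f) Q(g) / u.
   The Koszul identities then determine the connection,
   Gamma(f, g) = - (Q(f) Q(g) / u)''.  The local terms of the curvature cancel; what
   remains comes from the u-dependence of the constant in Q, whose derivative is
   q(f, g) = int f Q(g) / u^2 / int 1 / u, and
   G(R(f, g) g, f) = (3/4) (int 1 / u) (q(f, g) - q(g, f))^2.
   Along a geodesic, Vol'' = - (2/9) int u^(-5/3) (f - Q(f) u' / u)^2, and along the
   gradient flow u_t = (2/3) (u^(1/3))'' a variation field w satisfies
   d/dt G(w, w) = - (4/9) int u^(1/3) ((Q(w) / u)')^2. *)

(** * Smooth functions on the circle *)

(** The potential and the connection enter through [epsilon], so an explicit witness helps only
    together with an argument that every admissible choice gives the same value. Another obstacle is
    that the constant in Q(f) depends on u non-locally. For first derivatives of the metric it is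
    avoided by writing G as a covariance for the density 1/u, which does not see constants added to
    the primitives: a primitive normalised at one u is kept fixed while u moves, and the correction
    term vanishes to second order. For the curvature Q itself must be differentiated, but it moves
    only by constants in x. Finally, J and [0, 1] may contain end points. Smoothness holds in a
    neighbourhood of them, so that derivatives are two-sided, whereas periodicity, positivity, unit
    mass and the flow equation are known on the set alone. Off the set, positivity is recovered from
    continuity and compactness, and identities valid only for s in [0, 1] are differentiated by
    stepping inwards. *)

Definition smooth1 (f : R -> R) : Prop := forall n x, ex_derive_n f n x.

(** Reduces smoothness to a one-step check: a class stable under [Derive] replaces formulas for the
    higher derivatives of products and powers. *)
Lemma smooth1_stable (C : (R -> R) -> Prop) :
  (forall f, C f -> (forall x, ex_derive f x) /\ C (Derive f)) ->
  forall f, C f -> smooth1 f.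
Proof.
move=> HC f Cf.
have CD : forall n, C (Derive_n f n).
  by elim=> [//|n IH] /=; case: (HC _ IH).
by case=> [//|n] x /=; case: (HC _ (CD n)).
Qed.

Lemma smooth1_ex_derive f x : smooth1 f -> ex_derive f x.
Proof. by move=> /(_ 1%nat x). Qed.

Lemma smooth1_Derive f : smooth1 f -> smooth1 (Derive f).
Proof.
move=> Hf [//|n] x /=.
apply: (ex_derive_ext (Derive_n f n.+1)); last exact: (Hf n.+2 x).
move=> t; have := Derive_n_comp f n 1 t; rewrite plusE addn1; exact: esym.
Qed.

Lemma is_derive_Rpower c x :
  0 < x -> is_derive (fun y => Rpower y c) x (c * Rpower x (c - 1)).
Proof.
move=> x0; apply/is_derive_Reals; exact: derivable_pt_lim_power.
Qed.

(* Closed under [Derive], so that all its elements are smooth. *)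
Inductive smooth1_alg : (R -> R) -> Prop :=
| alg_base f : smooth1 f -> smooth1_alg f
| alg_plus f g : smooth1_alg f -> smooth1_alg g -> smooth1_alg (fun x => f x + g x)
| alg_mult f g : smooth1_alg f -> smooth1_alg g -> smooth1_alg (fun x => f x * g x)
| alg_power f c : smooth1_alg f -> (forall x, 0 < f x) ->
    smooth1_alg (fun x => Rpower (f x) c).

Lemma smooth1_const c : smooth1 (fun _ => c).
Proof. by move=> n x; apply: ex_derive_n_const. Qed.

Lemma smooth1_alg_smooth f : smooth1_alg f -> smooth1 f.
Proof.
apply: smooth1_stable => {}f; elim=> {f}.
- by move=> f sf; split=> [x|]; [exact: smooth1_ex_derive|apply/alg_base/smooth1_Derive].
- move=> f g sf [df Df] sg [dg Dg]; split=> [x|].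
    by apply: ex_derive_plus.
  have -> : Derive (fun x => f x + g x) = fun x => Derive f x + Derive g x.
    by apply: functional_extensionality => x; rewrite Derive_plus.
  exact: alg_plus.
- move=> f g sf [df Df] sg [dg Dg]; split=> [x|].
    by apply: ex_derive_mult.
  have -> : Derive (fun x => f x * g x) = fun x => Derive f x * g x + f x * Derive g x.
    by apply: functional_extensionality => x; rewrite Derive_mult.
  by apply: alg_plus; apply: alg_mult.
- move=> f c sf [df Df] f0.
  have H : forall x, is_derive (fun x => Rpower (f x) c) x
                      (Derive f x * (c * Rpower (f x) (c - 1))).
    move=> x; apply: (is_derive_comp (fun y => Rpower y c)).
      exact: is_derive_Rpower.
    exact: Derive_correct.
  split=> [x|]; first by eexists; exact: H.
  have -> : Derive (fun x => Rpower (f x) c) =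
            fun x => Derive f x * (c * Rpower (f x) (c - 1)).
    by apply: functional_extensionality => x; exact: is_derive_unique.
  apply: alg_mult => //; apply: alg_mult; last exact: alg_power.
  exact/alg_base/smooth1_const.
Qed.

Lemma smooth1_plus f g : smooth1 f -> smooth1 g -> smooth1 (fun x => f x + g x).
Proof. by move=> sf sg; apply/smooth1_alg_smooth/alg_plus; apply: alg_base. Qed.

Lemma smooth1_mult f g : smooth1 f -> smooth1 g -> smooth1 (fun x => f x * g x).
Proof. by move=> sf sg; apply/smooth1_alg_smooth/alg_mult; apply: alg_base. Qed.

Lemma smooth1_Rpower f c :
  smooth1 f -> (forall x, 0 < f x) -> smooth1 (fun x => Rpower (f x) c).
Proof. by move=> sf f0; apply/smooth1_alg_smooth/alg_power => //; apply: alg_base. Qed.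

Lemma circ_const c : circle_fun (fun _ => c).
Proof. by split=> //; exact: smooth1_const. Qed.

Lemma circ_plus f g : circle_fun f -> circle_fun g -> circle_fun (fun x => f x + g x).
Proof. by case=> sf pf [sg pg]; split=> [|x]; [exact: smooth1_plus|rewrite pf pg]. Qed.

Lemma circ_mult f g : circle_fun f -> circle_fun g -> circle_fun (fun x => f x * g x).
Proof. by case=> sf pf [sg pg]; split=> [|x]; [exact: smooth1_mult|rewrite pf pg]. Qed.

Lemma circ_opp f : circle_fun f -> circle_fun (fun x => - f x).
Proof.
move=> cf; have -> : (fun x => - f x) = (fun x => -1 * f x).
  by apply: functional_extensionality => x; ring.
exact: circ_mult (circ_const _) cf.
Qed.

Lemma circ_minus f g : circle_fun f -> circle_fun g -> circle_fun (fun x => f x - g x).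
Proof. by move=> cf cg; apply: circ_plus => //; exact: circ_opp. Qed.

Lemma circ_Rpower f c :
  circle_fun f -> (forall x, 0 < f x) -> circle_fun (fun x => Rpower (f x) c).
Proof. by case=> sf pf f0; split=> [|x]; [exact: smooth1_Rpower|rewrite pf]. Qed.

Lemma Rpower_m1 x : 0 < x -> Rpower x (-1) = / x.
Proof. by move=> x0; rewrite Rpower_Ropp Rpower_1. Qed.

Lemma circ_inv f :
  circle_fun f -> (forall x, 0 < f x) -> circle_fun (fun x => / f x).
Proof.
move=> cf f0; have -> : (fun x => / f x) = (fun x => Rpower (f x) (-1)).
  by apply: functional_extensionality => x; rewrite Rpower_m1.
exact: circ_Rpower.
Qed.

Lemma circ_div f g :
  circle_fun f -> circle_fun g -> (forall x, 0 < g x) -> circle_fun (fun x => f x / g x).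
Proof. by move=> cf cg g0; apply: circ_mult => //; exact: circ_inv. Qed.

Lemma circ_ex_derive f x : circle_fun f -> ex_derive f x.
Proof. by case=> sf _; exact: smooth1_ex_derive. Qed.

Lemma circ_is_derive f x : circle_fun f -> is_derive f x (Derive f x).
Proof. by move=> cf; apply/Derive_correct/circ_ex_derive. Qed.

Lemma circ_Derive f : circle_fun f -> circle_fun (Derive f).
Proof.
case=> sf pf; split; first exact: smooth1_Derive.
move=> x; rewrite -[in RHS](functional_extensionality _ _ pf).
have D : is_derive (fun y => f (y + 1)) x (1 * Derive f (x + 1)).
  apply: (is_derive_comp f (fun y => y + 1)); last by auto_derive.
  exact/Derive_correct/smooth1_ex_derive.
by rewrite (is_derive_unique _ _ _ D) Rmult_1_l.
Qed.

Lemma circ_continuous f x : circle_fun f -> continuous f x.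
Proof. by move=> cf; apply/ex_derive_continuous/circ_ex_derive. Qed.

Lemma circ_ex_RInt f a b : circle_fun f -> ex_RInt f a b.
Proof. by move=> cf; apply: ex_RInt_continuous => z _; exact: circ_continuous. Qed.

Lemma circ_period f n x : circle_fun f -> f (x + INR n) = f x.
Proof.
case=> _ pf; elim: n => [|n IH]; first by rewrite Rplus_0_r.
by rewrite S_INR -Rplus_assoc pf.
Qed.

(** Transfers compactness of [0, 1] to the whole line, which yields the global bounds below. *)
Lemma circ_frac f x : circle_fun f -> exists y, 0 <= y <= 1 /\ f x = f y.
Proof.
move=> cf; have [H1 H2] := base_Int_part x.
exists (x - IZR (Int_part x)); split; first lra.
case: (Int_part x) H1 H2 => [|p|p] H1 H2.
- by rewrite Rminus_0_r.
- have -> : x = x - IZR (Zpos p) + INR (Pos.to_nat p).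
    by rewrite INR_IZR_INZ Znat.positive_nat_Z; ring.
  by rewrite circ_period // INR_IZR_INZ Znat.positive_nat_Z; congr (f _); ring.
- by rewrite -(circ_period (Pos.to_nat p) x) // INR_IZR_INZ Znat.positive_nat_Z;
     congr (f _); rewrite -[Z.neg p]/(Z.opp (Zpos p)) opp_IZR; ring.
Qed.

Lemma circ_bounded f : circle_fun f -> exists B, 0 < B /\ forall x, Rabs (f x) <= B.
Proof.
move=> cf.
have [|M [HM _]] := continuity_ab_maj (fun x => Rabs (f x)) 0 1 Rle_0_1.
  move=> c _; apply/continuity_pt_filterlim.
  apply: (continuous_comp f Rabs); first exact: circ_continuous.
  exact: continuous_Rabs.
exists (Rabs (f M) + 1); split; first by have := Rabs_pos (f M); lra.
move=> x; have [y [Hy ->]] := circ_frac x cf.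
by have := HM y Hy; lra.
Qed.

Lemma circ_pos_min f : circle_fun f -> (forall x, 0 < f x) ->
  exists m, 0 < m /\ forall x, m <= f x.
Proof.
move=> cf f0.
have [|M [HM _]] := continuity_ab_min f 0 1 Rle_0_1.
  by move=> c _; apply/continuity_pt_filterlim; exact: circ_continuous.
exists (f M); split=> // x; have [y [Hy ->]] := circ_frac x cf.
exact: HM.
Qed.

Lemma circ_RInt_Derive f : circle_fun f -> RInt (Derive f) 0 1 = 0.
Proof.
move=> cf; rewrite RInt_Derive.
- by have := circ_period 1 0 cf; rewrite /= Rplus_0_l => ->; ring.
- by move=> x _; exact: circ_ex_derive.
- by move=> x _; apply: circ_continuous; exact: circ_Derive.
Qed.

Lemma circ_RInt_is_derive f g : circle_fun f ->
  (forall x, is_derive f x (g x)) -> RInt g 0 1 = 0.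
Proof.
move=> cf fg; rewrite -[RHS](circ_RInt_Derive cf).
by apply: RInt_ext => x _; rewrite (is_derive_unique _ _ _ (fg x)).
Qed.

Lemma RInt_lin (f g : R -> R) a b l m : ex_RInt f a b -> ex_RInt g a b ->
  RInt (fun x => l * f x + m * g x) a b = l * RInt f a b + m * RInt g a b.
Proof.
move=> If Ig.
rewrite (RInt_plus (fun x => l * f x) (fun x => m * g x)).
- by rewrite (RInt_scal f a b l) // (RInt_scal g a b m).
- exact: (@ex_RInt_scal R_NormedModule).
- exact: (@ex_RInt_scal R_NormedModule).
Qed.

Lemma circ_RInt_lin f g l m : circle_fun f -> circle_fun g ->
  RInt (fun x => l * f x + m * g x) 0 1 = l * RInt f 0 1 + m * RInt g 0 1.
Proof. by move=> cf cg; apply: RInt_lin; exact: circ_ex_RInt. Qed.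

Lemma circ_RInt_scal f l : circle_fun f ->
  RInt (fun x => l * f x) 0 1 = l * RInt f 0 1.
Proof. by move=> cf; apply: (RInt_scal f); exact: circ_ex_RInt. Qed.

Lemma RInt_ge0 f : (forall x, 0 <= f x) -> ex_RInt f 0 1 -> 0 <= RInt f 0 1.
Proof. by move=> f0 If; apply: RInt_ge_0 => //; lra. Qed.

(* The derivative of the nondecreasing primitive of f vanishes on (0, 1). *)
Lemma circ_RInt_eq0 f : circle_fun f -> (forall x, 0 <= f x) ->
  RInt f 0 1 = 0 -> forall x, f x = 0.
Proof.
move=> cf f0 If.
have f0i : forall y, 0 < y < 1 -> f y = 0.
  move=> y Hy; apply: Rle_antisym => //.
  have H0 : forall z, 0 < z < 1 -> RInt f 0 z = 0.
    move=> z Hz; apply: Rle_antisym.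
      have := RInt_Chasles f 0 z 1 (circ_ex_RInt 0 z cf) (circ_ex_RInt z 1 cf).
      have : 0 <= RInt f z 1.
        by apply: RInt_ge_0 => //; [lra|exact: circ_ex_RInt].
      by rewrite If /plus /=; lra.
    by apply: RInt_ge_0 => //; [lra|exact: circ_ex_RInt].
  have D : is_derive (RInt f 0) y (f y).
    apply: (is_derive_RInt f _ 0); last exact: circ_continuous.
    by exists (mkposreal 1 Rlt_0_1) => z _; apply/RInt_correct/circ_ex_RInt.
  have D0 : is_derive (RInt f 0) y 0.
    apply: (@is_derive_ext_loc _ _ (fun _ : R => 0)); last by auto_derive.
    have [d Hd] : locally y (fun z => 0 < z < 1).
      by apply: (locally_interval _ y 0 1) => /= *; lra.
    by exists d => z /Hd/H0.
  by have := is_derive_unique _ _ _ D; rewrite (is_derive_unique _ _ _ D0) => <-; lra.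
suff f00 : f 0 = 0.
  move=> x; have [y [Hy ->]] := circ_frac x cf.
  have f1 : f 1 = 0 by have := circ_period 1 0 cf; rewrite /= Rplus_0_l => ->.
  have [->|y0] := Req_dec y 0; first by [].
  have [->|y1] := Req_dec y 1; first by [].
  by apply: f0i; lra.
(* A positive value at 0 would persist at some small z > 0, where [f0i] gives f z = 0. *)
case: (Req_dec (f 0) 0) => // fn0.
have fp : 0 < f 0 by have := f0 0; lra.
have [d Hd] : locally 0 (fun z => 0 < f z).
  have := @circ_continuous f 0 cf; rewrite /continuous => /filterlim_locally.
  move=> /(_ (mkposreal _ fp)); apply: filter_imp => z.
  by rewrite /ball /= /AbsRing_ball /abs /minus /plus /opp /= => /Rabs_def2; lra.
have dp := cond_pos d.
set z := Rmin (d / 2) (1 / 2).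
have zp : 0 < z by apply: Rmin_pos; lra.
have zd : z <= d / 2 by exact: Rmin_l.
have z1 : z <= 1 / 2 by exact: Rmin_r.
have := Hd z; rewrite f0i; last by lra.
move=> H; suff : 0 < 0 by lra.
by apply: H; rewrite /ball /= /AbsRing_ball /abs /minus /plus /opp /= Rabs_pos_eq; lra.
Qed.

Definition prim (f : R -> R) (x : R) : R := RInt f 0 x.

Lemma prim_is_derive f x : circle_fun f -> is_derive (prim f) x (f x).
Proof.
move=> cf; apply: (is_derive_RInt f _ 0); last exact: circ_continuous.
by exists (mkposreal 1 Rlt_0_1) => z _; apply/RInt_correct/circ_ex_RInt.
Qed.

(** F(z + 1) - F(z) has derivative zero by periodicity of f, so it keeps its value F 1 - F 0 = 0. *)
Lemma circ_of_derive F f : circle_fun f -> (forall x, is_derive F x (f x)) ->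
  F 1 = F 0 -> circle_fun F.
Proof.
move=> cf FD F1; split.
  case=> [//|[|n]] x; first by exists (f x).
  have E : forall k y, Derive_n F k.+1 y = Derive_n f k y.
    elim=> [|k IH] y; first exact: is_derive_unique.
    by apply: Derive_ext => z; exact: IH.
  apply: (ex_derive_ext (Derive_n f n)); first by move=> t; rewrite -E.
  by case: cf => /(_ n.+1 x).
move=> x.
have D : forall y, is_derive (fun z => F (z + 1) - F z) y 0.
  move=> y; have -> : 0 = 1 * f (y + 1) - f y by case: cf => _ ->; ring.
  apply: (is_derive_minus (fun z => F (z + 1)) F) => //.
  apply: (is_derive_comp F (fun z => z + 1)) => //.
  by auto_derive.
have [||c [_]] := MVT_gen (fun z => F (z + 1) - F z) 0 x (fun _ => 0) => //.
  move=> y _; apply/continuity_pt_filterlim.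
  exact: (@ex_derive_continuous _ _ (fun z => F (z + 1) - F z) y (ex_intro _ _ (D y))).
by rewrite Rplus_0_l F1; lra.
Qed.

Lemma tangent_prim f : tangent f -> circle_fun (prim f).
Proof.
case=> cf f0; apply: (circ_of_derive cf).
  by move=> x; exact: prim_is_derive.
by rewrite /prim f0 RInt_point.
Qed.

Lemma tangent_Derive f : circle_fun f -> tangent (Derive f).
Proof. by move=> cf; split; [exact: circ_Derive|exact: circ_RInt_Derive]. Qed.

(** * Integrals depending on a parameter *)

Lemma ball_R (x : R) (e : R) y : ball x e y <-> Rabs (y - x) < e.
Proof. by []. Qed.

(** The tube lemma: compactness of [a, b] lets one neighbourhood of t serve all x. The radius must
    be a total function for [compactness_value_1d], hence the arbitrary value 1 outside [a, b]. *)
Lemma tube (T : UniformSpace) (P : T -> R -> Prop) (t : T) a b :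
  (forall x, a <= x <= b -> locally ((t, x) : T * R) (fun p => P p.1 p.2)) ->
  locally t (fun t' => forall x, a <= x <= b -> P t' x).
Proof.
move=> H.
have H' : forall x, exists d : posreal, a <= x <= b ->
    forall t' x', ball t d t' -> Rabs (x' - x) < d -> P t' x'.
  move=> x; case: (excluded_middle_informative (a <= x <= b)) => Hx.
    have [d Hd] := H x Hx; exists d => _ t' x' Ht Hx'.
    by apply: (Hd (t', x')); split.
  by exists (mkposreal 1 Rlt_0_1).
pose delta x := proj1_sig (constructive_indefinite_description _ (H' x)).
have Hdelta x := proj2_sig (constructive_indefinite_description _ (H' x)).
have [d Hd] := compactness_value_1d a b delta.
exists d => t' Ht' x Hx; apply: NNPP => nP.
apply: (Hd x Hx) => -[y [Hy [xy dy]]]; apply: nP.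
apply: (Hdelta y Hy) => //; exact: ball_le Ht'.
Qed.

(** The parameter space is left general because it will be both a plane of pairs (t, x) and R^n. *)
Lemma RInt_param_continuous (T : UniformSpace) (f : T -> R -> R) (t : T) :
  (forall x, 0 <= x <= 1 -> continuous (fun p : T * R => f p.1 p.2) (t, x)) ->
  locally t (fun t' => ex_RInt (f t') 0 1) ->
  continuous (fun t' => RInt (f t') 0 1) t.
Proof.
move=> fc fI; apply/filterlim_locally => eps.
have e2 : 0 < eps / 2 by have := cond_pos eps; lra.
have e4 : 0 < eps / 4 by have := cond_pos eps; lra.
have It : ex_RInt (f t) 0 1 := locally_singleton _ _ fI.
have := @tube T (fun t' x => Rabs (f t' x - f t x) <= eps / 2) t 0 1.
case=> [x Hx|d Hd].
  have /filterlim_locally /(_ (mkposreal _ e4)) [d Hd] := fc x Hx.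
  exists d => -[t' x'] [/= Ht Hx'].
  have A := Hd (t', x') (conj Ht Hx').
  have B := Hd (t, x') (conj (ball_center _ _) Hx').
  move: A B; rewrite !ball_R /= => /Rabs_def2 A /Rabs_def2 B.
  by apply: Rabs_le; lra.
case: fI => d' Hd'.
exists (mkposreal _ (Rmin_stable_in_posreal d d')) => t' Ht'.
have It' : ex_RInt (f t') 0 1.
  by apply: Hd'; apply: ball_le Ht'; exact: Rmin_r.
apply/ball_R.
have <- : RInt (fun x => f t' x - f t x) 0 1 = RInt (f t') 0 1 - RInt (f t) 0 1.
  exact: (RInt_minus (f t') (f t)).
have := abs_RInt_le_const (fun x => f t' x - f t x) 0 1 (eps / 2) Rle_0_1.
move=> /(_ (ex_RInt_minus (f t') (f t) 0 1 It' It)) H.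
apply: Rle_lt_trans (H _) _; last by lra.
by move=> x Hx; apply: Hd => //; apply: ball_le Ht'; exact: Rmin_l.
Qed.

(** * Families that are C^1 in a parameter *)

Definition Dt (h : R -> R -> R) : R -> R -> R := fun t x => Derive (fun z => h z x) t.

Definition c1_at (h : R -> R -> R) (t x : R) : Prop :=
  ex_derive (fun z => h z x) t /\ continuity_2d_pt h t x /\ continuity_2d_pt (Dt h) t x.

(** Demanded near the point because differentiation under the integral needs the derivative at all
    nearby parameters, and because an open condition can be passed to [tube]. *)
Definition c1_near (h : R -> R -> R) (t x : R) : Prop := locally_2d (c1_at h) t x.

Lemma locally_2dP (P : R -> R -> Prop) t x :
  locally_2d P t x <-> locally ((t, x) : R * R) (fun p => P p.1 p.2).
Proof. by split=> /locally_2d_locally. Qed.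

Lemma locally_2d_near (P : R -> R -> Prop) t x :
  locally_2d P t x -> locally_2d (fun t' x' => locally_2d P t' x') t x.
Proof. by apply: locally_2d_impl_strong; apply: locally_2d_forall. Qed.

Lemma c1_near_at h t x : c1_near h t x -> c1_at h t x.
Proof. exact: locally_2d_singleton. Qed.

Lemma c1_at_is_derive h t x : c1_at h t x -> is_derive (fun z => h z x) t (Dt h t x).
Proof. by case=> ? _; exact: Derive_correct. Qed.

Lemma c1_near_intro h dh t x :
  locally_2d (fun t' x' => is_derive (fun z => h z x') t' (dh t' x')) t x ->
  locally_2d (fun t' x' => continuity_2d_pt h t' x' /\ continuity_2d_pt dh t' x') t x ->
  c1_near h t x.
Proof.
move=> /locally_2d_near H1; apply: locally_2d_impl; move: H1.
apply: locally_2d_impl; apply: locally_2d_forall => t' x' D [Ch Cdh].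
split; [|split] => //.
  by exists (dh t' x'); exact: locally_2d_singleton D.
apply: continuity_2d_pt_ext_loc Cdh.
apply: locally_2d_impl D; apply: locally_2d_forall => t'' x'' D.
by rewrite /Dt (is_derive_unique _ _ _ D).
Qed.

Lemma c1_near_plus h k t x : c1_near h t x -> c1_near k t x ->
  c1_near (fun t x => h t x + k t x) t x.
Proof.
move=> Hh Hk; have H := locally_2d_and _ _ _ _ Hh Hk.
apply: (@c1_near_intro _ (fun t x => Dt h t x + Dt k t x));
  apply: locally_2d_impl H; apply: locally_2d_forall => t' x' [[dh [ch cdh]] [dk [ck cdk]]].
  by apply: is_derive_plus; exact: Derive_correct.
by split; exact: continuity_2d_pt_plus.
Qed.

Lemma c1_near_mult h k t x : c1_near h t x -> c1_near k t x ->
  c1_near (fun t x => h t x * k t x) t x.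
Proof.
move=> Hh Hk; have H := locally_2d_and _ _ _ _ Hh Hk.
apply: (@c1_near_intro _ (fun t x => Dt h t x * k t x + h t x * Dt k t x));
  apply: locally_2d_impl H; apply: locally_2d_forall => t' x' [[dh [ch cdh]] [dk [ck cdk]]].
  apply: (is_derive_mult (fun z => h z x') (fun z => k z x')).
  - exact: Derive_correct.
  - exact: Derive_correct.
  - by move=> *; exact: Rmult_comm.
split; first exact: continuity_2d_pt_mult.
by apply: continuity_2d_pt_plus; apply: continuity_2d_pt_mult.
Qed.

Lemma continuity_2d_pt_snd (k : R -> R) t x : continuous k x ->
  continuity_2d_pt (fun _ x => k x) t x.
Proof.
move=> kc; apply: (continuity_1d_2d_pt_comp k (fun _ x => x)).
  exact/continuity_pt_filterlim.
exact: continuity_2d_pt_id2.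
Qed.

Lemma c1_near_cst (k : R -> R) t x : (forall y, continuous k y) ->
  c1_near (fun _ x => k x) t x.
Proof.
move=> kc; apply: (@c1_near_intro _ (fun _ _ => 0)); apply: locally_2d_forall => t' x'.
  by auto_derive.
by split; [exact: continuity_2d_pt_snd|exact: continuity_2d_pt_const].
Qed.

Lemma c1_near_param (k : R -> R) t x :
  locally t (fun t => ex_derive k t /\ continuous (Derive k) t) ->
  c1_near (fun t _ => k t) t x.
Proof.
move=> Hk.
have H : locally_2d (fun t' _ => ex_derive k t' /\ continuous (Derive k) t') t x.
  by case: Hk => d Hd; exists d => u v Hu _; exact: Hd.
apply: (@c1_near_intro _ (fun t _ => Derive k t));
  apply: locally_2d_impl H; apply: locally_2d_forall => t' x' [dk ck].
  exact: Derive_correct.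
split.
  apply: (continuity_1d_2d_pt_comp k (fun t _ => t)); last exact: continuity_2d_pt_id1.
  by apply/continuity_pt_filterlim; exact: ex_derive_continuous.
apply: (continuity_1d_2d_pt_comp (Derive k) (fun t _ => t)); last exact: continuity_2d_pt_id1.
exact/continuity_pt_filterlim.
Qed.

Lemma continuity_2d_pt_pos h t x : continuity_2d_pt h t x -> 0 < h t x ->
  locally_2d (fun t x => 0 < h t x) t x.
Proof.
move=> ch hp; have [d Hd] := ch (mkposreal _ hp).
by exists d => u v Hu Hv; have := Hd u v Hu Hv => /= /Rabs_def2; lra.
Qed.

Lemma c1_near_Rpower h c t x : c1_near h t x -> 0 < h t x ->
  c1_near (fun t x => Rpower (h t x) c) t x.
Proof.
move=> Hh h0; have [_ [ch _]] := c1_near_at Hh.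
have H := locally_2d_and _ _ _ _ Hh (continuity_2d_pt_pos ch h0).
have P : forall c h t x, continuity_2d_pt h t x -> 0 < h t x ->
    continuity_2d_pt (fun t x => Rpower (h t x) c) t x.
  move=> {}c {}h {}t {}x {h0 H Hh} {}ch h0.
  apply: (continuity_1d_2d_pt_comp (fun y => Rpower y c)) => //.
  apply/continuity_pt_filterlim/(@ex_derive_continuous _ _ (fun y => Rpower y c)).
  by eexists; exact: is_derive_Rpower.
apply: (@c1_near_intro _ (fun t x => Dt h t x * (c * Rpower (h t x) (c - 1))));
  apply: locally_2d_impl H; apply: locally_2d_forall => t' x' [[dh [ch' cdh]] h0'].
  apply: (is_derive_comp (fun y => Rpower y c) (fun z => h z x')).
    exact: is_derive_Rpower.
  exact: Derive_correct.
split; first exact: P.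
apply: continuity_2d_pt_mult => //; apply: continuity_2d_pt_mult; last exact: P.
exact: continuity_2d_pt_const.
Qed.

Lemma c1_near_ext h k t x : locally_2d (fun t x => h t x = k t x) t x ->
  c1_near h t x -> c1_near k t x.
Proof.
move=> /locally_2d_near E H.
apply: (@c1_near_intro _ (Dt h));
  apply: locally_2d_impl H; apply: locally_2d_impl E;
  apply: locally_2d_forall => t' x' E [dh [ch cdh]].
  apply: (@is_derive_ext_loc _ _ (fun z => h z x')); last exact: Derive_correct.
  exact: locally_2d_1d_const_y E.
by split=> //; exact: continuity_2d_pt_ext_loc E ch.
Qed.

Lemma c1_near_inv h t x : c1_near h t x -> 0 < h t x ->
  c1_near (fun t x => / h t x) t x.
Proof.
move=> Hh h0; have [_ [ch _]] := c1_near_at Hh.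
apply: c1_near_ext (c1_near_Rpower (-1) Hh h0).
apply: locally_2d_impl (continuity_2d_pt_pos ch h0).
by apply: locally_2d_forall => t' x'; exact: Rpower_m1.
Qed.

Lemma c1_near_opp h t x : c1_near h t x -> c1_near (fun t x => - h t x) t x.
Proof.
move=> H; apply: (@c1_near_ext (fun t x => -1 * h t x)).
  by apply: locally_2d_forall => t' x'; ring.
apply: c1_near_mult => //; apply: (@c1_near_cst (fun _ => -1)) => y.
exact: continuous_const.
Qed.

Lemma c1_near_minus h k t x : c1_near h t x -> c1_near k t x ->
  c1_near (fun t x => h t x - k t x) t x.
Proof. by move=> Hh Hk; apply: c1_near_plus => //; exact: c1_near_opp. Qed.

Lemma c1_near_div h k t x : c1_near h t x -> c1_near k t x -> 0 < k t x ->
  c1_near (fun t x => h t x / k t x) t x.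
Proof. by move=> Hh Hk k0; apply: c1_near_mult => //; exact: c1_near_inv. Qed.

(* The hypothesis for differentiating [fun t => RInt (h t) 0 1] at t under the
   integral sign. *)
Definition c1_param (h : R -> R -> R) (t : R) : Prop :=
  forall x, 0 <= x <= 1 -> c1_near h t x.

Lemma c1_param_near h t : c1_param h t ->
  locally t (fun t' => forall x, 0 <= x <= 1 -> c1_near h t' x).
Proof.
move=> H; apply: (@tube R_UniformSpace (c1_near h)) => x Hx.
by apply/locally_2dP/locally_2d_near; exact: H.
Qed.

Lemma continuity_2d_pt_slice h t x : continuity_2d_pt h t x -> continuous (h t) x.
Proof.
move=> ch; apply/filterlim_locally => eps; have [d Hd] := ch eps.
by exists d => y Hy; apply: Hd => //; rewrite Rminus_diag Rabs_R0; exact: cond_pos.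
Qed.

Lemma c1_param_ex_RInt h t : c1_param h t -> ex_RInt (h t) 0 1.
Proof.
move=> H; apply: ex_RInt_continuous => x; rewrite Rmin_left ?Rmax_right; try lra.
by move=> /H/c1_near_at [_ [? _]]; exact: continuity_2d_pt_slice.
Qed.

Lemma c1_param_is_derive h t : c1_param h t ->
  is_derive (fun t => RInt (h t) 0 1) t (RInt (Dt h t) 0 1).
Proof.
move=> H; have Hn := c1_param_near H.
apply: (is_derive_RInt_param h); rewrite ?Rmin_left ?Rmax_right; try lra.
- by apply: filter_imp Hn => t' Ht x /Ht/c1_near_at [].
- by move=> x /H/c1_near_at [_ []].
- by apply: filter_imp Hn => t' Ht; exact: c1_param_ex_RInt.
Qed.

(* The substitution y = x s makes the domain of integration constant. *)
Lemma prim_rescale f x : (forall y, Rmin 0 x <= y <= Rmax 0 x -> continuous f y) ->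
  prim f x = x * RInt (fun s => f (x * s)) 0 1.
Proof.
move=> fc; have := RInt_comp_lin f x 0 0 1.
rewrite Rmult_0_r Rmult_1_r !Rplus_0_r => H.
rewrite /prim -H; last exact: ex_RInt_continuous.
rewrite -[RHS](RInt_scal (fun s => f (x * s)) 0 1 x).
  by apply: RInt_ext => s _; rewrite Rplus_0_r.
have [x0|x0] := Req_dec x 0.
  apply: (ex_RInt_ext (fun _ => f 0)); last exact: ex_RInt_const.
  by move=> s _; rewrite x0 Rmult_0_l.
have : ex_RInt (fun s => scal x (f (x * s + 0))) 0 1.
  apply: (ex_RInt_comp_lin f x 0 0 1); rewrite Rmult_0_r Rmult_1_r !Rplus_0_r.
  exact: ex_RInt_continuous.
move=> /(ex_RInt_scal _ _ _ (/ x)); apply: ex_RInt_ext => s _.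
by rewrite /scal /= /mult /= Rplus_0_r -Rmult_assoc Rinv_l // Rmult_1_l.
Qed.

Lemma continuous_pair (T : UniformSpace) (f g : T -> R) p :
  continuous f p -> continuous g p -> continuous (fun p => (f p, g p) : R * R) p.
Proof.
move=> cf cg; apply: (continuous_comp_2 f g (fun a b => (a, b))) => //.
by apply: (continuous_ext (fun p : R * R => p)); [case|exact: continuous_id].
Qed.

Lemma continuous_rescale t x s :
  continuous (fun p : (R * R) * R => (p.1.1, p.1.2 * p.2) : R * R) ((t, x), s).
Proof.
apply: continuous_pair.
  by apply: (continuous_comp fst fst); exact: continuous_fst.
apply: (continuous_mult (fun p : (R * R) * R => p.1.2) snd).
  by apply: (continuous_comp fst snd); [exact: continuous_fst|exact: continuous_snd].
exact: continuous_snd.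
Qed.

Lemma continuous_slice_rescale x t s :
  continuous (fun p : R * R => (p.1, x * p.2) : R * R) (t, s).
Proof.
apply: continuous_pair; first exact: continuous_fst.
apply: (continuous_mult (fun _ : R * R => x) snd); last exact: continuous_snd.
exact: continuous_const.
Qed.

Lemma continuity_2d_pt_rescale g x t s : continuity_2d_pt g t (x * s) ->
  continuity_2d_pt (fun t s => g t (x * s)) t s.
Proof.
move=> /continuity_2d_pt_filterlim cg; apply/continuity_2d_pt_filterlim.
exact: (filterlim_comp _ _ _ (fun p : R * R => (p.1, x * p.2))
  (fun p : R * R => g p.1 p.2) _ _ _ (@continuous_slice_rescale x t s) cg).
Qed.

Lemma continuity_2d_pt_RInt_rescale g t x :
  locally ((t, x) : R * R) (fun p => forall s, 0 <= s <= 1 ->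
      continuity_2d_pt g p.1 (p.2 * s)) ->
  continuity_2d_pt (fun t x => RInt (fun s => g t (x * s)) 0 1) t x.
Proof.
move=> Hg; apply/continuity_2d_pt_filterlim.
apply: (@RInt_param_continuous _ (fun (p : R * R) s => g p.1 (p.2 * s)) (t, x)).
  move=> s Hs; have := locally_singleton _ _ Hg s Hs => /continuity_2d_pt_filterlim cg.
  exact: (filterlim_comp _ _ _ (fun p : (R * R) * R => (p.1.1, p.1.2 * p.2))
    (fun p : R * R => g p.1 p.2) _ _ _ (@continuous_rescale t x s) cg).
apply: filter_imp Hg => -[t' x'] /= Hp.
apply: ex_RInt_continuous => s; rewrite Rmin_left ?Rmax_right; try lra.
move=> /Hp/continuity_2d_pt_slice cg.
apply: (continuous_comp (fun s => x' * s) (g t')) => //.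
by apply: continuous_mult; [exact: continuous_const|exact: continuous_id].
Qed.

(** Near (t, x) the primitive, whose upper limit moves, is replaced by x times an integral over
    [0, 1]; its t-derivative is then taken under the integral, and both are jointly continuous by
    [continuity_2d_pt_RInt_rescale]. *)
Lemma c1_param_prim h t : c1_param h t -> c1_param (fun t x => prim (h t) x) t.
Proof.
move=> H x Hx.
(* The segments from 0 to points x' near [0, 1] stay in the good region. *)
have Hn : locally ((t, x) : R * R) (fun p => forall s, 0 <= s <= 1 ->
    c1_near h p.1 (p.2 * s)).
  apply: (@tube _ (fun p s => c1_near h p.1 (p.2 * s))) => s Hs.
  have : 0 <= x * s <= 1 by nra.
  move=> /H/locally_2d_near/locally_2dP Hl.
  exact: (@continuous_rescale t x s) _ Hl.
have Hk : locally ((t, x) : R * R) (fun p => forall s, 0 <= s <= 1 ->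
    c1_near (fun t' s => h t' (p.2 * s)) p.1 s).
  apply: filter_imp Hn => -[t' x'] /= Hp s /Hp Hs.
  have Hs' : locally_2d (fun t'' s' => c1_at h t'' (x' * s')) t' s.
    move: Hs => /locally_2dP Hs; apply/locally_2dP.
    exact: (@continuous_slice_rescale x' t' s) _ Hs.
  apply: (@c1_near_intro _ (fun t s => Dt h t (x' * s)));
    apply: locally_2d_impl Hs'; apply: locally_2d_forall => t'' s' [dh [ch cdh]].
    exact: Derive_correct.
  by split; apply: continuity_2d_pt_rescale.
have HI : locally ((t, x) : R * R) (fun p =>
   is_derive (fun t => RInt (fun s => h t (p.2 * s)) 0 1) p.1
             (RInt (fun s => Dt h p.1 (p.2 * s)) 0 1)).
  by apply: filter_imp Hk => -[t' x'] /= Hp; exact: (c1_param_is_derive Hp).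
pose J (g : R -> R -> R) (t x : R) := x * RInt (fun s => g t (x * s)) 0 1.
have E : locally_2d (fun t x => J h t x = prim (h t) x) t x.
  apply/locally_2dP; apply: filter_imp Hn => -[t' x'] /= Hp.
  symmetry; apply: prim_rescale => y Hy.
  (* A neighbourhood of x reaches outside [0, 1], so x' may also be zero or negative. *)
  have [s [Hs ->]] : exists s, 0 <= s <= 1 /\ y = x' * s.
    have [x0|x0] := Req_dec x' 0.
      exists 0; move: Hy; rewrite x0 Rmin_left ?Rmax_left; lra.
    exists (y / x'); split; last by field.
    move: Hy; rewrite /Rmin /Rmax; case: Rle_dec => Hx0 [H1 H2].
      have x'0 : 0 < x' by lra.
      split; first by apply: Rle_mult_inv_pos.
      by apply/(Rmult_le_reg_r x') => //; rewrite /Rdiv Rmult_assoc Rinv_l; lra.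
    have -> : y / x' = (- y) / (- x') by field.
    have x'0 : 0 < - x' by lra.
    split; first by apply: Rle_mult_inv_pos; lra.
    by apply/(Rmult_le_reg_r (- x')) => //; rewrite /Rdiv Rmult_assoc Rinv_l; lra.
  by have /c1_near_at [_ [/continuity_2d_pt_slice]] := Hp s Hs.
apply: c1_near_ext E _; apply: c1_near_mult.
  apply: (@c1_near_cst (fun x => x)) => y; exact: continuous_id.
have Hn2 := locally_locally _ _ Hn.
apply: (@c1_near_intro _ (fun t x => RInt (fun s => Dt h t (x * s)) 0 1)).
  exact/locally_2dP.
apply/locally_2dP; apply: filter_imp Hn2 => -[t' x'] /= Hp; split.
  by apply: continuity_2d_pt_RInt_rescale; apply: filter_imp Hp => -[t'' x''] Hp s /Hp/c1_near_at [_ []].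
by apply: continuity_2d_pt_RInt_rescale; apply: filter_imp Hp => -[t'' x''] Hp s /Hp/c1_near_at [_ []].
Qed.

(** * The metric of a cohomogeneity-one closed G2-structure *)

Definition ords7 : seq 'I_7 := [:: th1; th2; th3; x0; x1; x2; x3].

Lemma sum7E (F : 'I_7 -> R) :
  \rsum_(i < 7) F i = foldr (fun i s => F i + s) 0 ords7.
Proof.
rewrite !big_ord_recl big_ord0 /=.
by congr (F _ + (F _ + (F _ + (F _ + (F _ + (F _ + (F _ + _)))))));
  apply: val_inj.
Qed.

Lemma sum_ordE n (F : nat -> R) :
  \rsum_(b < n) F b = foldr (fun b s => F b + s) 0 (seq.iota 0 n).
Proof.
rewrite -(big_mkord xpredT F) /index_iota subn0.
by elim: (seq.iota 0 n) => [|b l IH]; rewrite ?big_nil // big_cons IH.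
Qed.

Lemma mem_ords7 (i : 'I_7) : i \in ords7.
Proof. by case: i => -[|[|[|[|[|[|[|//]]]]]]] ?. Qed.

(** * Evaluating multi-index sums by integer computation *)

Definition sumZ (T : Type) (l : seq T) (F : T -> Z) : Z :=
  foldr (fun b s => Z.add (F b) s) 0%Z l.

Lemma sumZ_IZR T (l : seq T) (F : T -> Z) (G : T -> R) :
  (forall b, G b = IZR (F b)) ->
  foldr (fun b s => G b + s) 0 l = IZR (sumZ l F).
Proof. by move=> E; elim: l => //= b l ->; rewrite plus_IZR E. Qed.

(* Integer-valued versions of the combinatorial parts of the definitions, so
   that the sums over multi-indices can be evaluated. *)
Definition wedgeZ (i : 'I_7) (al : seq 'I_7 -> Z) (I : seq 'I_7) : Z :=
  sumZ (seq.iota 0 (size I)) (fun b =>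
     if nth x0 I b == i
     then Z.mul (if odd b then -1 else 1)%Z (al (del b I)) else 0%Z).

Definition dxZ (I J : seq 'I_7) : Z :=
  foldr wedgeZ (fun J => if J is [::] then 1%Z else 0%Z) I J.

Lemma pow_m1_odd b : (-1) ^ b = IZR (if odd b then (-1)%Z else 1%Z).
Proof. by elim: b => //= b ->; case: (odd b); rewrite /=; lra. Qed.

Lemma dxE I J p : dx I J p = IZR (dxZ I J).
Proof.
elim: I J => [|i I IH] J /=; first by case: J.
rewrite /wedge1 /wedgeZ (sum_ordE _ (fun b =>
  (-1) ^ b * (if nth x0 J b == i then 1 else 0) * dx I (del b J) p)).
apply: sumZ_IZR => b; rewrite IH pow_m1_odd.
by case: (nth x0 J b == i); rewrite ?mult_IZR; ring.
Qed.

(* Polynomials in u with integer coefficients, constant term first; the zero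
   polynomial should be represented by the empty list whenever possible. *)
Definition polyZ := seq Z.

Fixpoint evalP (u : R) (P : polyZ) : R :=
  if P is c :: P' then IZR c + u * evalP u P' else 0.

Fixpoint addP (P Q : polyZ) : polyZ :=
  match P, Q with
  | [::], _ => Q
  | _, [::] => P
  | c :: P', d :: Q' => Z.add c d :: addP P' Q'
  end.

Definition scaleP (c : Z) (P : polyZ) : polyZ :=
  if c is 0%Z then [::] else [seq Z.mul c d | d <- P].

Fixpoint mulP (P Q : polyZ) : polyZ :=
  if Q is [::] then [::] else
  if P is c :: P' then addP (scaleP c Q) (if mulP P' Q is [::] then [::] else 0%Z :: mulP P' Q)
  else [::].

Lemma evalP_add u P Q : evalP u (addP P Q) = evalP u P + evalP u Q.
Proof.
elim: P Q => [|c P IH] [|d Q] /=; rewrite ?IH ?plus_IZR; ring.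
Qed.

Lemma evalP_scale u c P : evalP u (scaleP c P) = IZR c * evalP u P.
Proof.
have H : evalP u [seq Z.mul c d | d <- P] = IZR c * evalP u P.
  by elim: P => [|d P /= ->]; rewrite /= ?mult_IZR; ring.
by case: c H => //= _; ring.
Qed.

Lemma evalP_mul u P Q : evalP u (mulP P Q) = evalP u P * evalP u Q.
Proof.
elim: P => [|c P IH]; first by case: Q => /= *; ring.
case: Q IH => [|d Q]; first by move=> _ /=; ring.
move=> IH; rewrite [mulP _ _]/= evalP_add evalP_scale.
have -> : evalP u (if mulP P (d :: Q) is [::] then [::] else 0%Z :: mulP P (d :: Q)) =
  u * evalP u (mulP P (d :: Q)).
  by case: (mulP P (d :: Q)) => //= *; ring.
by rewrite IH [evalP u (c :: P)]/=; ring.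
Qed.

Definition sumP (T : Type) (l : seq T) (F : T -> polyZ) : polyZ :=
  foldr (fun b s => addP (F b) s) [::] l.

Fixpoint allI (k : nat) : seq (seq 'I_7) :=
  if k is k'.+1 then flatten [seq [seq i :: K | K <- allI k'] | i <- ords7]
  else [:: [::]].

Lemma sum_idxE k G : sum_idx k G = foldr (fun I s => G I + s) 0 (allI k).
Proof.
elim: k G => [|k IH] G; first by rewrite /= Rplus_0_r.
rewrite -[sum_idx _ _]/(\rsum_(i < 7) sum_idx k (fun I => G (i :: I))) sum7E.
rewrite -[allI _]/(flatten [seq [seq i :: K | K <- allI k] | i <- ords7]).
elim: ords7 => [//|i l IHl].
rewrite [LHS]/= IHl IH [flatten _]/= foldr_cat.
move: (foldr _ 0 (flatten _)) => z.
by elim: (allI k) => [|I m IHm] /=; [ring|rewrite -IHm; ring].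
Qed.

(** Zero components are discarded before summing. The sum over 7^7 multi-indices would be too large,
    but phi has only 42 nonzero components, and 6 once its first index is fixed. *)
Definition supp (k : nat) (c : seq 'I_7 -> polyZ) : seq (seq 'I_7 * polyZ) :=
  [seq (K, c K) | K <- allI k & ~~ nilp (c K)].

Lemma sum_idx_supp u k c (F : seq 'I_7 -> polyZ) G :
  (forall I, G I = evalP u (F I)) ->
  sum_idx k (fun I => evalP u (c I) * G I) =
  evalP u (sumP (supp k c) (fun x => mulP x.2 (F x.1))).
Proof.
move=> GF; rewrite sum_idxE /supp; elim: (allI k) => [//|I l IH].
rewrite [LHS]/= IH /=; case: nilP => [->|_] /=; first by rewrite Rmult_0_l Rplus_0_l.
by rewrite evalP_add evalP_mul GF.
Qed.

Lemma sum_idx_ext k F G : (forall I, size I = k -> F I = G I) -> sum_idx k F = sum_idx k G.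
Proof.
elim: k F G => [|k IH] F G E /=; first exact: E.
by apply: eq_bigr => i _; apply: IH => I sI; apply: E; rewrite /= sI.
Qed.

Lemma sum_idx_scal k c F : sum_idx k (fun I => c * F I) = c * sum_idx k F.
Proof.
elim: k F => [//|k IH] F /=; rewrite !sum7E.
by elim: ords7 => [|i l IHl] /=; [ring|rewrite IH IHl; ring].
Qed.

Lemma sum_idx_split m k F :
  sum_idx (m + k) F = sum_idx m (fun I => sum_idx k (fun J => F (I ++ J))).
Proof.
elim: m F => [//|m IH] F /=.
by apply: eq_bigr => i _; rewrite IH.
Qed.

Definition cmpZ (a b : nat) : Z :=
  if leq a.+1 b then 1%Z else if leq b.+1 a then (-1)%Z else 0%Z.

Definition sgnZ (I : seq 'I_7) : Z :=
  foldr Z.mul 1%Z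
    [seq cmpZ (nth x0 I a) (nth x0 I b) | b <- seq.iota 0 (size I), a <- seq.iota 0 b].

Lemma sgn_idxE I : sgn_idx I = IZR (sgnZ I).
Proof.
rewrite /sgn_idx /sgnZ.
have E : forall a b : nat, sign (INR a - INR b) = IZR (cmpZ b a).
  move=> a b; rewrite /cmpZ; case: (ltngtP a b) => H.
  - by have H1 := lt_INR _ _ (ltP H); rewrite sign_eq_m1; lra.
  - by have H1 := lt_INR _ _ (ltP H); rewrite sign_eq_1; lra.
  - by rewrite H Rminus_diag sign_0.
elim: (seq.iota 0 (size I)) => [//|b l IH].
rewrite !allpairs_cons !foldr_cat.
rewrite IH; elim: (seq.iota 0 b) => [//|a m IHm] /=.
by rewrite mult_IZR -IHm E.
Qed.

Definition phiP (I : seq 'I_7) : polyZ :=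
  let a := Z.sub (dxZ [:: th1; th2; th3] I)
    (sumZ [:: [:: th1; x0; x1]; [:: th1; x2; x3]; [:: th2; x0; x2];
              [:: th2; x3; x1]; [:: th3; x1; x2]] (fun L => dxZ L I)) in
  let b := Z.opp (dxZ [:: th3; x0; x3] I) in
  if (Z.eqb a 0 && Z.eqb b 0) then [::] else [:: a; b].

Lemma phi_ofE u I p : phi_of u I p = evalP (u (p x0)) (phiP I).
Proof.
rewrite /phi_of !dxE /phiP.
set a := Z.sub _ _; set b := Z.opp _.
have -> : evalP (u (p x0)) (if (Z.eqb a 0 && Z.eqb b 0) then [::] else [:: a; b]) =
    IZR a + u (p x0) * IZR b.
  case: Z.eqb_spec => [->|_] /=; last ring.
  by case: Z.eqb_spec => [->|_] /=; ring.
by rewrite /a /b minus_IZR opp_IZR /= !plus_IZR; ring.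
Qed.

(* 144 times an entry of the matrix B. *)
Definition BP (S Ti Tj : seq (seq 'I_7 * polyZ)) : polyZ :=
  sumP Ti (fun K => mulP K.2 (sumP Tj (fun L => mulP L.2
    (sumP S (fun M => mulP M.2 [:: sgnZ (K.1 ++ L.1 ++ M.1)]))))).

Definition phi_supp := supp 3 phiP.
Definition phi_supp_head i := supp 2 (fun K => phiP (i :: K)).

Definition u_index (i : 'I_7) : bool := i \in [:: th3; x0; x3].

Definition B_expected (i j : 'I_7) : polyZ :=
  if i == j then if u_index i then [:: 0%Z; 144%Z] else [:: 144%Z] else [::].

Lemma evalP_all0 u P : all (Z.eqb 0) P -> evalP u P = 0.
Proof.
elim: P => [//|c P IH] H.
have /andP [/Z.eqb_eq <- /IH /= ->] : Z.eqb 0 c && all (Z.eqb 0) P := H.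
ring.
Qed.

(** The supports are arguments, so that call-by-value evaluation computes each of them once for all
    49 entries. *)
Definition BP_test S (T : seq ('I_7 * seq (seq 'I_7 * polyZ))) : bool :=
  all (fun Ti => all (fun Tj => all (Z.eqb 0)
    (addP (BP S Ti.2 Tj.2) (scaleP (-1) (B_expected Ti.1 Tj.1)))) T) T.

Lemma BP_testP S h u i j : BP_test S [seq (i, h i) | i <- ords7] ->
  evalP u (BP S (h i) (h j)) = evalP u (B_expected i j).
Proof.
rewrite /BP_test all_map => /allP /(_ i (mem_ords7 i)).
rewrite -[preim _ _ _]/(all (fun Tj => all (Z.eqb 0) (addP (BP S (h i) Tj.2)
  (scaleP (-1) (B_expected i Tj.1)))) [seq (i, h i) | i <- ords7]).
rewrite all_map => /allP /(_ j (mem_ords7 j)) H.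
have {H} : all (Z.eqb 0) (addP (BP S (h i) (h j)) (scaleP (-1) (B_expected i j))) := H.
move=> /(evalP_all0 u).
by rewrite evalP_add evalP_scale /=; lra.
Qed.

Lemma BP_expected u i j :
  evalP u (BP phi_supp (phi_supp_head i) (phi_supp_head j)) = evalP u (B_expected i j).
Proof. by apply: BP_testP; vm_compute. Qed.

Lemma sum_idx7_split F : sum_idx 7 F =
  sum_idx 2 (fun K => sum_idx 2 (fun L => sum_idx 3 (fun M => F (K ++ L ++ M)))).
Proof.
rewrite (sum_idx_split 2 5); apply: sum_idx_ext => K _.
by rewrite (sum_idx_split 2 3).
Qed.

(** The seven summation indices are grouped 2 + 2 + 3, as they are shared out among the three
    factors phi; each group then runs over a support, and the rest is the computation in
    [BP_expected]. *)
Lemma g2_BE u p i j :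
  g2_B (phi_of u) p i j = if i == j then if u_index i then u (p x0) else 1 else 0.
Proof.
rewrite /g2_B mxE; set w := u (p x0).
rewrite sum_idx7_split.
have -> : (if i == j then if u_index i then w else 1 else 0) =
    / 144 * evalP w (B_expected i j).
  rewrite /B_expected; case: (i == j) => /=; last by ring.
  by case: (u_index i) => /=; field.
rewrite -BP_expected /BP.
congr (_ * _).
rewrite -(@sum_idx_supp w 2 (fun K => phiP (i :: K)) (fun K =>
  sumP (phi_supp_head j) (fun L => mulP L.2
    (sumP phi_supp (fun M => mulP M.2 [:: sgnZ (K ++ L.1 ++ M.1)]))))
  (fun K => sum_idx 2 (fun L => evalP w (phiP (j :: L)) *
     sum_idx 3 (fun M => evalP w (phiP M) * IZR (sgnZ (K ++ L ++ M)))))).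
  apply: sum_idx_ext => -[|k0 [|k1 [|//]]] // _.
  rewrite -sum_idx_scal; apply: sum_idx_ext => -[|k2 [|k3 [|//]]] // _.
  rewrite -!sum_idx_scal; apply: sum_idx_ext => -[|k4 [|k5 [|k6 [|//]]]] // _.
  rewrite -[LHS]/(sgn_idx [:: k0; k1; k2; k3; k4; k5; k6] * phi_of u [:: i; k0; k1] p *
    phi_of u [:: j; k2; k3] p * phi_of u [:: k4; k5; k6] p).
  rewrite sgn_idxE !phi_ofE -[[:: k0; k1] ++ _]/[:: k0; k1; k2; k3; k4; k5; k6].
  by rewrite -/w; ring.
move=> K.
apply: (@sum_idx_supp w 2 (fun L => phiP (j :: L)) (fun L =>
  sumP phi_supp (fun M => mulP M.2 [:: sgnZ (K ++ L ++ M.1)]))) => L.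
apply: (@sum_idx_supp w 3 phiP (fun M => [:: sgnZ (K ++ L ++ M)])) => M.
by rewrite [evalP _ _]/=; ring.
Qed.

(** * Diagonal metrics and the metric of [phi_of u] *)

Lemma sum_delta n (d : R) (i : 'I_n) (F : 'I_n -> R) :
  \rsum_(j < n) ((if i == j then d else 0) * F j) = d * F i.
Proof.
rewrite (bigD1 i) //= eqxx big1 ?Rplus_0_r // => j.
by rewrite eq_sym => /negbTE ->; rewrite Rmult_0_l.
Qed.

Definition diag7 (d : 'I_7 -> R) : 'M[R]_7 :=
  \matrix_(i < 7, j < 7) (if i == j then d i else 0).

Lemma diag7E d : diag7 d = diag_mx (\row_i d i).
Proof.
apply/matrixP => i j; rewrite !mxE; case: eqP => [->|_]; first by rewrite GRing.mulr1n.
by rewrite GRing.mulr0n.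
Qed.

Lemma det_diag7 d : determinant (diag7 d) = foldr (fun i s => d i * s) 1 ords7.
Proof.
rewrite diag7E det_diag.
rewrite (eq_bigr d) => [|i _]; last by rewrite mxE.
rewrite !big_ord_recl big_ord0 /=.
congr (d _ * (d _ * (d _ * (d _ * (d _ * (d _ * (d _ * _)))))));
  apply: val_inj => //.
Qed.

Lemma invmx_diag7 d : (forall i, d i <> 0) -> invmx (diag7 d) = diag7 (fun i => / d i).
Proof.
move=> d0.
have AB : mulmx (diag7 d) (diag7 (fun i => / d i)) = scalar_mx (GRing.one R).
  rewrite !diag7E mulmx_diag; apply/matrixP => i j; rewrite !mxE; congr (GRing.natmul _ _).
  exact: Rinv_r.
have [Au _] := mulmx1_unit AB.
by rewrite -[LHS]mulmx1 -AB mulmxA mulVmx // mul1mx.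
Qed.

Definition prodI (d : 'I_7 -> R) (K : seq 'I_7) : R := foldr (fun i s => d i * s) 1 K.

Lemma contract_diag7 d K al : contract (diag7 d) K al = prodI d K * al K.
Proof.
elim: K al => [|i K IH] al; first by rewrite /= Rmult_1_l.
rewrite /= (eq_bigr (fun j => (if i == j then d i else 0) * (prodI d K * al (j :: K)))).
  by rewrite sum_delta -/(prodI d K) Rmult_assoc.
by move=> j _; rewrite mxE IH.
Qed.

Lemma prodI_inv d K : (forall i, d i <> 0) -> prodI d K * prodI (fun i => / d i) K = 1.
Proof.
move=> d0; elim: K => [|i K IH] /=; first by rewrite Rmult_1_l.
transitivity (d i * / d i * (prodI d K * prodI (fun i => / d i) K)); first ring.
by rewrite IH Rinv_r ?Rmult_1_l.
Qed.

(* With a = u^{1/3} the metric is a^2 or 1/a on each coordinate direction, and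
   the volume density is a. *)
Definition croot (u : R -> R) (p : pt) : R := Rpower (u (p x0)) (1 / 3).

Definition met (u : R -> R) (p : pt) (i : 'I_7) : R :=
  if u_index i then croot u p * croot u p else / croot u p.

Lemma croot_pos u p : 0 < croot u p.
Proof. exact: exp_pos. Qed.

Lemma Rpower_third x : 0 < x ->
  Rpower x (1 / 3) * Rpower x (1 / 3) * Rpower x (1 / 3) = x.
Proof.
move=> x0; rewrite -!Rpower_plus -[RHS]Rpower_1 //; congr Rpower; field.
Qed.

Lemma croot3 u p : 0 < u (p x0) -> croot u p * croot u p * croot u p = u (p x0).
Proof. exact: Rpower_third. Qed.

Lemma met_pos u p i : 0 < met u p i.
Proof.
have a0 := croot_pos u p; rewrite /met; case: ifP => _; first exact: Rmult_lt_0_compat.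
exact: Rinv_0_lt_compat.
Qed.

Lemma met_neq0 u p i : met u p i <> 0.
Proof. by have := met_pos u p i; lra. Qed.

(** det B = u^3, whose ninth root is a = u^(1/3). Dividing the diagonal entries u = a^3 and 1 of B
    by a leaves a^2 and 1/a. *)
Lemma g2_metricE u p : 0 < u (p x0) -> g2_metric (phi_of u) p = diag7 (met u p).
Proof.
move=> u0; have a0 := croot_pos u p; have a3 := @croot3 u p u0.
have E : Rpower (determinant (g2_B (phi_of u) p)) (1 / 9) = croot u p.
  have -> : g2_B (phi_of u) p = diag7 (fun i => if u_index i then u (p x0) else 1).
    by apply/matrixP => k l; rewrite g2_BE mxE.
  rewrite det_diag7 /= !Rmult_1_l !Rmult_1_r /croot.
  have -> : u (p x0) * (u (p x0) * u (p x0)) = Rpower (u (p x0)) 3.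
    by rewrite -[X in X * _]Rpower_1 // -{2 3}[u (p x0)]Rpower_1 // -!Rpower_plus;
       congr Rpower; ring.
  by rewrite Rpower_mult; congr Rpower; field.
apply/matrixP => i j; rewrite /g2_metric mxE E g2_BE mxE /met; case: eqP => _; last by rewrite /Rdiv Rmult_0_l.
case: ifP => _; last by rewrite /Rdiv Rmult_1_l.
rewrite -[in LHS]a3; field; lra.
Qed.

(** Three entries a^2 and four entries 1/a multiply to a^2. *)
Lemma g2_volE u p : 0 < u (p x0) -> g2_vol (phi_of u) p = croot u p.
Proof.
move=> u0; have a0 := croot_pos u p.
rewrite /g2_vol g2_metricE // det_diag7 /= /met /=.
set a := croot u p.
have -> : / a * (/ a * (a * a * (a * a * (/ a * (/ a * (a * a * 1)))))) = a * a.
  by field; rewrite /a; lra.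
by rewrite sqrt_square //; rewrite /a; lra.
Qed.

Lemma raiseE u al K p : 0 < u (p x0) ->
  raise (phi_of u) al K p = prodI (fun i => / met u p i) K * al K p.
Proof.
move=> u0; rewrite /raise g2_metricE // invmx_diag7; last exact: met_neq0.
exact: contract_diag7.
Qed.

Lemma lowerE u al K p : 0 < u (p x0) ->
  lower (phi_of u) al K p = prodI (met u p) K * al K p.
Proof. by move=> u0; rewrite /lower g2_metricE // contract_diag7. Qed.

(** * Smooth functions on the torus *)

Definition cont_deriv n (F : ('I_n -> R) -> R) : Prop := forall q : 'I_n -> R,
  continuous F q /\ forall i, ex_derive (fun t => F (upd q i t)) (q i).

Definition smooth n (F : ('I_n -> R) -> R) : Prop := forall L, cont_deriv (partials L F).

Lemma smooth_onP n (F : ('I_n -> R) -> R) : smooth_on (fun _ => True) F <-> smooth F.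
Proof.
split=> [sF L q|sF p _]; first exact: (locally_singleton _ _ (sF q Logic.I) L).
by exists (mkposreal 1 Rlt_0_1) => q _ L; exact: sF.
Qed.

Lemma smooth_stable n (C : (('I_n -> R) -> R) -> Prop) :
  (forall F, C F -> cont_deriv F /\ forall i, C (partial i F)) ->
  forall F, C F -> smooth F.
Proof.
move=> HC F CF L.
suff CL : C (partials L F) by case: (HC _ CL).
by elim: L => [//|i L IH] /=; case: (HC _ IH).
Qed.

Lemma smooth_cont n (F : ('I_n -> R) -> R) q : smooth F -> continuous F q.
Proof. by move=> /(_ [::] q) []. Qed.

Lemma smooth_partial n (F : ('I_n -> R) -> R) i : smooth F -> smooth (partial i F).
Proof.
move=> sF L; have := sF (L ++ [:: i]); by rewrite /partials foldr_cat.
Qed.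

Lemma upd_same n (p : 'I_n -> R) i t : upd p i t i = t.
Proof. by rewrite /upd eqxx. Qed.

Lemma upd_id n (p : 'I_n -> R) i : upd p i (p i) = p.
Proof.
by apply: functional_extensionality => j; rewrite /upd; case: eqP => [->|].
Qed.

Lemma upd_upd n (p : 'I_n -> R) i s t : upd (upd p i s) i t = upd p i t.
Proof.
by apply: functional_extensionality => j; rewrite /upd; case: eqP.
Qed.

Lemma upd_comm n (p : 'I_n -> R) i j s t : i != j ->
  upd (upd p i s) j t = upd (upd p j t) i s.
Proof.
move=> ij; apply: functional_extensionality => k; rewrite /upd.
by case: (eqVneq k j) => [->|//]; rewrite eq_sym (negbTE ij).
Qed.

Lemma upd_other n (p : 'I_n -> R) i j t : j != i -> upd p i t j = p j.
Proof. by rewrite /upd => /negbTE ->. Qed.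

Lemma smooth_is_derive n (F : ('I_n -> R) -> R) q i t : smooth F ->
  is_derive (fun t => F (upd q i t)) t (partial i F (upd q i t)).
Proof.
move=> /(_ [::] (upd q i t)) [_ /(_ i)]; rewrite upd_same => D.
have := Derive_correct _ _ D; rewrite /partial upd_same.
apply: is_derive_ext => s; by rewrite upd_upd.
Qed.

Lemma smooth_is_derive_at n (F : ('I_n -> R) -> R) q i : smooth F ->
  is_derive (fun t => F (upd q i t)) (q i) (partial i F q).
Proof. by move=> sF; have := smooth_is_derive q i (q i) sF; rewrite upd_id. Qed.

Lemma partial_unique n (F : ('I_n -> R) -> R) q i l :
  is_derive (fun t => F (upd q i t)) (q i) l -> partial i F q = l.
Proof. exact: is_derive_unique. Qed.

Lemma partial_mult n (F G : ('I_n -> R) -> R) i : smooth F -> smooth G ->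
  partial i (fun p => F p * G p) = fun p => partial i F p * G p + F p * partial i G p.
Proof.
move=> sF sG; apply: functional_extensionality => p; apply: partial_unique.
have := is_derive_mult (fun t => F (upd p i t)) (fun t => G (upd p i t)) (p i) _ _
  (smooth_is_derive_at p i sF) (smooth_is_derive_at p i sG) Rmult_comm.
by rewrite upd_id.
Qed.

(** Sums of products: a class that contains every product F G and is stable under partial
    derivatives by the product rule, as [smooth_stable] requires. *)
Inductive smooth_poly n : (('I_n -> R) -> R) -> Prop :=
| sp_base F G : smooth F -> smooth G -> smooth_poly (fun x => F x * G x)
| sp_plus F G : smooth_poly F -> smooth_poly G -> smooth_poly (fun x => F x + G x).

Lemma smooth_const n c : @smooth n (fun _ => c).
Proof.
apply: (@smooth_stable n (fun F => exists c, F = fun _ => c)); last by exists c.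
move=> _ [{}c ->]; split=> [q|i].
  by split=> [|i]; [exact: continuous_const|exact: ex_derive_const].
exists 0; apply: functional_extensionality => p; exact: Derive_const.
Qed.

Lemma cont_deriv_poly n (F : ('I_n -> R) -> R) : smooth_poly F ->
  cont_deriv F /\ forall i, smooth_poly (partial i F).
Proof.
elim=> {F} [F G sF sG|F G _ [cF pF] _ [cG pG]].
  split=> [q|i].
    split=> [|i]; first by apply: continuous_mult; exact: smooth_cont.
    apply: ex_derive_mult; by eexists; exact: smooth_is_derive_at.
  rewrite partial_mult //; apply: sp_plus; apply: sp_base => //; exact: smooth_partial.
split=> [q|i].
  split=> [|i]; first by apply: continuous_plus; [case: (cF q)|case: (cG q)].
  by apply: ex_derive_plus; [case: (cF q)|case: (cG q)].
have -> : partial i (fun p => F p + G p) = fun p => partial i F p + partial i G p.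
  apply: functional_extensionality => p; apply: Derive_plus;
    by [case: (cF p)|case: (cG p)].
exact: sp_plus.
Qed.

Lemma smooth_poly_smooth n (F : ('I_n -> R) -> R) : smooth_poly F -> smooth F.
Proof. exact: (smooth_stable (@cont_deriv_poly n)). Qed.

Lemma smooth_mult n (F G : ('I_n -> R) -> R) :
  smooth F -> smooth G -> smooth (fun p => F p * G p).
Proof. by move=> sF sG; apply/smooth_poly_smooth/sp_base. Qed.

Lemma smooth_plus n (F G : ('I_n -> R) -> R) :
  smooth F -> smooth G -> smooth (fun p => F p + G p).
Proof.
move=> sF sG; have := smooth_poly_smooth (sp_plus (sp_base sF (@smooth_const n 1))
  (sp_base sG (@smooth_const n 1))).
by congr smooth; apply: functional_extensionality => p; ring.
Qed.

Lemma smooth_sum n m (F : 'I_m -> ('I_n -> R) -> R) :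
  (forall i, smooth (F i)) -> smooth (fun p => \rsum_(i < m) F i p).
Proof.
move=> sF; elim: (index_enum _) => [|i l IH].
  by have := @smooth_const n 0; congr smooth; apply: functional_extensionality => p;
     rewrite big_nil.
have := smooth_plus (sF i) IH; congr smooth; apply: functional_extensionality => p.
by rewrite big_cons.
Qed.

Lemma partial_sum n m (F : 'I_m -> ('I_n -> R) -> R) i p :
  (forall j, smooth (F j)) ->
  partial i (fun p => \rsum_(j < m) F j p) p = \rsum_(j < m) partial i (F j) p.
Proof.
move=> sF.
suff H : is_derive (fun t => \rsum_(j < m) F j (upd p i t)) (p i)
    (\rsum_(j < m) partial i (F j) p) by exact: partial_unique H.
elim: (index_enum _) => [|j l IH].
  rewrite big_nil; apply: (@is_derive_ext _ _ (fun _ => 0)); last by auto_derive.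
  by move=> t; rewrite big_nil.
rewrite big_cons; apply: (@is_derive_ext _ _
  (fun t => F j (upd p i t) + \big[Rplus/0]_(k <- l) F k (upd p i t))).
  by move=> t; rewrite big_cons.
by apply: is_derive_plus => //; exact: smooth_is_derive_at.
Qed.

Lemma continuous_coord n (p : 'I_n -> R) i : continuous (fun p : 'I_n -> R => p i) p.
Proof. by move=> P [d Hd]; exists d => q Hq; apply: Hd; exact: Hq. Qed.

Lemma smooth_coord n (h : R -> R) (i : 'I_n) : smooth1 h -> smooth (fun p => h (p i)).
Proof.
move=> sh; apply: (@smooth_stable n (fun F => exists2 h, smooth1 h & F = fun p => h (p i)));
  last by exists h.
move=> _ {h sh} [h sh ->]; split=> [q|j].
  split=> [|j].
    apply: (continuous_comp (fun p : 'I_n -> R => p i) h); first exact: continuous_coord.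
    by apply/ex_derive_continuous/smooth1_ex_derive.
  rewrite /upd; case: eqP => [_|_]; last exact: ex_derive_const.
  exact: smooth1_ex_derive.
case: (eqVneq i j) => [<-|ij].
  exists (Derive h); first exact: smooth1_Derive.
  apply: functional_extensionality => p; rewrite /partial.
  by apply: Derive_ext => t; rewrite upd_same.
exists (fun _ => 0); first exact: smooth1_const.
apply: functional_extensionality => p; rewrite /partial.
rewrite (Derive_ext _ (fun _ => h (p i))) ?Derive_const // => t.
by rewrite upd_other.
Qed.

Lemma partial_coord n (h : R -> R) (i j : 'I_n) p :
  partial j (fun p => h (p i)) p = if i == j then Derive h (p i) else 0.
Proof.
rewrite /partial; case: eqP => [<-|/eqP ij].
  by apply: Derive_ext => t; rewrite upd_same.
rewrite (Derive_ext _ (fun _ => h (p i))) ?Derive_const // => t.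
by rewrite upd_other.
Qed.

Lemma partial_scal n (F : ('I_n -> R) -> R) i c p :
  partial i (fun p => c * F p) p = c * partial i F p.
Proof. exact: Derive_scal. Qed.

Lemma continuous_upd n (T : UniformSpace) (f : T -> 'I_n -> R) (g : T -> R) j x :
  continuous f x -> continuous g x -> continuous (fun x => upd (f x) j (g x)) x.
Proof.
move=> /filterlim_locally cf /filterlim_locally cg.
apply/(@filterlim_locally _ (fct_UniformSpace 'I_n R_UniformSpace)) => eps.
case: (filter_and _ _ (cf eps) (cg eps)) => d Hd; exists d => y /Hd [Hf Hg] k; rewrite /upd; case: eqP => // _; exact: Hf.
Qed.

(** * Planar slices and commuting partial derivatives *)

Section Slices.
Context (n : nat) (F : ('I_n -> R) -> R) (p : 'I_n -> R) (i j : 'I_n).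
Hypotheses (sF : smooth F) (ij : i != j).

Let f s t := F (upd (upd p i s) j t).

Lemma slice_is_derive_fst s t :
  is_derive (fun s => f s t) s (partial i F (upd (upd p i s) j t)).
Proof.
rewrite upd_comm //.
apply: (@is_derive_ext _ _ (fun s => F (upd (upd p j t) i s))).
  by move=> s'; rewrite /f -(@upd_comm n p i j s' t ij).
exact: smooth_is_derive.
Qed.

Lemma slice_is_derive_snd s t :
  is_derive (f s) t (partial j F (upd (upd p i s) j t)).
Proof. exact: smooth_is_derive. Qed.

Lemma slice_continuity_2d s t : continuity_2d_pt f s t.
Proof.
apply/continuity_2d_pt_filterlim.
apply: (continuous_comp (fun z : R * R => upd (upd p i z.1) j z.2) F (s, t)).
  apply: continuous_upd; last exact: continuous_snd.
  apply: (continuous_upd (f := fun _ => p)); last exact: continuous_fst.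
  exact: continuous_const.
exact: smooth_cont.
Qed.
End Slices.

Lemma partial_comm n (F : ('I_n -> R) -> R) i j : smooth F ->
  partial i (partial j F) = partial j (partial i F).
Proof.
move=> sF; case: (eqVneq i j) => [->//|ij].
apply: functional_extensionality => p.
pose f s t := F (upd (upd p i s) j t).
have D1 s t : Derive (fun z => f z t) s = partial i F (upd (upd p i s) j t).
  exact/is_derive_unique/slice_is_derive_fst.
have D2 s t : Derive (fun z => f s z) t = partial j F (upd (upd p i s) j t).
  exact/is_derive_unique/slice_is_derive_snd.
have D12 s t : is_derive (fun z => Derive (fun t => f z t) t) s
    (partial i (partial j F) (upd (upd p i s) j t)).
  apply: is_derive_ext (slice_is_derive_fst p (smooth_partial j sF) ij s t) => z.
  by rewrite D2.
have D21 s t : is_derive (fun z => Derive (fun t => f t z) s) t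
    (partial j (partial i F) (upd (upd p i s) j t)).
  apply: is_derive_ext (slice_is_derive_snd p i j (smooth_partial i sF) s t) => z.
  by rewrite D1.
have := Schwarz f (p i) (p j).
rewrite (is_derive_unique _ _ _ (D12 _ _)) (is_derive_unique _ _ _ (D21 _ _)) !upd_id.
apply.
- apply: locally_2d_forall => s t; split; first by eexists; exact: slice_is_derive_fst.
  split; first by eexists; exact: slice_is_derive_snd.
  by split; eexists; [exact: D12|exact: D21].
- apply: continuity_2d_pt_ext (slice_continuity_2d p i j
    (smooth_partial i (smooth_partial j sF)) _ _) => s t.
  by rewrite (is_derive_unique _ _ _ (D12 _ _)).
- apply: continuity_2d_pt_ext (slice_continuity_2d p i j
    (smooth_partial j (smooth_partial i sF)) _ _) => s t.
  by rewrite (is_derive_unique _ _ _ (D21 _ _)).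
Qed.

(** * Averages over circles and Stokes' theorem *)

Definition avg n (j : 'I_n) (F : ('I_n -> R) -> R) : ('I_n -> R) -> R :=
  fun p => RInt (fun t => F (upd p j t)) 0 1.

Lemma smooth_ex_RInt n (F : ('I_n -> R) -> R) j p a b :
  smooth F -> ex_RInt (fun t => F (upd p j t)) a b.
Proof.
move=> sF; apply: ex_RInt_continuous => t _.
apply: (@ex_derive_continuous _ _ (fun t => F (upd p j t))).
by eexists; exact: smooth_is_derive.
Qed.

Lemma avg_is_derive n (F : ('I_n -> R) -> R) i j p : smooth F -> i != j ->
  is_derive (fun s => avg j F (upd p i s)) (p i) (avg j (partial i F) p).
Proof.
move=> sF ij.
have D s t : Derive (fun s => F (upd (upd p i s) j t)) s = partial i F (upd (upd p i s) j t).
  exact/is_derive_unique/slice_is_derive_fst.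
have -> : avg j (partial i F) p =
    RInt (fun t => Derive (fun s => F (upd (upd p i s) j t)) (p i)) 0 1.
  by apply: RInt_ext => t _; rewrite D upd_id.
apply: (is_derive_RInt_param (fun s t => F (upd (upd p i s) j t))).
- apply: filter_forall => s t _; eexists; exact: slice_is_derive_fst.
- move=> t _; apply: continuity_2d_pt_ext (slice_continuity_2d p i j
    (smooth_partial i sF) _ _) => u v; exact: esym.
- apply: filter_forall => s; exact: smooth_ex_RInt.
Qed.

Lemma partial_avg n (F : ('I_n -> R) -> R) i j : smooth F -> i != j ->
  partial i (avg j F) = avg j (partial i F).
Proof.
move=> sF ij; apply: functional_extensionality => p.
exact/partial_unique/avg_is_derive.
Qed.

Lemma avg_upd n (F : ('I_n -> R) -> R) j p t : avg j F (upd p j t) = avg j F p.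
Proof. by apply: RInt_ext => s _; rewrite upd_upd. Qed.

Lemma smooth_avg n (F : ('I_n -> R) -> R) j : smooth F -> smooth (avg j F).
Proof.
move=> sF; apply: (@smooth_stable n (fun G => exists2 F, smooth F & G = avg j F));
  last by exists F.
move=> _ {F sF} [F sF ->]; split=> [p|i].
  split=> [|i].
    apply: (@RInt_param_continuous _ (fun (q : 'I_n -> R) t => F (upd q j t))).
      move=> t _.
      apply: (continuous_comp (fun z : ('I_n -> R) * R => upd z.1 j z.2) F (p, t)).
        by apply: continuous_upd; [exact: continuous_fst|exact: continuous_snd].
      exact: smooth_cont.
    by apply: filter_forall => q; exact: smooth_ex_RInt.
  case: (eqVneq i j) => [->|ij]; last by eexists; exact: avg_is_derive.
  by apply: (ex_derive_ext (fun _ => avg j F p)); [move=> t; rewrite avg_upd|exact: ex_derive_const].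
case: (eqVneq i j) => [->|ij]; last first.
  by exists (partial i F); [exact: smooth_partial|exact: partial_avg].
exists (fun _ => 0); first exact: smooth_const.
apply: functional_extensionality => p; rewrite /avg RInt_const /scal /= /mult /= Rmult_0_r.
rewrite /partial (Derive_ext _ (fun _ => avg j F p)) ?Derive_const // => t.
exact: avg_upd.
Qed.

Definition periodic n (F : ('I_n -> R) -> R) : Prop :=
  forall p i, F (upd p i (p i + 1)) = F p.

Lemma periodic_avg n (F : ('I_n -> R) -> R) j : periodic F -> periodic (avg j F).
Proof.
move=> pF p i; case: (eqVneq i j) => [->|ij]; first by rewrite avg_upd.
apply: RInt_ext => t _; rewrite upd_comm //.
by have := pF (upd p j t) i; rewrite upd_other.
Qed.

Lemma periodic_partial n (F : ('I_n -> R) -> R) j : smooth F -> periodic F ->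
  periodic (partial j F).
Proof.
move=> sF pF p i.
have E : (fun t => F (upd (upd p j t) i (upd p j t i + 1))) = fun t => F (upd p j t).
  by apply: functional_extensionality => t.
rewrite [RHS]/partial -E.
case: (eqVneq i j) => [ij|ij].
  rewrite ij; apply/esym/is_derive_unique.
  apply: (@is_derive_ext _ _ (fun t => F (upd p j (t + 1)))).
    by move=> t; rewrite upd_upd upd_same.
  rewrite -[partial _ _ _]Rmult_1_l.
  apply: (is_derive_comp (fun t => F (upd p j t)) (fun t => t + 1)).
    exact: smooth_is_derive.
  by auto_derive.
rewrite /partial upd_other; last by rewrite eq_sym.
apply: Derive_ext => t; rewrite upd_other // upd_comm //.
Qed.

Lemma avg_partial_same n (F : ('I_n -> R) -> R) j p : smooth F -> periodic F ->
  avg j (partial j F) p = 0.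
Proof.
move=> sF pF; rewrite /avg.
have D t : is_derive (fun t => F (upd p j t)) t (partial j F (upd p j t)).
  exact: smooth_is_derive.
have C t : continuous (fun t => partial j F (upd p j t)) t.
  apply: (@ex_derive_continuous _ _ (fun t => partial j F (upd p j t))).
  by eexists; apply: smooth_is_derive; exact: smooth_partial.
have := is_RInt_derive (fun t => F (upd p j t)) (fun t => partial j F (upd p j t)) 0 1
  (fun t _ => D t) (fun t _ => C t).
move=> /is_RInt_unique ->.
have := pF (upd p j 0) j; rewrite upd_same Rplus_0_l upd_upd => ->.
exact: Rminus_diag.
Qed.

Definition avgs n (L : seq 'I_n) (F : ('I_n -> R) -> R) := foldr (@avg n) F L.

(* Stokes' theorem on the torus: integrate along the i-th circle first. *)
Lemma avgs_partial n (L : seq 'I_n) (F : ('I_n -> R) -> R) i :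
  smooth F -> periodic F -> i \in L -> avgs L (partial i F) = fun _ => 0.
Proof.
have avg0 j : @avg n j (fun _ => 0) = fun _ => 0.
  by apply: functional_extensionality => p;
     rewrite /avg RInt_const /scal /= /mult /= Rmult_0_r.
elim: L => [//|j L IH] sF pF; rewrite inE /=.
case: (boolP (i \in L)) => [iL _|iL]; first by rewrite IH // avg0.
rewrite orbF => /eqP <-.
have -> : avgs L (partial i F) = partial i (avgs L F).
  elim: L iL {IH} => [//|k L IH]; rewrite inE negb_or => /andP [ik iL] /=.
  rewrite IH // partial_avg //.
  by elim: (L) => [//|l M IHM] /=; exact: smooth_avg.
apply: functional_extensionality => p; apply: avg_partial_same.
  by elim: (L) => [//|l M IHM] /=; exact: smooth_avg.
by elim: (L) => [//|l M IHM] /=; exact: periodic_avg.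
Qed.

Lemma smooth_avgs n (L : seq 'I_n) F : smooth F -> smooth (avgs L F).
Proof. by move=> sF; elim: L => [//|l L IH] /=; exact: smooth_avg. Qed.

Lemma avgs_plus n (L : seq 'I_n) F G : smooth F -> smooth G ->
  avgs L (fun p => F p + G p) = fun p => avgs L F p + avgs L G p.
Proof.
move=> sF sG; elim: L => [//|l L IH] /=; rewrite IH.
apply: functional_extensionality => p; apply: (RInt_plus (fun t => avgs L F (upd p l t))
  (fun t => avgs L G (upd p l t))); by apply: smooth_ex_RInt; exact: smooth_avgs.
Qed.

Lemma avgs_scal n (L : seq 'I_n) F c : smooth F ->
  avgs L (fun p => c * F p) = fun p => c * avgs L F p.
Proof.
move=> sF; elim: L => [//|l L IH] /=; rewrite IH.
apply: functional_extensionality => p; apply: (RInt_scal (fun t => avgs L F (upd p l t))).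
by apply: smooth_ex_RInt; exact: smooth_avgs.
Qed.

Lemma torus_intE F : torus_int F = avgs (enum 'I_7) F (fun _ => 0).
Proof. by []. Qed.

Lemma torus_int_partial (F : pt -> R) i : smooth F -> periodic F ->
  torus_int (partial i F) = 0.
Proof. by move=> sF pF; rewrite torus_intE avgs_partial // mem_enum. Qed.

Lemma torus_int_plus (F H : pt -> R) : smooth F -> smooth H ->
  torus_int (fun p => F p + H p) = torus_int F + torus_int H.
Proof. by move=> sF sG; rewrite torus_intE avgs_plus. Qed.

Lemma torus_int_scal c (F : pt -> R) : smooth F ->
  torus_int (fun p => c * F p) = c * torus_int F.
Proof. by move=> sF; rewrite torus_intE avgs_scal. Qed.

Lemma torus_int_sum_partial (V : 'I_7 -> pt -> R) :
  (forall i, smooth (V i)) -> (forall i, periodic (V i)) ->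
  torus_int (fun p => \rsum_(i < 7) partial i (V i) p) = 0.
Proof.
move=> sV pV; elim: (index_enum _) => [|i l IH].
  have -> : (fun p => \big[Rplus/0]_(i <- [::]) partial i (V i) p) =
      fun p => 0 * (fun _ : pt => 0) p.
    by apply: functional_extensionality => p; rewrite big_nil Rmult_0_l.
  by rewrite (@torus_int_scal 0 (fun _ => 0)) ?Rmult_0_l //; exact: smooth_const.
have -> : (fun p => \big[Rplus/0]_(i <- i :: l) partial i (V i) p) =
    fun p => partial i (V i) p + \big[Rplus/0]_(i <- l) partial i (V i) p.
  by apply: functional_extensionality => p; rewrite big_cons.
rewrite torus_int_plus ?IH ?torus_int_partial ?Rplus_0_r //; first exact: smooth_partial.
elim: l {IH} => [|j l IHl].
  have := @smooth_const 7 0; congr smooth; apply: functional_extensionality => p.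
  by rewrite big_nil.
have := smooth_plus (smooth_partial j (sV j)) IHl; congr smooth.
by apply: functional_extensionality => p; rewrite big_cons.
Qed.

Lemma torus_int_coord (h : R -> R) : torus_int (fun p => h (p x0)) = RInt h 0 1.
Proof.
rewrite torus_intE.
have -> : enum 'I_7 = ords7.
  apply: (inj_map val_inj); rewrite val_enum_ord; by [].
have C (j : 'I_7) c : avg j (fun _ => c) = fun _ => c.
  by apply: functional_extensionality => p;
     rewrite /avg RInt_const /scal /= /mult /= Rminus_0_r Rmult_1_l.
have N (j : 'I_7) : j != x0 -> avg j (fun p : pt => h (p x0)) = fun p => h (p x0).
  move=> jx; apply: functional_extensionality => p.
  rewrite /avg (RInt_ext _ (fun _ => h (p x0))) => [|t _].
    by rewrite RInt_const /scal /= /mult /= Rminus_0_r Rmult_1_l.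
  by rewrite upd_other // eq_sym.
rewrite /= (N x3) // (N x2) // (N x1) //.
have -> : avg x0 (fun p : pt => h (p x0)) = fun _ => RInt h 0 1.
  by apply: functional_extensionality => p; apply: RInt_ext => t _; rewrite upd_same.
by rewrite !C.
Qed.

(** * The codifferential and its adjoint *)

Definition smooth_form (k : nat) (al : Defs.form) : Prop :=
  forall K, size K = k -> smooth (al K) /\ periodic (al K).

Definition alternating (k : nat) (al : Defs.form) : Prop :=
  forall I J a b p, size (I ++ a :: b :: J) = k ->
    al (I ++ a :: b :: J) p = - al (I ++ b :: a :: J) p.

Lemma is_formP k al : is_form k al <-> alternating k al /\ smooth_form k al.
Proof.
split=> [[aal sal]|[aal sal]]; split=> // K sK.
  by case: (sal K sK) => /smooth_onP sm per; split=> // p i; exact: per.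
by case: (sal K sK) => sm per; split; [exact/smooth_onP|exact: per].
Qed.

Lemma periodic_mult n (F G : ('I_n -> R) -> R) :
  periodic F -> periodic G -> periodic (fun p => F p * G p).
Proof. by move=> pF pG p i; rewrite pF pG. Qed.

Lemma periodic_sum n m (F : 'I_m -> ('I_n -> R) -> R) :
  (forall i, periodic (F i)) -> periodic (fun p => \rsum_(i < m) F i p).
Proof. by move=> pF p i; apply: eq_bigr => j _; exact: pF. Qed.

Lemma periodic_coord n (h : R -> R) (i : 'I_n) : (forall x, h (x + 1) = h x) ->
  periodic (fun p => h (p i)).
Proof.
move=> ph p j; case: (eqVneq i j) => [->|ij]; first by rewrite upd_same.
by rewrite upd_other.
Qed.

Lemma circ_coord h : circle_fun h ->
  smooth (fun p : pt => h (p x0)) /\ periodic (fun p : pt => h (p x0)).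
Proof. by case=> sh ph; split; [exact: smooth_coord|exact: periodic_coord]. Qed.

(* The weight with which a component of a form enters the codifferential. *)
Definition weight (u : R -> R) (K : seq 'I_7) (x : R) : R :=
  Rpower (u x) (1 / 3) * prodI (fun i => / met u (fun _ => x) i) K.

Lemma metE u p : met u (fun _ => p x0) = met u p.
Proof. by []. Qed.

Lemma circ_weight u K : circle_fun u -> (forall x, 0 < u x) -> circle_fun (weight u K).
Proof.
move=> cu u0; apply: circ_mult; first exact: circ_Rpower.
elim: K => [|i K IH] /=; first exact: circ_const.
apply: circ_mult => //; apply: circ_inv; last by move=> x; exact: met_pos.
have cr : circle_fun (fun x => croot u (fun _ => x)) by exact: circ_Rpower.
rewrite /met; case: (u_index i); first exact: circ_mult.
by apply: circ_inv => // x; exact: croot_pos.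
Qed.

(** The contravariant density sqrt(det g) al^K; up to the factor -1/sqrt(det g) and lowering of
    indices, its divergence is the codifferential. *)
Definition codensity (u : R -> R) (al : Defs.form) (K : seq 'I_7) (p : pt) : R :=
  weight u K (p x0) * al K p.

Section Geometry.
Variable u : R -> R.
Hypotheses (cu : circle_fun u) (u0 : forall x, 0 < u x).

Let phi := phi_of u.

Lemma volE p : g2_vol phi p = croot u p.
Proof. exact: g2_volE. Qed.

Lemma codiffE al K p : codiff phi al K p =
  prodI (met u p) K * (- / croot u p * \rsum_(i < 7) partial i (codensity u al (i :: K)) p).
Proof.
rewrite /codiff lowerE // volE; congr (_ * (_ * _)).
apply: eq_bigr => i _; congr (partial i _ p).
apply: functional_extensionality => q; rewrite volE raiseE //.
by rewrite /codensity /weight Rmult_assoc.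
Qed.

Lemma smooth_codensity k al K : smooth_form k al -> size K = k ->
  smooth (codensity u al K) /\ periodic (codensity u al K).
Proof.
move=> sal /sal [sK pK]; have [sw pw] := circ_coord (circ_weight K cu u0).
by split; [exact: smooth_mult|exact: periodic_mult].
Qed.

Lemma smooth_form_codiff k al : smooth_form k.+1 al -> smooth_form k (codiff phi al).
Proof.
move=> sal K sK.
have cm : circle_fun (fun x => prodI (met u (fun _ => x)) K * - / Rpower (u x) (1 / 3)).
  have cr : circle_fun (fun x => Rpower (u x) (1 / 3)) by exact: circ_Rpower.
  apply: circ_mult; last by apply: circ_opp; apply: circ_inv => // x; exact: exp_pos.
  elim: K {sK} => [|i K IH] /=; first exact: circ_const.
  apply: circ_mult => //; rewrite /met; case: (u_index i); first exact: circ_mult.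
  by apply: circ_inv => // x; exact: exp_pos.
have -> : codiff phi al K = fun p =>
    (fun p : pt => (fun x => prodI (met u (fun _ => x)) K * - / Rpower (u x) (1 / 3)) (p x0)) p *
    \rsum_(i < 7) partial i (codensity u al (i :: K)) p.
  by apply: functional_extensionality => p; rewrite codiffE metE Rmult_assoc.
have [sm pm] := circ_coord cm.
have sd i : smooth (codensity u al (i :: K)) /\ periodic (codensity u al (i :: K)).
  by apply: smooth_codensity sal _; rewrite /= sK.
split.
  apply: smooth_mult => //; apply: smooth_sum => i.
  by apply: smooth_partial; case: (sd i).
apply: periodic_mult => //; apply: periodic_sum => i.
by apply: periodic_partial; case: (sd i).
Qed.

Lemma innerE k al be p : inner phi k al be p =
  / INR (k`!)%nat * sum_idx k (fun K => al K p * (prodI (fun i => / met u p i) K * be K p)).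
Proof.
by congr (_ * _); apply: sum_idx_ext => K _; rewrite raiseE.
Qed.

Lemma inner_sym k al be p : inner phi k al be p = inner phi k be al p.
Proof. by rewrite !innerE; congr (_ * _); apply: sum_idx_ext => K _; ring. Qed.

Lemma inner_ext k al al' be p : form_eq k al al' -> inner phi k al be p = inner phi k al' be p.
Proof.
by move=> E; rewrite !innerE; congr (_ * _); apply: sum_idx_ext => K sK; rewrite E.
Qed.
End Geometry.

(** * Exact 3-forms are closed *)

Lemma ext3E al i j k p : ext al [:: i; j; k] p =
  partial i (al [:: j; k]) p - partial j (al [:: i; k]) p + partial k (al [:: i; j]) p.
Proof.
rewrite /ext (sum_ordE _ (fun b => (-1) ^ b *
  partial (nth x0 [:: i; j; k] b) (al (del b [:: i; j; k])) p)) /=.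
rewrite /del /=; ring.
Qed.

Lemma ext4E al i j k l p : ext al [:: i; j; k; l] p =
  partial i (al [:: j; k; l]) p - partial j (al [:: i; k; l]) p
  + partial k (al [:: i; j; l]) p - partial l (al [:: i; j; k]) p.
Proof.
rewrite /ext (sum_ordE _ (fun b => (-1) ^ b *
  partial (nth x0 [:: i; j; k; l] b) (al (del b [:: i; j; k; l])) p)) /=.
rewrite /del /=; ring.
Qed.

Lemma partial3 (F G H : pt -> R) i p : smooth F -> smooth G -> smooth H ->
  partial i (fun p => F p - G p + H p) p = partial i F p - partial i G p + partial i H p.
Proof.
move=> sF sG sH; apply: partial_unique; apply: is_derive_plus; last exact: smooth_is_derive_at.
by apply: is_derive_minus; exact: smooth_is_derive_at.
Qed.

Lemma size_del b (K : seq 'I_7) : leq b.+1 (size K) -> size (del b K) = (size K).-1.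
Proof.
move=> bK; rewrite /del size_cat size_take size_drop bK.
by apply/eqP; rewrite -eqSS (ltn_predK bK) -addnS subnSK // subnKC // ltnW.
Qed.

(** Once the order of differentiation is normalised, the twelve second derivatives cancel in
    pairs. *)
Lemma ext_ext al : smooth_form 2 al -> forall K p, size K = 4%nat -> ext (ext al) K p = 0.
Proof.
move=> sal [//|i [//|j [//|k [//|l [|//]]]]] p _.
have s a b : smooth (al [:: a; b]) by case: (sal [:: a; b] erefl).
have E a b c : ext al [:: a; b; c] = fun p =>
    partial a (al [:: b; c]) p - partial b (al [:: a; c]) p + partial c (al [:: a; b]) p.
  by apply: functional_extensionality => q; exact: ext3E.
rewrite ext4E !E !partial3 //; try exact: smooth_partial.
rewrite (@partial_comm _ _ j i) // (@partial_comm _ _ k i) // (@partial_comm _ _ l i) //.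
rewrite (@partial_comm _ _ k j) // (@partial_comm _ _ l j) // (@partial_comm _ _ l k) //.
ring.
Qed.

Lemma exact_closed w : exact_form 3 w -> forall K p, size K = 4%nat -> ext w K p = 0.
Proof.
case=> eta [/is_formP [_ seta] E] K p sK; rewrite -(ext_ext seta p sK).
apply: eq_bigr => b _; congr (_ * _); congr (partial _ _ p).
apply: functional_extensionality => q; apply: E.
by rewrite size_del ?sK.
Qed.

Section TripleSums.
Variable n : nat.
Implicit Types A W : 'I_n -> 'I_n -> 'I_n -> R.

Definition sum3 A : R := \rsum_(i < n) \rsum_(j < n) \rsum_(k < n) A i j k.

Lemma sum3_lin a A b W :
  sum3 (fun i j k => a * A i j k + b * W i j k) = a * sum3 A + b * sum3 W.
Proof.
rewrite /sum3 !(big_distrr _ _ (plus := Rplus) (times := Rmult)) /= -big_split /=; apply: eq_bigr => i _.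
rewrite !(big_distrr _ _ (plus := Rplus) (times := Rmult)) /= -big_split /=; apply: eq_bigr => j _.
by rewrite !(big_distrr _ _ (plus := Rplus) (times := Rmult)) /= -big_split.
Qed.

Lemma sum3_ext A W : (forall i j k, A i j k = W i j k) -> sum3 A = sum3 W.
Proof. by move=> E; do 3!apply: eq_bigr => ? _. Qed.

Lemma sum3_swap12 A : sum3 (fun i j k => A j i k) = sum3 A.
Proof. by rewrite /sum3 exchange_big. Qed.

Lemma sum3_swap23 A : sum3 (fun i j k => A i k j) = sum3 A.
Proof. by apply: eq_bigr => i _; rewrite exchange_big. Qed.

(* Antisymmetrising A is superfluous when it is paired with an alternating W. *)
Lemma sum3_alternating A W :
  (forall i j k, W i j k = - W j i k) -> (forall i j k, W i j k = - W i k j) ->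
  sum3 (fun i j k => (A i j k - A j i k + A k i j) * W i j k) =
  3 * sum3 (fun i j k => A i j k * W i j k).
Proof.
move=> W12 W23.
pose S := sum3 (fun i j k => A i j k * W i j k).
have S1 : sum3 (fun i j k => A j i k * W i j k) = - S.
  rewrite -sum3_swap12 -[- S]/(- sum3 _).
  rewrite (sum3_ext (W := fun i j k => (-1) * (A i j k * W i j k) + 0 * 0)).
    by rewrite (sum3_lin _ _ _ (fun _ _ _ => 0)) /S; ring.
  by move=> i j k; rewrite W12; ring.
have S2 : sum3 (fun i j k => A k i j * W i j k) = S.
  rewrite /S -[RHS]sum3_swap12 -[RHS]sum3_swap23.
  by apply: sum3_ext => i j k; rewrite W23 W12; ring.
rewrite (sum3_ext (W := fun i j k => 1 * (1 * (A i j k * W i j k) + (-1) * (A j i k * W i j k))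
   + 1 * (A k i j * W i j k))); last by move=> i j k; ring.
rewrite sum3_lin (sum3_lin 1 (fun i j k => A i j k * W i j k)
  (-1) (fun i j k => A j i k * W i j k)) S1 S2 -/S; ring.
Qed.
End TripleSums.

Lemma smooth_sum_idx k (F : seq 'I_7 -> pt -> R) :
  (forall K, size K = k -> smooth (F K)) -> smooth (fun p => sum_idx k (fun K => F K p)).
Proof.
elim: k F => [|k IH] F sF /=; first exact: sF.
apply: smooth_sum => i; apply: (IH (fun K => F (i :: K))) => K sK.
by apply: sF; rewrite /= sK.
Qed.

(** * Adjointness and independence of the chosen potential *)

Section Adjoint.
Variable u : R -> R.
Hypotheses (cu : circle_fun u) (u0 : forall x, 0 < u x).

Let phi := phi_of u.

Definition pairing k (al be : Defs.form) : R :=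
  torus_int (fun p => inner phi k al be p * g2_vol phi p).

Lemma codensity_alternating w : alternating 3 w ->
  (forall i j k p, codensity u w [:: i; j; k] p = - codensity u w [:: j; i; k] p) /\
  (forall i j k p, codensity u w [:: i; j; k] p = - codensity u w [:: i; k; j] p).
Proof.
move=> aw; split=> i j k p; rewrite /codensity /weight /=.
  by rewrite (aw [::] [:: k] i j p erefl) /=; ring.
by rewrite (aw [:: i] [::] j k p erefl) /=; ring.
Qed.

Lemma smooth_inner k al be : smooth_form k al -> smooth_form k be ->
  smooth (fun p => inner phi k al be p * g2_vol phi p).
Proof.
move=> sal sbe.
have -> : (fun p => inner phi k al be p * g2_vol phi p) = fun p =>
    (fun _ : pt => / INR (k`!)%nat) p * sum_idx k (fun K => al K p * codensity u be K p).
  apply: functional_extensionality => p; rewrite innerE // volE // Rmult_assoc; congr (_ * _).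
  rewrite Rmult_comm -sum_idx_scal; apply: sum_idx_ext => K _.
  by rewrite /codensity /weight metE /croot; ring.
apply: smooth_mult; first exact: smooth_const.
have sF K : size K = k -> smooth (fun p => al K p * codensity u be K p).
  move=> sK; apply: smooth_mult; first by case: (sal K sK).
  by case: (smooth_codensity cu u0 sbe sK).
exact: (@smooth_sum_idx k (fun K p => al K p * codensity u be K p)).
Qed.

Lemma INR_fact3 : INR (3`!)%nat = 6.
Proof. by rewrite /factorial /=; lra. Qed.

Lemma INR_fact2 : INR (2`!)%nat = 2.
Proof. by rewrite /factorial /=; lra. Qed.

(** The two integrands differ by the divergence of V^i = (1/2) sum_jk eta_jk sqrt(det g) w^ijk, and
    a divergence integrates to zero on the torus. *)
Lemma codiff_adjoint eta w : smooth_form 2 eta -> alternating 3 w -> smooth_form 3 w ->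
  pairing 3 (ext eta) w = pairing 2 eta (codiff phi w).
Proof.
move=> seta aw sw; have [W12 W23] := codensity_alternating aw.
have sd i j k : smooth (codensity u w [:: i; j; k]) /\ periodic (codensity u w [:: i; j; k]).
  exact: smooth_codensity sw _.
have se j k : smooth (eta [:: j; k]) /\ periodic (eta [:: j; k]) by exact: seta.
pose V (i : 'I_7) p := \rsum_(j < 7) \rsum_(k < 7)
  (/ 2 * (eta [:: j; k] p * codensity u w [:: i; j; k] p)).
have sV1 i j k : smooth (fun p => / 2 * (eta [:: j; k] p * codensity u w [:: i; j; k] p)).
  apply: (@smooth_mult _ (fun _ => / 2)); first exact: smooth_const.
  by apply: smooth_mult; [case: (se j k)|case: (sd i j k)].
have sV2 i j : smooth (fun p => \rsum_(k < 7)
    (/ 2 * (eta [:: j; k] p * codensity u w [:: i; j; k] p))).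
  exact: smooth_sum.
have sV i : smooth (V i) by exact: smooth_sum.
have pV i : periodic (V i).
  apply: periodic_sum => j; apply: periodic_sum => k p l.
  by case: (se j k) => _ ->; case: (sd i j k) => _ ->.
have DV i p : partial i (V i) p = \rsum_(j < 7) \rsum_(k < 7)
    (/ 2 * (partial i (eta [:: j; k]) p * codensity u w [:: i; j; k] p
            + eta [:: j; k] p * partial i (codensity u w [:: i; j; k]) p)).
  rewrite partial_sum //; apply: eq_bigr => j _; rewrite partial_sum //.
  apply: eq_bigr => k _; rewrite partial_scal partial_mult //;
    by [case: (se j k)|case: (sd i j k)].
have scw := smooth_form_codiff cu u0 sw.
have sDV : smooth (fun p => \rsum_(i < 7) partial i (V i) p).
  by apply: smooth_sum => i; exact: smooth_partial.
rewrite -[RHS]Rplus_0_r -(torus_int_sum_partial sV pV) /pairing -torus_int_plus //;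
  last exact: smooth_inner.
congr torus_int; apply: functional_extensionality => p.
rewrite innerE // innerE // !volE // INR_fact3 INR_fact2.
have a0 := croot_pos u p.
pose A (i j k : 'I_7) := partial i (eta [:: j; k]) p.
pose W (i j k : 'I_7) := codensity u w [:: i; j; k] p.
pose W' (i j k : 'I_7) := eta [:: j; k] p * partial i (codensity u w [:: i; j; k]) p.
(* The three terms of d eta contribute equally against the alternating w; this factor 3 turns 1/3!
   into 1/2!. *)
have -> : / 6 * sum_idx 3 (fun K => ext eta K p * (prodI (fun i => / met u p i) K * w K p))
    * croot u p = / 2 * sum3 (fun i j k => A i j k * W i j k).
  have <- : / 6 * (3 * sum3 (fun i j k => A i j k * W i j k)) =
      / 2 * sum3 (fun i j k => A i j k * W i j k) by field.
  rewrite -sum3_alternating; [|by move=> *; exact: W12|by move=> *; exact: W23].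
  rewrite Rmult_assoc; congr (_ * _); rewrite Rmult_comm -sum_idx_scal.
  do 3!apply: eq_bigr => ? _.
  rewrite ext3E /W /codensity /weight metE /A /croot; ring.
have -> : / 2 * sum_idx 2 (fun K => eta K p *
      (prodI (fun i => / met u p i) K * codiff phi w K p)) * croot u p =
    - (/ 2 * sum3 W').
  set T := sum_idx 2 _.
  transitivity (/ 2 * (croot u p * T)); first by ring.
  transitivity (/ 2 * (-1 * sum3 W')); last by ring.
  congr (_ * _); rewrite -sum_idx_scal /sum3 exchange_big
    (big_distrr _ _ (plus := Rplus) (times := Rmult)).
  apply: eq_bigr => j _; rewrite [in RHS]exchange_big
    (big_distrr _ _ (plus := Rplus) (times := Rmult)); apply: eq_bigr => k _.
  pose S := \rsum_(i < 7) partial i (codensity u w [:: i; j; k]) p.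
  have E : \rsum_(i < 7) W' i j k = eta [:: j; k] p * S.
    by rewrite /S (big_distrr _ _ (plus := Rplus) (times := Rmult)).
  transitivity (-1 * (eta [:: j; k] p * S)); last by rewrite -E.
  transitivity (croot u p * (eta [:: j; k] p *
    (prodI (fun i => / met u p i) [:: j; k] * codiff phi w [:: j; k] p))); first by [].
  rewrite codiffE // -/S.
  have P := prodI_inv [:: j; k] (@met_neq0 u p).
  transitivity (- (prodI (met u p) [:: j; k] * prodI (fun i => / met u p i) [:: j; k]) *
    (croot u p * / croot u p) * (eta [:: j; k] p * S)); first by rewrite /=; ring.
  by rewrite P Rinv_r; [ring|lra].
have -> : \rsum_(i < 7) partial i (V i) p =
    / 2 * sum3 (fun i j k => A i j k * W i j k) + / 2 * sum3 W'.
  rewrite -sum3_lin; apply: eq_bigr => i _; rewrite DV.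
  by apply: eq_bigr => j _; apply: eq_bigr => k _; rewrite Rmult_plus_distr_l.
ring.
Qed.

(** For [phi_of u], the property by which [exact_potential] is chosen. *)
Definition potential (X w : Defs.form) : Prop :=
  is_form 3 w /\ exact_form 3 w /\ form_eq 3 (laplacian phi w) X.

Lemma codiff_ext_exact w : exact_form 3 w ->
  forall K p, size K = 3%nat -> codiff phi (ext w) K p = 0.
Proof.
move=> ew K p sK; rewrite codiffE // big1 ?Rmult_0_r // => i _.
have -> : codensity u (ext w) (i :: K) = fun _ => 0.
  apply: functional_extensionality => q; rewrite /codensity exact_closed ?Rmult_0_r //.
  by rewrite /= sK.
exact: Derive_const.
Qed.

Lemma potential_ext_codiff X w : potential X w -> form_eq 3 (ext (codiff phi w)) X.
Proof.
case=> _ [ew E] K p sK; rewrite -(E K p sK) /laplacian codiff_ext_exact ?Rplus_0_r //.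
Qed.

Lemma pairing_ext k al al' be : form_eq k al al' -> pairing k al be = pairing k al' be.
Proof.
move=> E; congr torus_int; apply: functional_extensionality => p; congr (_ * _).
exact: inner_ext.
Qed.

Lemma pairing_sym k al be : pairing k al be = pairing k be al.
Proof.
by congr torus_int; apply: functional_extensionality => p; rewrite inner_sym.
Qed.

(** Adjointness moves the codifferential from w' to an exterior derivative on the other side, and d
    delta w = X because the exact form w is closed. *)
Lemma pairing_codiff X w w' : potential X w -> is_form 3 w' ->
  pairing 2 (codiff phi w) (codiff phi w') = pairing 3 X w'.
Proof.
move=> pw /is_formP [aw' sw']; case: (pw) => /is_formP [aw sw] _.
rewrite -codiff_adjoint //; last exact: smooth_form_codiff.
exact/pairing_ext/potential_ext_codiff.
Qed.

(* Both potentials may be replaced one after the other by adjointness, so no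
   uniqueness of solutions of the Laplace equation is needed. *)
Lemma dirichlet_potential X Y v w : potential X v -> potential Y w ->
  dirichlet phi X Y = pairing 2 (codiff phi v) (codiff phi w).
Proof.
move=> pv pw.
have H Z z : potential Z z -> potential Z (exact_potential phi Z).
  move=> pz; apply: (epsilon_spec (inhabits (fun _ _ => 0 : R)) (potential Z)).
  by exists z.
have pv' := H X v pv; have pw' := H Y w pw.
rewrite -[LHS]/(pairing 2 (codiff phi (exact_potential phi X))
                          (codiff phi (exact_potential phi Y))).
rewrite (pairing_codiff pv'); last by case: pw'.
rewrite -(pairing_codiff pv); last by case: pw'.
rewrite pairing_sym (pairing_codiff pw'); last by case: pv.
rewrite -(pairing_codiff pw); last by case: pv.
exact: pairing_sym.
Qed.
End Adjoint.

(** * The Dirichlet metric on M_1 *)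

(* Coquelicot states equations between integrals in a complete normed module,
   where [ring] and [field] do not recognise R. *)
Ltac eqR := lazymatch goal with |- @eq _ ?a ?b => change (@eq R a b) end.

Lemma RInt_eq (f g : R -> R) a b : (forall x, f x = g x) -> RInt f a b = RInt g a b :> R.
Proof. by move=> E; apply: RInt_ext => x _; exact: E. Qed.

Lemma is_derive_cst (c x : R) : is_derive (fun _ : R => c) x 0.
Proof. by auto_derive. Qed.

(* The weighted primitive Q(f) of the statement. *)
Definition Qprim (u f : R -> R) : R -> R := fun x =>
  prim f x - RInt (fun x => prim f x / u x) 0 1 / RInt (fun x => / u x) 0 1.

Lemma QprimE u f x : Qprim u f x =
  prim f x - RInt (fun x => prim f x / u x) 0 1 / RInt (fun x => / u x) 0 1.
Proof. by []. Qed.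

Section Primitive.
Variable u : R -> R.
Hypotheses (cu : circle_fun u) (u0 : forall x, 0 < u x).

Lemma RInt_inv_pos : 0 < RInt (fun x => / u x) 0 1.
Proof.
have ci := circ_inv cu u0.
have [m [m0 Hm]] := circ_pos_min ci (fun x => Rinv_0_lt_compat _ (u0 x)).
apply: Rlt_le_trans m0 _.
have <- : RInt (fun _ => m) 0 1 = m by rewrite RInt_const /scal /= /mult /=; ring.
apply: RInt_le => //; [lra|exact: ex_RInt_const|exact: circ_ex_RInt].
Qed.

Lemma circ_Qprim f : tangent f -> circle_fun (Qprim u f).
Proof. by move=> tf; apply: circ_minus; [exact: tangent_prim|exact: circ_const]. Qed.

Lemma Qprim_is_derive f x : tangent f -> is_derive (Qprim u f) x (f x).
Proof.
move=> [cf _]; rewrite -[f x]Rminus_0_r; apply: is_derive_minus.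
  exact: prim_is_derive.
exact: is_derive_cst.
Qed.

Lemma Derive_Qprim f x : tangent f -> Derive (Qprim u f) x = f x.
Proof. by move=> tf; apply: is_derive_unique; exact: Qprim_is_derive. Qed.

Lemma RInt_Qprim f : tangent f -> RInt (fun x => Qprim u f x / u x) 0 1 = 0.
Proof.
move=> tf; have cp := tangent_prim tf; have I0 := RInt_inv_pos.
set b := RInt (fun x => prim f x / u x) 0 1 / RInt (fun x => / u x) 0 1.
rewrite (@RInt_eq _ (fun x => 1 * (prim f x / u x) + (- b) * / u x)).
  rewrite circ_RInt_lin; [|exact: circ_div|exact: circ_inv].
  by rewrite /b; eqR; field; lra.
by move=> x; rewrite /Qprim -/b /Rdiv; ring.
Qed.

(** Two primitives of f differ by a constant, and the normalisation kills it because the integral of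
    1/u is positive. *)
Lemma Qprim_unique f q : tangent f -> circle_fun q -> (forall x, is_derive q x (f x)) ->
  RInt (fun x => q x / u x) 0 1 = 0 -> q = Qprim u f.
Proof.
move=> tf cq Dq mq; have I0 := RInt_inv_pos; have cQ := circ_Qprim tf.
have [c Hc] : exists c, forall x, q x = c + Qprim u f x.
  exists (q 0 - Qprim u f 0) => x.
  have D y : is_derive (fun y => q y - Qprim u f y) y 0.
    rewrite -[0](Rminus_diag (f y)); apply: is_derive_minus => //.
    exact: Qprim_is_derive.
  have [||z [_]] := MVT_gen (fun y => q y - Qprim u f y) 0 x (fun _ => 0) => //.
    move=> y _; apply/continuity_pt_filterlim.
    exact: (@ex_derive_continuous _ _ (fun y => q y - Qprim u f y) y (ex_intro _ _ (D y))).
  lra.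
have c0 : c = 0.
  move: mq; rewrite (@RInt_eq _ (fun x => c * / u x + 1 * (Qprim u f x / u x))).
    rewrite circ_RInt_lin; [|exact: circ_inv|exact: circ_div].
    rewrite RInt_Qprim // Rmult_0_r Rplus_0_r => /Rmult_integral [//|]; lra.
  by move=> x; rewrite Hc /Rdiv; ring.
by apply: functional_extensionality => x; rewrite Hc c0 Rplus_0_l.
Qed.
End Primitive.

(** * An explicit potential *)

Lemma ext_coord (h : R -> R) L K p :
  ext (fun K p => h (p x0) * dx L K p) K p = Derive h (p x0) * dx (x0 :: L) K p.
Proof.
rewrite -[dx (x0 :: L)]/(wedge1 x0 (dx L)) /wedge1 (big_distrr _ _ (plus := Rplus) (times := Rmult)).
apply: eq_bigr => b _ /=.
have -> : (fun p : pt => h (p x0) * dx L (del b K) p) =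
    fun p => IZR (dxZ L (del b K)) * h (p x0).
  by apply: functional_extensionality => q; rewrite dxE; ring.
rewrite partial_scal partial_coord dxE eq_sym.
by case: ifP => _; ring.
Qed.

(** In these names 0 and 3 stand for x^0 and x^3, and 2 for theta^3. The order of [e203] is that of
    [tangent_form]. *)
Definition e23 : seq 'I_7 := [:: th3; x3].
Definition e023 : seq 'I_7 := [:: x0; th3; x3].
Definition e203 : seq 'I_7 := [:: th3; x0; x3].

Lemma all_ords2 (P : 'I_7 -> 'I_7 -> bool) :
  all (fun a => all (P a) ords7) ords7 -> forall a b, P a b.
Proof. by move=> /allP H a b; apply: (allP (H a (mem_ords7 a))); exact: mem_ords7. Qed.

Lemma all_ords3 (P : 'I_7 -> 'I_7 -> 'I_7 -> bool) :
  all (fun a => all (fun b => all (P a b) ords7) ords7) ords7 -> forall a b c, P a b c.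
Proof.
move=> H a b c; have := @all_ords2 (fun a b => all (P a b) ords7) H a b.
by move=> /allP; apply; exact: mem_ords7.
Qed.

Lemma e23_anti a b : dxZ e23 [:: a; b] = Z.opp (dxZ e23 [:: b; a]).
Proof.
apply/Z.eqb_eq; refine (@all_ords2 (fun a b => Z.eqb (dxZ e23 [:: a; b]) (Z.opp (dxZ e23 [:: b; a]))) _ a b).
by vm_compute.
Qed.

Lemma e023_anti12 a b c : dxZ e023 [:: a; b; c] = Z.opp (dxZ e023 [:: b; a; c]).
Proof.
apply/Z.eqb_eq; refine (@all_ords3 (fun a b c => Z.eqb (dxZ e023 [:: a; b; c]) (Z.opp (dxZ e023 [:: b; a; c]))) _ a b c).
by vm_compute.
Qed.

Lemma e023_anti23 a b c : dxZ e023 [:: a; b; c] = Z.opp (dxZ e023 [:: a; c; b]).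
Proof.
apply/Z.eqb_eq; refine (@all_ords3 (fun a b c => Z.eqb (dxZ e023 [:: a; b; c]) (Z.opp (dxZ e023 [:: a; c; b]))) _ a b c).
by vm_compute.
Qed.

Lemma e203_e023 a b c : dxZ e203 [:: a; b; c] = Z.opp (dxZ e023 [:: a; b; c]).
Proof.
apply/Z.eqb_eq; refine (@all_ords3 (fun a b c => Z.eqb (dxZ e203 [:: a; b; c]) (Z.opp (dxZ e023 [:: a; b; c]))) _ a b c).
by vm_compute.
Qed.

Lemma e023_x0 a b : dxZ e023 [:: x0; a; b] = dxZ e23 [:: a; b].
Proof.
apply/Z.eqb_eq; refine (@all_ords2 (fun a b => Z.eqb (dxZ e023 [:: x0; a; b]) (dxZ e23 [:: a; b])) _ a b).
by vm_compute.
Qed.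

(** Wherever this form has a nonzero component both indices carry the metric factor a^2, so the
    powers of a in its codifferential and norm are known without going through the indices. *)
Lemma e23_support a b : dxZ e23 [:: a; b] <> 0%Z -> u_index a && u_index b.
Proof.
have H : (Z.eqb (dxZ e23 [:: a; b]) 0) || (u_index a && u_index b).
  refine (@all_ords2 (fun a b => Z.eqb (dxZ e23 [:: a; b]) 0 || (u_index a && u_index b)) _ a b).
  by vm_compute.
by case/orP: H => // /Z.eqb_eq ->.
Qed.

Lemma sum_e23_sq : sumZ ords7 (fun a => sumZ ords7 (fun b =>
  Z.mul (dxZ e23 [:: a; b]) (dxZ e23 [:: a; b]))) = 2%Z.
Proof. by vm_compute. Qed.

Lemma smooth_form_coord k (h : R -> R) L : circle_fun h ->
  smooth_form k (fun K p => h (p x0) * dx L K p).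
Proof.
move=> ch K _; have -> : (fun p : pt => h (p x0) * dx L K p) =
    fun p => (fun x => h x * IZR (dxZ L K)) (p x0).
  by apply: functional_extensionality => p; rewrite dxE.
exact: (circ_coord (circ_mult ch (circ_const (IZR (dxZ L K))))).
Qed.

Lemma is_form_e23 h : circle_fun h -> is_form 2 (fun K p => h (p x0) * dx e23 K p).
Proof.
move=> ch; apply/is_formP; split; last exact: smooth_form_coord.
move=> [|i [|j I]] [|k J] a b p sz; try by move/eqP: sz; rewrite /= ?size_cat /= ?addnS.
by rewrite !dxE (e23_anti a b : dxZ e23 ([::] ++ [:: a; b]) = Z.opp (dxZ e23 ([::] ++ [:: b; a]))) opp_IZR; ring.
Qed.

Lemma is_form_e023 h : circle_fun h -> is_form 3 (fun K p => h (p x0) * dx e023 K p).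
Proof.
move=> ch; apply/is_formP; split; last exact: smooth_form_coord.
move=> [|i [|j I]] [|k [|l J]] a b p sz; try by move/eqP: sz; rewrite /= ?size_cat /= ?addnS.
  by rewrite !dxE (e023_anti12 a b k : dxZ e023 ([::] ++ [:: a; b; k]) =
    Z.opp (dxZ e023 ([::] ++ [:: b; a; k]))) opp_IZR; ring.
by rewrite !dxE (e023_anti23 i a b : dxZ e023 ([:: i] ++ [:: a; b]) =
  Z.opp (dxZ e023 ([:: i] ++ [:: b; a]))) opp_IZR; ring.
Qed.

Section Potential.
Variables u f : R -> R.
Hypotheses (cu : circle_fun u) (u0 : forall x, 0 < u x) (tf : tangent f).

Let a x := Rpower (u x) (1 / 3).
Let P := prim (fun x => Qprim u f x / u x).
Let a5 x := a x * a x * a x * a x * a x.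
Let c := RInt (fun x => a5 x * P x) 0 1 / RInt a5 0 1.
(** The component of index x^0 theta^3 x^3 has weight a^(-5), so h becomes -(P - c), with derivative
    -Q(f)/u; lowering two indices and dividing by the volume multiplies by -a^3 = -u and leaves
    Q(f). P is periodic because Q(f)/u has zero integral. The constant c makes the integral of h
    vanish, so that h has a periodic primitive and the form is exact. *)
Let h x := - (a5 x * (P x - c)).

Lemma potential_aux :
  [/\ tangent h, circle_fun a, circle_fun P & forall x, is_derive P x (Qprim u f x / u x)].
Proof.
have ca : circle_fun a by exact: circ_Rpower.
have ca5 : circle_fun a5 by do !apply: circ_mult.
have a0 x : 0 < a x by exact: exp_pos.
have a50 x : 0 < a5 x by rewrite /a5; do !apply: Rmult_lt_0_compat.
have cq : circle_fun (fun x => Qprim u f x / u x).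
  by apply: circ_div => //; exact: circ_Qprim.
have tq : tangent (fun x => Qprim u f x / u x) by split=> //; exact: RInt_Qprim.
have cP : circle_fun P by exact: tangent_prim.
split=> //; last by move=> x; exact: prim_is_derive.
have Ia : 0 < RInt a5 0 1.
  have [m [m0 Hm]] := circ_pos_min ca5 a50; apply: Rlt_le_trans m0 _.
  have <- : RInt (fun _ => m) 0 1 = m by rewrite RInt_const /scal /= /mult /=; ring.
  apply: RInt_le => //; [lra|exact: ex_RInt_const|exact: circ_ex_RInt].
split.
  by apply: circ_opp; apply: circ_mult => //; apply: circ_minus => //; exact: circ_const.
rewrite (@RInt_eq _ (fun x => (-1) * (a5 x * P x) + c * a5 x)).
  by rewrite circ_RInt_lin //; [rewrite /c; eqR; field; lra|exact: circ_mult].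
by move=> x; rewrite /h; ring.
Qed.

Definition epot : Defs.form := fun K p => h (p x0) * dx e023 K p.

Lemma codiff_epot K p : size K = 2%nat ->
  codiff (phi_of u) epot K p = Qprim u f (p x0) * dx e23 K p.
Proof.
have [th ca cP DP] := potential_aux; have a0 x : 0 < a x by exact: exp_pos.
case: K => [|k1 [|k2 [|//]]] // _.
rewrite codiffE //.
have E i : partial i (codensity u epot [:: i; k1; k2]) p =
    if x0 == i then Derive (fun x => weight u [:: i; k1; k2] x * h x) (p x0) *
                    IZR (dxZ e023 [:: i; k1; k2]) else 0.
  have -> : codensity u epot [:: i; k1; k2] = fun p => IZR (dxZ e023 [:: i; k1; k2]) *
      (fun x => weight u [:: i; k1; k2] x * h x) (p x0).
    by apply: functional_extensionality => q; rewrite /codensity /epot dxE; ring.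
  rewrite partial_scal (@partial_coord 7 (fun x => weight u [:: i; k1; k2] x * h x) x0 i p).
  case: ifP => _; ring.
rewrite (eq_bigr _ (fun i _ => E i)) (bigD1 x0) // big1 => [|i /negbTE]; last first.
  by rewrite eq_sym => ->.
rewrite eqxx -[X in _ * (_ * X)]/(_ + 0) Rplus_0_r e023_x0 dxE.
case: (Z.eq_dec (dxZ e23 [:: k1; k2]) 0) => [->|/e23_support/andP [H1 H2]]; first ring.
(* Volume a times three inverse metric factors a^(-2). *)
have W x : weight u [:: x0; k1; k2] x = / a5 x.
  rewrite /weight /= /met H1 H2 /= /croot -/(a x) /a5; have := a0 x => ?; field; lra.
have -> : (fun x => weight u [:: x0; k1; k2] x * h x) = fun x => - (P x - c).
  apply: functional_extensionality => x; rewrite W /h.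
  have : a5 x <> 0 by rewrite /a5; have := a0 x => ?; do !apply: Rmult_integral_contrapositive_currified; lra.
  by move=> ?; field.
have -> : Derive (fun x => - (P x - c)) (p x0) = - (Qprim u f (p x0) / u (p x0)).
  apply: is_derive_unique; apply: (@is_derive_opp _ _ (fun x => P x - c)).
  rewrite -[_ / _]Rminus_0_r; apply: is_derive_minus => //; exact: is_derive_cst.
have Eu : u (p x0) = croot u p * croot u p * croot u p by rewrite (@croot3 u p).
rewrite /= /met H1 H2 Eu; have a1 := croot_pos u p.
by field; lra.
Qed.

(** On an exact form the Laplacian is d delta, and d (Q(f) e23) = f e023. Exchanging the first two
    factors produces the minus sign of [tangent_form]. *)
Lemma epot_potential : potential u (tangent_form f) epot.
Proof.
have [th ca cP DP] := potential_aux.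
have ch : circle_fun h by case: th.
have ex : exact_form 3 epot.
  exists (fun K p => prim h (p x0) * dx e23 K p); split.
    exact/is_form_e23/tangent_prim.
  move=> K p sK; rewrite ext_coord /epot; congr (_ * _).
  by apply/esym/is_derive_unique; exact: prim_is_derive.
split; first exact: is_form_e023.
split=> // K p sK.
rewrite /laplacian codiff_ext_exact // Rplus_0_r.
have -> : ext (codiff (phi_of u) epot) K p =
    ext (fun K p => Qprim u f (p x0) * dx e23 K p) K p.
  apply: eq_bigr => b _; congr (_ * _); congr (partial _ _ p).
  apply: functional_extensionality => q; apply: codiff_epot.
  by rewrite size_del ?sK.
rewrite ext_coord Derive_Qprim // /tangent_form.
case: K sK => [|k1 [|k2 [|k3 [|//]]]] // _.
by rewrite !dxE -/e203 e203_e023 -/e023 opp_IZR; ring.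
Qed.
End Potential.

Definition Gform (u f g : R -> R) : R := RInt (fun x => Qprim u f x * Qprim u g x / u x) 0 1.

(** Raising two indices gives a^(-4), the volume a, together 1/u. Each unordered pair of indices
    occurs twice, which cancels 1/2!. *)
Lemma pairing_e23 u F H al be : (forall x, 0 < u x) ->
  (forall K p, size K = 2%nat -> al K p = F (p x0) * dx e23 K p) ->
  (forall K p, size K = 2%nat -> be K p = H (p x0) * dx e23 K p) ->
  pairing u 2 al be = RInt (fun x => F x * H x / u x) 0 1.
Proof.
move=> u0 alE beE.
rewrite -torus_int_coord; congr torus_int; apply: functional_extensionality => p.
rewrite innerE // volE // INR_fact2.
have a0 := croot_pos u p; set a := croot u p in a0 *.
have Eu : u (p x0) = a * a * a by rewrite (@croot3 u p).
rewrite (@sum_idx_ext 2 _ (fun K => (F (p x0) * H (p x0) / (a * a * a * a)) *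
  (IZR (dxZ e23 K) * IZR (dxZ e23 K)))).
  rewrite sum_idx_scal.
  have -> : sum_idx 2 (fun K => IZR (dxZ e23 K) * IZR (dxZ e23 K)) = 2.
    rewrite -[2]/(IZR 2) -sum_e23_sq.
    rewrite -[LHS]/(\rsum_(i < 7) \rsum_(j < 7) (IZR (dxZ e23 [:: i; j]) * IZR (dxZ e23 [:: i; j]))).
    rewrite sum7E; apply: sumZ_IZR => i; rewrite sum7E; apply: sumZ_IZR => j.
    by rewrite mult_IZR.
  by rewrite Eu; field; lra.
move=> [|i [|j [|//]]] // _.
rewrite alE // beE // !dxE.
case: (Z.eq_dec (dxZ e23 [:: i; j]) 0) => [->|/e23_support/andP [H1 H2]]; first ring.
by rewrite /= /met H1 H2 -/a; field; lra.
Qed.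

Lemma GE u f g : circle_fun u -> (forall x, 0 < u x) -> tangent f -> tangent g ->
  G u f g = Gform u f g.
Proof.
move=> cu u0 tf tg.
rewrite /G (dirichlet_potential cu u0 (epot_potential cu u0 tf) (epot_potential cu u0 tg)).
by apply: pairing_e23 => // K p sK; exact: codiff_epot.
Qed.

(** All integrations by parts are made in this form: F is the boundary term, and what remains is a
    pointwise identity for its derivative. *)
Lemma circ_RInt_parts F f g : circle_fun F -> circle_fun f -> circle_fun g ->
  (forall x, is_derive F x (f x - g x)) -> RInt f 0 1 = RInt g 0 1 :> R.
Proof.
move=> cF cf cg D; have := circ_RInt_is_derive cF D.
rewrite (@RInt_eq _ (fun x => 1 * f x + (-1) * g x)) => [|x]; last by ring.
rewrite circ_RInt_lin // => H; apply: Rminus_diag_uniq.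
by rewrite -[RHS]H; eqR; ring.
Qed.

(** * The metric as a quadratic form in Q *)

Section Form.
Variable u : R -> R.
Hypotheses (cu : circle_fun u) (u0 : forall x, 0 < u x).

Lemma tangent_lin a f g : tangent f -> tangent g -> tangent (fun x => a * f x + g x).
Proof.
move=> [cf If] [cg Ig]; split.
  by apply: circ_plus => //; apply: circ_mult => //; exact: circ_const.
rewrite (@RInt_eq _ (fun x => a * f x + 1 * g x)) => [|x]; last by ring.
by rewrite circ_RInt_lin // If Ig; eqR; ring.
Qed.

Lemma Qprim_lin a f g : tangent f -> tangent g ->
  Qprim u (fun x => a * f x + g x) = fun x => a * Qprim u f x + Qprim u g x.
Proof.
move=> tf tg; symmetry; have cf := circ_Qprim u tf; have cg := circ_Qprim u tg.
apply: Qprim_unique => //.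
- exact: tangent_lin.
- by apply: circ_plus => //; apply: circ_mult => //; exact: circ_const.
- move=> x; apply: (is_derive_plus (fun x => a * Qprim u f x)); last exact: Qprim_is_derive.
  by apply: (is_derive_scal (Qprim u f)); exact: Qprim_is_derive.
- rewrite (@RInt_eq _ (fun x => a * (Qprim u f x / u x) + 1 * (Qprim u g x / u x))) => [|x].
    rewrite circ_RInt_lin; [|exact: circ_div|exact: circ_div].
    by rewrite !RInt_Qprim //; eqR; ring.
  by rewrite /Rdiv; ring.
Qed.

Lemma Gform_sym f g : Gform u f g = Gform u g f.
Proof. by apply: RInt_eq => x; rewrite /Rdiv; ring. Qed.

Lemma circ_Gform f g : tangent f -> tangent g ->
  circle_fun (fun x => Qprim u f x * Qprim u g x / u x).
Proof.
by move=> tf tg; apply: circ_div => //; apply: circ_mult; exact: circ_Qprim.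
Qed.

Lemma Gform_lin a f g h : tangent f -> tangent g -> tangent h ->
  Gform u (fun x => a * f x + g x) h = a * Gform u f h + Gform u g h.
Proof.
move=> tf tg th; rewrite /Gform Qprim_lin //.
rewrite (@RInt_eq _ (fun x => a * (Qprim u f x * Qprim u h x / u x)
    + 1 * (Qprim u g x * Qprim u h x / u x))) => [|x].
  by rewrite circ_RInt_lin; [eqR; ring|exact: circ_Gform|exact: circ_Gform].
by rewrite /Rdiv; ring.
Qed.

Lemma Gform_ge0 f : tangent f -> 0 <= Gform u f f.
Proof.
move=> tf; apply: RInt_ge0 => [x|]; last by apply: circ_ex_RInt; exact: circ_Gform.
by apply: Rle_mult_inv_pos => //; nra.
Qed.

Lemma Gform_definite f : tangent f -> Gform u f f = 0 -> forall x, f x = 0.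
Proof.
move=> tf G0 x.
have H y : Qprim u f y = 0.
  have := circ_RInt_eq0 (circ_Gform tf tf) _ G0.
  move=> /(_ (fun z => Rle_mult_inv_pos _ _ (Rle_0_sqr _) (u0 z)) y).
  move=> /Rmult_integral [/Rsqr_0_uniq//|]; have := Rinv_0_lt_compat _ (u0 y); lra.
rewrite -(Derive_Qprim u x tf) (Derive_ext _ (fun _ => 0)) ?Derive_const //.
Qed.

(* The mean of q drops out since [Qprim u h / u] has zero integral. *)
Lemma Gform_Derive q h : circle_fun q -> tangent h ->
  Gform u (Derive q) h = RInt (fun x => q x * Qprim u h x / u x) 0 1.
Proof.
move=> cq th; have I0 := RInt_inv_pos cu u0; have cQ := circ_Qprim u th.
set m := RInt (fun x => q x / u x) 0 1 / RInt (fun x => / u x) 0 1.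
have -> : Gform u (Derive q) h = RInt (fun x => (q x - m) * Qprim u h x / u x) 0 1.
  rewrite /Gform -(@Qprim_unique u cu u0 (Derive q) (fun x => q x - m)) //.
  - exact: tangent_Derive.
  - by apply: circ_minus => //; exact: circ_const.
  - move=> x; rewrite -[Derive q x]Rminus_0_r; apply: is_derive_minus.
      exact: circ_is_derive.
    exact: is_derive_cst.
  - rewrite (@RInt_eq _ (fun x => 1 * (q x / u x) + (- m) * / u x)) => [|x].
      rewrite circ_RInt_lin; [|exact: circ_div|exact: circ_inv].
      by rewrite /m; eqR; field; lra.
    by rewrite /Rdiv; ring.
rewrite (@RInt_eq _ (fun x => 1 * (q x * Qprim u h x / u x) + (- m) * (Qprim u h x / u x))) => [|x].
  rewrite circ_RInt_lin; last exact: circ_div.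
    by rewrite RInt_Qprim //; eqR; ring.
  by apply: circ_div => //; exact: circ_mult.
by rewrite /Rdiv; ring.
Qed.

(** The right side is a covariance for the density 1/u, hence independent of c and d. Constants
    taken from one u can thus be frozen while u varies, which leaves only the weights 1/u to
    differentiate. *)
Lemma Gform_shift f g c d : tangent f -> tangent g ->
  Gform u f g = RInt (fun x => (prim f x - c) * (prim g x - d) / u x) 0 1 -
    RInt (fun x => (prim f x - c) / u x) 0 1 * RInt (fun x => (prim g x - d) / u x) 0 1
      / RInt (fun x => / u x) 0 1.
Proof.
move=> tf tg; have I0 := RInt_inv_pos cu u0; set I := RInt (fun x => / u x) 0 1 in I0 *.
have cp h e : tangent h -> circle_fun (fun x => prim h x - e).
  by move=> th; apply: circ_minus; [exact: tangent_prim|exact: circ_const].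
have cA := cp _ c tf; have cB := cp _ d tg.
set JA := RInt (fun x => (prim f x - c) / u x) 0 1.
set JB := RInt (fun x => (prim g x - d) / u x) 0 1.
have Q h e : tangent h -> forall x, Qprim u h x =
    (prim h x - e) - RInt (fun x => (prim h x - e) / u x) 0 1 / I.
  move=> th x; rewrite [X in _ - X / I](@RInt_eq _ (fun x => 1 * (prim h x / u x) + (- e) * / u x)).
    rewrite circ_RInt_lin -/I.
    - by rewrite /Qprim -/I; field; lra.
    - by apply: circ_div => //; exact: tangent_prim.
    - exact: circ_inv.
  by move=> y; rewrite /Rdiv; ring.
have cAi : circle_fun (fun x => (prim f x - c) / u x) by exact: circ_div.
have cBi : circle_fun (fun x => (prim g x - d) / u x) by exact: circ_div.
have cABi : circle_fun (fun x => (prim f x - c) * (prim g x - d) / u x).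
  by apply: circ_div => //; exact: circ_mult.
rewrite /Gform (@RInt_eq _ (fun x =>
  1 * (1 * ((prim f x - c) * (prim g x - d) / u x) + (- (JB / I)) * ((prim f x - c) / u x))
  + 1 * ((- (JA / I)) * ((prim g x - d) / u x) + (JA / I * (JB / I)) * / u x))) => [|x].
  have ci := circ_inv cu u0.
  have cl f1 f2 a b : circle_fun f1 -> circle_fun f2 -> circle_fun (fun x => a * f1 x + b * f2 x).
    by move=> *; apply: circ_plus; apply: circ_mult => //; exact: circ_const.
  rewrite circ_RInt_lin; [|exact: cl|exact: cl].
  rewrite !circ_RInt_lin // -/JA -/JB -/I; eqR; field; lra.
by rewrite (Q f c tf) (Q g d tg) -/JA -/JB /Rdiv; ring.
Qed.
End Form.

(** The covariance of A and B for the probability density proportional to 1/v, multiplied by the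
    integral of 1/v. *)
Definition energy (v A B : R -> R) : R :=
  RInt (fun x => A x * B x / v x) 0 1 -
  RInt (fun x => A x / v x) 0 1 * RInt (fun x => B x / v x) 0 1 / RInt (fun x => / v x) 0 1.

Lemma c1_param_RInt_inv_pos v t : c1_param v t -> (forall x, 0 <= x <= 1 -> 0 < v t x) ->
  0 < RInt (fun x => / v t x) 0 1.
Proof.
move=> Hv v0; apply: RInt_gt_0; first lra.
  by move=> x Hx; apply: Rinv_0_lt_compat; apply: v0; lra.
move=> x Hx.
have [_ [ch _]] := c1_near_at (Hv x Hx).
have := continuity_2d_pt_slice (continuity_2d_pt_inv _ _ _ ch (Rgt_not_eq _ _ (v0 x Hx))).
exact.
Qed.

(* When A / v and B / v have zero integral at time t, the correction term is
   a product of two functions vanishing at t and does not contribute. *)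
Lemma energy_is_derive v A B t :
  c1_param v t -> c1_param A t -> c1_param B t ->
  (forall x, 0 <= x <= 1 -> 0 < v t x) ->
  RInt (fun x => A t x / v t x) 0 1 = 0 -> RInt (fun x => B t x / v t x) 0 1 = 0 ->
  is_derive (fun t => energy (v t) (A t) (B t)) t
    (RInt (fun x => Dt A t x * B t x / v t x + A t x * Dt B t x / v t x
                    - A t x * B t x * Dt v t x / (v t x * v t x)) 0 1).
Proof.
move=> Hv HA HB v0 A0 B0.
have HAB : c1_param (fun t x => A t x * B t x / v t x) t.
  move=> x Hx; apply: c1_near_div; [|exact: Hv|exact: v0].
  by apply: c1_near_mult; [exact: HA|exact: HB].
have HAv : c1_param (fun t x => A t x / v t x) t.
  by move=> x Hx; apply: c1_near_div; [exact: HA|exact: Hv|exact: v0].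
have HBv : c1_param (fun t x => B t x / v t x) t.
  by move=> x Hx; apply: c1_near_div; [exact: HB|exact: Hv|exact: v0].
have Hi : c1_param (fun t x => / v t x) t.
  by move=> x Hx; apply: c1_near_inv; [exact: Hv|exact: v0].
have I0 := c1_param_RInt_inv_pos Hv v0.
have D1 := c1_param_is_derive HAB; have D2 := c1_param_is_derive HAv.
have D3 := c1_param_is_derive HBv; have D4 := c1_param_is_derive Hi.
set r := RInt _ 0 1.
have -> : r = RInt (Dt (fun t x => A t x * B t x / v t x) t) 0 1.
  apply: RInt_ext => x; rewrite Rmin_left ?Rmax_right; try lra.
  move=> Hx; have Hx' : 0 <= x <= 1 by lra.
  have [dA _] := c1_near_at (HA x Hx'); have [dB _] := c1_near_at (HB x Hx').
  have [dv _] := c1_near_at (Hv x Hx'); have p := v0 x Hx'.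
  rewrite /Dt; apply/esym/is_derive_unique; auto_derive.
    by repeat split => //; lra.
  by rewrite -/(Dt A t x) -/(Dt B t x) -/(Dt v t x); field; lra.
set d1 := RInt _ 0 1 in D1 *; set d2 := RInt _ 0 1 in D2.
set d3 := RInt _ 0 1 in D3; set d4 := RInt _ 0 1 in D4.
have D : is_derive (fun t =>
    RInt (fun x => A t x / v t x) 0 1 * RInt (fun x => B t x / v t x) 0 1
      / RInt (fun x => / v t x) 0 1) t
   ((d2 * RInt (fun x => B t x / v t x) 0 1 + RInt (fun x => A t x / v t x) 0 1 * d3)
      * / RInt (fun x => / v t x) 0 1
    + RInt (fun x => A t x / v t x) 0 1 * RInt (fun x => B t x / v t x) 0 1
      * (- d4 / RInt (fun x => / v t x) 0 1 ^ 2)).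
  apply: (is_derive_mult (fun t =>
    RInt (fun x => A t x / v t x) 0 1 * RInt (fun x => B t x / v t x) 0 1)
    (fun t => / RInt (fun x => / v t x) 0 1)).
  - by apply: is_derive_mult => //; exact: Rmult_comm.
  - by apply: is_derive_inv => //; apply: Rgt_not_eq.
  - exact: Rmult_comm.
move: D; rewrite A0 B0 => D.
rewrite -[d1]Rminus_0_r; apply: is_derive_minus => //.
by move: D; rewrite !Rmult_0_l !Rmult_0_r Rplus_0_l Rmult_0_l Rplus_0_l.
Qed.

(** * The Levi-Civita connection *)

Lemma M1_perturb u f : M1 u -> tangent f ->
  locally 0 (fun e => M1 (fadd u (fscal e f))).
Proof.
move=> [cu [u0 Iu]] [cf If].
have [m [m0 Hm]] := circ_pos_min cu u0; have [B [B0 HB]] := circ_bounded cf.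
(* With m below u and B above |f|, the perturbation stays positive for |e| < m / B. *)
have mB : 0 < m / B by apply: Rdiv_lt_0_compat.
exists (mkposreal _ mB) => e /ball_R /=; rewrite Rminus_0_r => He.
have ce : circle_fun (fscal e f) by apply: circ_mult => //; exact: circ_const.
split; first exact: circ_plus.
split=> [x|].
  have H1 : Rabs (e * f x) < m.
    rewrite Rabs_mult; apply: (Rle_lt_trans _ (Rabs e * B)).
      by apply: Rmult_le_compat_l => //; exact: Rabs_pos.
    by have := Rmult_lt_compat_r _ _ _ B0 He; rewrite /Rdiv Rmult_assoc Rinv_l; lra.
  have := Hm x; rewrite /fadd /fscal; have := Rabs_def2 _ _ H1; lra.
rewrite /fadd /fscal (@RInt_eq _ (fun x => 1 * u x + e * f x)) => [|x]; last by ring.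
by rewrite circ_RInt_lin // Iu If; eqR; ring.
Qed.

Lemma c1_param_perturb u f e : circle_fun u -> circle_fun f ->
  c1_param (fun e => fadd u (fscal e f)) e.
Proof.
move=> cu cf x _; apply: (c1_near_plus (h := fun _ x => u x)).
  by apply: c1_near_cst => y; exact: circ_continuous.
apply: (c1_near_mult (h := fun e _ => e) (k := fun _ x => f x)).
  apply: (c1_near_param (k := fun e => e)); apply: filter_forall => t; split.
    exact: ex_derive_id.
  apply: (continuous_ext (fun _ => 1)); last exact: continuous_const.
  by move=> s; rewrite Derive_id.
by apply: c1_near_cst => y; exact: circ_continuous.
Qed.

Lemma fadd_fscal0 u f : fadd u (fscal 0 f) = u.
Proof. by apply: functional_extensionality => x; rewrite /fadd /fscal; ring. Qed.

Lemma Dt_perturb u f e x : Dt (fun e => fadd u (fscal e f)) e x = f x.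
Proof. by apply: is_derive_unique; rewrite /fadd /fscal; auto_derive => //; ring. Qed.

Lemma c1_param_cst k t : circle_fun k -> c1_param (fun _ => k) t.
Proof. by move=> ck x _; apply: (c1_near_cst (k := k)) => y; exact: circ_continuous. Qed.

(** [Gform_shift] allows the primitives [Qprim u g] and [Qprim u h] to stay fixed along the
    perturbation, so only the weight 1/u contributes. *)
Lemma G_perturb u f g h : M1 u -> tangent f -> tangent g -> tangent h ->
  is_derive (fun e => G (fadd u (fscal e f)) g h) 0
    (- RInt (fun x => Qprim u g x * Qprim u h x * f x / (u x * u x)) 0 1).
Proof.
move=> Mu tf tg th; have [cu [u0 _]] := Mu; have [cf _] := tf.
have cg := circ_Qprim u tg; have ch := circ_Qprim u th.
apply: (@is_derive_ext_loc _ _ (fun e => energy (fadd u (fscal e f)) (Qprim u g) (Qprim u h))).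
  apply: filter_imp (M1_perturb Mu tf) => e [ce [e0 _]].
  by rewrite GE // /energy; symmetry; exact: Gform_shift.
have := @energy_is_derive (fun e => fadd u (fscal e f)) (fun _ => Qprim u g)
  (fun _ => Qprim u h) 0.
rewrite fadd_fscal0 => H; have {H} := H (c1_param_perturb 0 cu cf) (c1_param_cst 0 cg)
  (c1_param_cst 0 ch) (fun x _ => u0 x) (RInt_Qprim cu u0 tg) (RInt_Qprim cu u0 th).
set r := RInt _ 0 1; have -> // : r = - RInt (fun x => Qprim u g x * Qprim u h x * f x / (u x * u x)) 0 1.
have cq : circle_fun (fun x => Qprim u g x * Qprim u h x * f x / (u x * u x)).
  apply: circ_div; [|exact: circ_mult|by move=> x; exact: Rmult_lt_0_compat].
  by do 2!apply: circ_mult => //.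
rewrite /r (@RInt_eq _ (fun x => (-1) * (Qprim u g x * Qprim u h x * f x / (u x * u x)))).
  by rewrite circ_RInt_scal //; eqR; ring.
move=> x; rewrite Dt_perturb.
have Dc (k : R -> R) : Dt (fun _ => k) 0 x = 0 by rewrite /Dt Derive_const.
by rewrite !Dc; have := u0 x => ?; field; lra.
Qed.

(** The solution of the Koszul formula 2 G(Gam(f, g), h) = - int (f Q(g) Q(h) + g Q(f) Q(h) - h Q(f)
    Q(g)) / u^2. Integrating by parts in the term with h = Q(h)' turns the right side into -2 int
    (Q(f) Q(g) / u)' Q(h) / u, so -(Q(f) Q(g) / u)' is a primitive of Gam(f, g). *)
Definition Gam (u f g : R -> R) : R -> R :=
  Derive (Derive (fun x => - (Qprim u f x * Qprim u g x / u x))).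

Lemma circ_Gam_potential u f g : circle_fun u -> (forall x, 0 < u x) ->
  tangent f -> tangent g -> circle_fun (fun x => - (Qprim u f x * Qprim u g x / u x)).
Proof. by move=> *; apply: circ_opp; exact: circ_Gform. Qed.

Lemma Gam_tangent u f g : circle_fun u -> (forall x, 0 < u x) ->
  tangent f -> tangent g -> tangent (Gam u f g).
Proof. by move=> *; apply/tangent_Derive/circ_Derive/circ_Gam_potential. Qed.

Lemma Gam_sym u f g : Gam u f g = Gam u g f.
Proof.
congr (Derive (Derive _)); apply: functional_extensionality => x; rewrite /Rdiv; ring.
Qed.

Lemma Derive_Gam_potential u f g x : circle_fun u -> (forall x, 0 < u x) ->
  tangent f -> tangent g ->
  Derive (fun x => - (Qprim u f x * Qprim u g x / u x)) x =
  - ((f x * Qprim u g x + Qprim u f x * g x) / u x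
     - Qprim u f x * Qprim u g x * Derive u x / (u x * u x)).
Proof.
move=> cu u0 tf tg; apply: is_derive_unique.
have ef : is_derive (Qprim u f) x (f x) by exact: Qprim_is_derive.
have eg : is_derive (Qprim u g) x (g x) by exact: Qprim_is_derive.
have ux := u0 x; auto_derive.
  by repeat split; [exists (f x)|exists (g x)|exact: circ_ex_derive|lra].
rewrite (is_derive_unique _ _ _ ef) (is_derive_unique _ _ _ eg).
by rewrite -[Derive (fun y => u y) x]/(Derive u x); field; lra.
Qed.

Lemma Gam_metric u f g h : M1 u -> tangent f -> tangent g -> tangent h ->
  - RInt (fun x => Qprim u g x * Qprim u h x * f x / (u x * u x)) 0 1 =
  Gform u (Gam u f g) h + Gform u g (Gam u f h).
Proof.
move=> [cu [u0 _]] tf tg th; rewrite [Gform u g _]Gform_sym /Gam.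
have cP2 a b : tangent a -> tangent b ->
    circle_fun (Derive (fun x => - (Qprim u a x * Qprim u b x / u x))).
  by move=> *; apply/circ_Derive/circ_Gam_potential.
have cQ a : tangent a -> circle_fun (Qprim u a) by exact: circ_Qprim.
pose k1 x := Derive (fun x => - (Qprim u f x * Qprim u g x / u x)) x * Qprim u h x / u x.
pose k2 x := Derive (fun x => - (Qprim u f x * Qprim u h x / u x)) x * Qprim u g x / u x.
transitivity (RInt k1 0 1 + RInt k2 0 1); last first.
  by apply: (f_equal2 Rplus); symmetry; apply: Gform_Derive => //; exact: cP2.
have c1 : circle_fun k1.
  by apply: circ_div => //; apply: circ_mult; [exact: cP2|exact: cQ].
have c2 : circle_fun k2.
  by apply: circ_div => //; apply: circ_mult; [exact: cP2|exact: cQ].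
have cuu : circle_fun (fun x => u x * u x) by exact: circ_mult.
have uu0 x : 0 < u x * u x by exact: Rmult_lt_0_compat.
(* The derivative of this symmetric expression accounts for all of k1 + k2 except one copy of - f
   Q(g) Q(h) / u^2. *)
pose F x := - (Qprim u f x * Qprim u g x * Qprim u h x / (u x * u x)).
have cf : circle_fun f by case: tf.
have c3 : circle_fun (fun x => Qprim u g x * Qprim u h x * f x / (u x * u x)).
  by apply: circ_div => //; apply: circ_mult => //; apply: circ_mult; exact: cQ.
have cF : circle_fun F.
  apply: circ_opp; apply: circ_div => //; apply: circ_mult; last exact: cQ.
  by apply: circ_mult; exact: cQ.
transitivity (RInt (fun x => (-1) * (Qprim u g x * Qprim u h x * f x / (u x * u x))) 0 1).
  by rewrite circ_RInt_scal //; eqR; ring.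
transitivity (RInt (fun x => 1 * k1 x + 1 * k2 x) 0 1); last first.
  by rewrite circ_RInt_lin //; eqR; ring.
symmetry; apply: (circ_RInt_parts cF).
- by apply: circ_plus; apply: circ_mult => //; exact: circ_const.
- by apply: circ_mult => //; exact: circ_const.
move=> x; have ux := u0 x.
have D a : tangent a -> is_derive (Qprim u a) x (a x) by move=> ?; exact: Qprim_is_derive.
have Df := D _ tf; have Dg := D _ tg; have Dh := D _ th.
rewrite /k1 /k2 (Derive_Gam_potential x cu u0 tf tg) (Derive_Gam_potential x cu u0 tf th) /F.
clear D k1 k2 F c1 c2 c3 cF cP2 cQ.
move: Df Dg Dh; move: (Qprim u f) (Qprim u g) (Qprim u h) => A B C Df Dg Dh.
auto_derive.
  by repeat split; [exists (f x)|exists (g x)|exists (h x)|exact: circ_ex_derive|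
                    exact: circ_ex_derive|nra].
rewrite (is_derive_unique _ _ _ Df) (is_derive_unique _ _ _ Dg) (is_derive_unique _ _ _ Dh).
by rewrite -[Derive (fun y => u y) x]/(Derive u x); field; lra.
Qed.

Lemma Gam_lin u a f g h x : circle_fun u -> (forall x, 0 < u x) ->
  tangent f -> tangent g -> tangent h ->
  Gam u (fadd (fscal a f) g) h x = a * Gam u f h x + Gam u g h x.
Proof.
move=> cu u0 tf tg th; rewrite /Gam -[fadd _ _]/(fun x => a * f x + g x) Qprim_lin //.
have cf := circ_Gam_potential cu u0 tf th; have cg := circ_Gam_potential cu u0 tg th.
set F := fun x => - (Qprim u f x * Qprim u h x / u x) in cf *.
set H := fun x => - (Qprim u g x * Qprim u h x / u x) in cg *.
have L k l : circle_fun k -> circle_fun l ->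
    Derive (fun x => a * k x + l x) = fun x => a * Derive k x + Derive l x.
  move=> ck cl; apply: functional_extensionality => y; apply: is_derive_unique.
  apply: (is_derive_plus (fun x => a * k x)); last exact: circ_is_derive.
  by apply: (is_derive_scal k); exact: circ_is_derive.
have -> : (fun x => - ((a * Qprim u f x + Qprim u g x) * Qprim u h x / u x)) =
    fun x => a * F x + H x.
  by apply: functional_extensionality => y; rewrite /F /H /Rdiv; ring.
by rewrite L // L //; exact: circ_Derive.
Qed.

Lemma is_derive_uniq (f : R -> R) x l1 l2 : is_derive f x l1 -> is_derive f x l2 -> l1 = l2.
Proof. by move=> /is_derive_unique <- /is_derive_unique <-. Qed.

Lemma Gam_levi_civita : is_levi_civita Gam.
Proof.
move=> u Mu f g h tf tg th; have [cu [u0 _]] := Mu; split.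
- exact: Gam_tangent.
- by move=> a x; exact: Gam_lin.
- by move=> x; rewrite Gam_sym.
- rewrite !GE //; try exact: Gam_tangent.
  by rewrite -Gam_metric //; exact: G_perturb.
Qed.

(* Otherwise unification unfolds these down to limits when it compares two
   different instances. *)
Opaque Gam Gform Qprim Derive RInt.

(* Koszul: the defect d(f,g,h) = G(Gam'(f,g) - Gam(f,g), h) is symmetric in f, g
   and antisymmetric in g, h, hence zero. *)
Lemma levi_civita_unique Gam' u f g : is_levi_civita Gam' -> M1 u ->
  tangent f -> tangent g -> Gam' u f g = Gam u f g.
Proof.
move=> LC' Mu tf tg; have [cu [u0 _]] := Mu.
have T a b : tangent a -> tangent b -> tangent (Gam u a b) by exact: Gam_tangent.
have T' a b : tangent a -> tangent b -> tangent (Gam' u a b).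
  by move=> ta tb; case: (LC' u Mu a b a ta tb ta).
pose d a b c := Gform u (Gam' u a b) c - Gform u (Gam u a b) c.
have d_sym a b c : tangent a -> tangent b -> d a b c = d b a c.
  move=> ta tb; have E : Gam' u a b = Gam' u b a.
    by apply: functional_extensionality => x; case: (LC' u Mu a b a ta tb ta).
  have E' := Gam_sym u a b.
  by rewrite /d E E'.
have d_anti a b c : tangent a -> tangent b -> tangent c -> d a b c = - d a c b.
  move=> ta tb tc; case: (LC' u Mu a b c ta tb tc) => _ _ _ D1.
  case: (Gam_levi_civita Mu ta tb tc) => _ _ _ D2.
  have := is_derive_uniq D1 D2.
  rewrite (GE cu u0 (T' a b ta tb) tc) (GE cu u0 (T a b ta tb) tc).
  rewrite (GE cu u0 tb (T' a c ta tc)) (GE cu u0 tb (T a c ta tc)).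
  rewrite (Gform_sym u b (Gam' u a c)) (Gform_sym u b (Gam u a c)) /d.
  lra.
have d0 a b c : tangent a -> tangent b -> tangent c -> d a b c = 0.
  move=> ta tb tc.
  have E1 := d_anti a b c ta tb tc; have E2 := d_sym a c b ta tc.
  have E3 := d_anti c a b tc ta tb; have E4 := d_sym c b a tc tb.
  have E5 := d_anti b c a tb tc ta; have E6 := d_sym b a c tb ta.
  by lra.
have tk : tangent (fun x => (-1) * Gam u f g x + Gam' u f g x).
  by apply: tangent_lin; [exact: T|exact: T'].
apply: functional_extensionality => x.
have := Gform_definite cu u0 tk _ x.
move=> H; suff : (-1) * Gam u f g x + Gam' u f g x = 0 by lra.
apply: H; rewrite Gform_lin //; [|exact: T|exact: T'].
by have := d0 f g _ tf tg tk; rewrite /d; lra.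
Qed.

(** The chosen connection is pinned down only on [M1] and on tangent vectors, so it can be replaced
    by [Gam] along a perturbation only for small e. *)
Lemma LC_E u f g : M1 u -> tangent f -> tangent g -> LC u f g = Gam u f g.
Proof.
apply: levi_civita_unique; apply: epsilon_spec; exists Gam; exact: Gam_levi_civita.
Qed.

(** * Curvature *)

(** Written out so that at a fixed x the connection becomes an algebraic expression in u, u', u''
    and the primitives, which can be differentiated in e directly. *)
Lemma second_derivative_quot (b c g h g1 h1 u u1 u2 : R -> R) :
  (forall x, is_derive b x (g x)) -> (forall x, is_derive c x (h x)) ->
  (forall x, is_derive g x (g1 x)) -> (forall x, is_derive h x (h1 x)) ->
  (forall x, is_derive u x (u1 x)) -> (forall x, is_derive u1 x (u2 x)) ->
  (forall x, 0 < u x) -> forall x,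
  Derive (Derive (fun x => - (b x * c x / u x))) x =
  - ((g1 x * c x + 2 * g x * h x + b x * h1 x) / u x
     - 2 * (g x * c x + b x * h x) * u1 x / u x ^ 2
     - b x * c x * u2 x / u x ^ 2 + 2 * b x * c x * u1 x ^ 2 / u x ^ 3).
Proof.
move=> Db Dc Dg Dh Du Du1 u0 x.
rewrite (Derive_ext _ (fun x => - ((g x * c x + b x * h x) / u x - b x * c x * u1 x / u x ^ 2))).
  apply: is_derive_unique; auto_derive; have := u0 x => p.
    by repeat split; try (by eexists; eauto); try nra.
  rewrite (is_derive_unique _ _ _ (Db x)) (is_derive_unique _ _ _ (Dc x))
    (is_derive_unique _ _ _ (Dg x)) (is_derive_unique _ _ _ (Dh x))
    (is_derive_unique _ _ _ (Du x)) (is_derive_unique _ _ _ (Du1 x)).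
  by field; lra.
move=> y; apply: is_derive_unique; auto_derive; have := u0 y => p.
  by repeat split; try (by eexists; eauto); lra.
rewrite (is_derive_unique _ _ _ (Db y)) (is_derive_unique _ _ _ (Dc y)) (is_derive_unique _ _ _ (Du y)).
by field; lra.
Qed.

(** Replaces an interchange of d/de with two x-derivatives: both sides are computed and compared.
    Here m1 and m2 are the amounts, constant in x, by which the primitives b and c shift as u moves
    to u + e f. *)
Lemma second_derivative_variation (al be : R) (b c g h g1 h1 f f1 f2 u u1 u2 : R -> R) :
  (forall x, is_derive b x (g x)) -> (forall x, is_derive c x (h x)) ->
  (forall x, is_derive g x (g1 x)) -> (forall x, is_derive h x (h1 x)) ->
  (forall x, is_derive f x (f1 x)) -> (forall x, is_derive f1 x (f2 x)) ->
  (forall x, is_derive u x (u1 x)) -> (forall x, is_derive u1 x (u2 x)) ->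
  (forall x, 0 < u x) -> forall x (m1 m2 : R -> R),
  m1 0 = 0 -> m2 0 = 0 -> is_derive m1 0 (- al) -> is_derive m2 0 (- be) ->
  is_derive (fun e => - ((g1 x * (c x - m2 e) + 2 * g x * h x + (b x - m1 e) * h1 x) / (u x + e * f x)
     - 2 * (g x * (c x - m2 e) + (b x - m1 e) * h x) * (u1 x + e * f1 x) / (u x + e * f x) ^ 2
     - (b x - m1 e) * (c x - m2 e) * (u2 x + e * f2 x) / (u x + e * f x) ^ 2
     + 2 * (b x - m1 e) * (c x - m2 e) * (u1 x + e * f1 x) ^ 2 / (u x + e * f x) ^ 3)) 0
  (Derive (Derive (fun x => - (al * c x / u x + be * b x / u x - b x * c x * f x / u x ^ 2))) x).
Proof.
move=> Db Dc Dg Dh Df Df1 Du Du1 u0 x m1 m2 m10 m20 Dm1 Dm2.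
rewrite (Derive_ext _ (fun x => - (al * h x / u x - al * c x * u1 x / u x ^ 2
  + be * g x / u x - be * b x * u1 x / u x ^ 2
  - (g x * c x * f x + b x * h x * f x + b x * c x * f1 x) / u x ^ 2
  + 2 * b x * c x * f x * u1 x / u x ^ 3))); last first.
  move=> y; apply: is_derive_unique; auto_derive; have := u0 y => p.
    by repeat split; try (by eexists; eauto); try nra.
  rewrite (is_derive_unique _ _ _ (Db y)) (is_derive_unique _ _ _ (Dc y))
    (is_derive_unique _ _ _ (Du y)) (is_derive_unique _ _ _ (Df y)).
  by field; lra.
have p := u0 x.
have p2 : u x * (u x * 1) <> 0 by nra.
have p3 : u x * (u x * (u x * 1)) <> 0 by apply: Rgt_not_eq; rewrite Rmult_1_r; do !apply: Rmult_lt_0_compat.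
set D := Derive _ x.
have -> : D = - ((al * h1 x) / u x - al * h x * u1 x / u x ^ 2
  - (al * h x * u1 x + al * c x * u2 x) / u x ^ 2 + 2 * al * c x * u1 x ^ 2 / u x ^ 3
  + be * g1 x / u x - be * g x * u1 x / u x ^ 2
  - (be * g x * u1 x + be * b x * u2 x) / u x ^ 2 + 2 * be * b x * u1 x ^ 2 / u x ^ 3
  - (g1 x * c x * f x + g x * h x * f x + g x * c x * f1 x
     + g x * h x * f x + b x * h1 x * f x + b x * h x * f1 x
     + g x * c x * f1 x + b x * h x * f1 x + b x * c x * f2 x) / u x ^ 2
  + 2 * (g x * c x * f x + b x * h x * f x + b x * c x * f1 x) * u1 x / u x ^ 3
  + 2 * (g x * c x * f x * u1 x + b x * h x * f x * u1 x + b x * c x * f1 x * u1 x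
         + b x * c x * f x * u2 x) / u x ^ 3
  - 6 * b x * c x * f x * u1 x ^ 2 / u x ^ 4).
  apply: is_derive_unique; auto_derive.
    by repeat split; try (by eexists; eauto); lra.
  rewrite (is_derive_unique _ _ _ (Db x)) (is_derive_unique _ _ _ (Dc x))
    (is_derive_unique _ _ _ (Dg x)) (is_derive_unique _ _ _ (Dh x))
    (is_derive_unique _ _ _ (Df x)) (is_derive_unique _ _ _ (Df1 x))
    (is_derive_unique _ _ _ (Du x)) (is_derive_unique _ _ _ (Du1 x)).
  by field; lra.
auto_derive; rewrite ?m10 ?m20 ?Rmult_0_l ?Rplus_0_r.
  by repeat split; try (by eexists; eauto); lra.
rewrite (is_derive_unique _ _ _ Dm1) (is_derive_unique _ _ _ Dm2).
by field; lra.
Qed.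

Lemma quadratic_ge0_discr A B C : 0 <= A ->
  (forall a, 0 <= a ^ 2 * A + 2 * a * B + C) -> 0 <= A * C - B ^ 2.
Proof.
move=> A0 H; case: (Req_dec A 0) => [Z|nZ]; last first.
  (* The minimum of the quadratic. *)
  have := H (- B / A).
  have -> : (- B / A) ^ 2 * A + 2 * (- B / A) * B + C = (A * C - B ^ 2) / A by field.
  move=> /(Rmult_le_pos _ _ A0).
  by rewrite (_ : A * ((A * C - B ^ 2) / A) = A * C - B ^ 2) //; field.
case: (Req_dec B 0) => [->|nB]; first by rewrite Z; lra.
(* With A = 0 and B nonzero the affine function takes the value -1 here. *)
have := H (- (C + 1) / (2 * B)); rewrite Z.
rewrite (_ : _ + C = -1); first lra.
by field.
Qed.

Section Curvature.
Variable u : R -> R.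
Hypothesis Mu : M1 u.

Let cu : circle_fun u. Proof. by case: Mu. Qed.
Let u0 : forall x, 0 < u x. Proof. by case: Mu => _ []. Qed.
Let I := RInt (fun x => / u x) 0 1.
Let I0 : 0 < I. Proof. exact: RInt_inv_pos cu u0. Qed.

(* The derivative of [Qprim u g] in the direction f is the constant [dQ f g]. *)
Definition dQ (f g : R -> R) : R := RInt (fun x => f x * Qprim u g x / u x ^ 2) 0 1 / I.

Lemma circ_sq : circle_fun (fun x => u x ^ 2) /\ forall x, 0 < u x ^ 2.
Proof.
split; last by move=> x; apply: pow_lt; exact: u0.
have -> : (fun x => u x ^ 2) = fun x => u x * u x.
  by apply: functional_extensionality => x; ring.
by apply: circ_mult; exact: cu.
Qed.

Lemma circ_dQ f g : circle_fun f -> tangent g ->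
  circle_fun (fun x => f x * Qprim u g x / u x ^ 2).
Proof.
move=> cf tg; have [c2 p2] := circ_sq; apply: circ_div => //.
by apply: circ_mult => //; exact: circ_Qprim.
Qed.

(** The mean of Q_u(g) for the perturbed weight, which is the constant to subtract from it to obtain
    Q at u + e f. *)
Definition meanQ (f g : R -> R) (e : R) : R :=
  RInt (fun x => Qprim u g x / fadd u (fscal e f) x) 0 1 /
  RInt (fun x => / fadd u (fscal e f) x) 0 1.

Lemma Qprim_perturb f g e x : M1 (fadd u (fscal e f)) -> tangent g ->
  Qprim (fadd u (fscal e f)) g x = Qprim u g x - meanQ f g e.
Proof.
set v := fadd u (fscal e f) => -[cv [v0 _]] tg; rewrite /meanQ -/v.
set c := RInt (fun x => prim g x / u x) 0 1 / I.
have Q y : Qprim u g y = prim g y - c by rewrite QprimE.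
have J0 := RInt_inv_pos cv v0.
have -> : RInt (fun x => Qprim u g x / v x) 0 1 =
    1 * RInt (fun x => prim g x / v x) 0 1 + (- c) * RInt (fun x => / v x) 0 1.
  rewrite -circ_RInt_lin; [|by apply: circ_div => //; exact: tangent_prim|exact: circ_inv].
  by apply: RInt_eq => y; rewrite Q /Rdiv; ring.
by rewrite Q QprimE; field; lra.
Qed.

Lemma meanQ0 f g : tangent g -> meanQ f g 0 = 0.
Proof.
by move=> tg; rewrite /meanQ fadd_fscal0 (RInt_Qprim cu u0 tg) /Rdiv Rmult_0_l.
Qed.

Lemma meanQ_is_derive f g : circle_fun f -> tangent g ->
  is_derive (meanQ f g) 0 (- dQ f g).
Proof.
move=> cf tg; have cg := circ_Qprim u tg.
have Hv := @c1_param_perturb u f 0 cu cf.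
have v0 x : 0 <= x <= 1 -> 0 < fadd u (fscal 0 f) x by rewrite fadd_fscal0.
have H1 : c1_param (fun e x => Qprim u g x / fadd u (fscal e f) x) 0.
  move=> x Hx; apply: (c1_near_div (h := fun _ x => Qprim u g x)); [exact: c1_param_cst|exact: Hv|exact: v0].
have H2 : c1_param (fun e x => / fadd u (fscal e f) x) 0.
  by move=> x Hx; apply: c1_near_inv; [exact: Hv|exact: v0].
have D1 := c1_param_is_derive H1; have D2 := c1_param_is_derive H2.
have E1 : RInt (Dt (fun e x => Qprim u g x / fadd u (fscal e f) x) 0) 0 1 = - (I * dQ f g).
  rewrite (@RInt_eq _ (fun x => (-1) * (f x * Qprim u g x / u x ^ 2))) => [|x].
    rewrite circ_RInt_scal; last exact: circ_dQ.
    by rewrite /dQ; eqR; field; lra.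
  rewrite /Dt /fadd /fscal; apply: is_derive_unique; have := u0 x => p.
  move: (Qprim u g) => q; auto_derive; first lra.
  by field; lra.
move: D1; rewrite E1; set d2 := RInt _ 0 1 in D2; move=> D1.
(* The numerator vanishes at e = 0, so the derivative d2 of the denominator drops out of the
   quotient rule. *)
have N0 : RInt (fun x => Qprim u g x / fadd u (fscal 0 f) x) 0 1 = 0.
  by rewrite fadd_fscal0 (RInt_Qprim cu u0 tg).
have I1 : RInt (fun x => / fadd u (fscal 0 f) x) 0 1 = I by rewrite fadd_fscal0.
rewrite /meanQ; move: D1 D2 N0 I1.
set n := fun e => RInt (fun x => Qprim u g x / fadd u (fscal e f) x) 0 1.
set d := fun e => RInt (fun x => / fadd u (fscal e f) x) 0 1.
rewrite -/(n 0) -/(d 0) => D1 D2 N0 I1.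
have := is_derive_div n d 0 _ _ D1 D2 _; rewrite N0 I1 => D.
have -> : - dQ f g = (- (I * dQ f g) * I - 0 * d2) / I ^ 2 by field; lra.
apply: D; lra.
Qed.

Lemma circ_is_derive_fun k : circle_fun k -> forall x, is_derive k x (Derive k x).
Proof. by move=> ck x; exact: circ_is_derive. Qed.

Lemma Gam_explicit v g h x : circle_fun v -> (forall x, 0 < v x) -> tangent g -> tangent h ->
  Gam v g h x = - ((Derive g x * Qprim v h x + 2 * g x * h x + Qprim v g x * Derive h x) / v x
     - 2 * (g x * Qprim v h x + Qprim v g x * h x) * Derive v x / v x ^ 2
     - Qprim v g x * Qprim v h x * Derive (Derive v) x / v x ^ 2
     + 2 * Qprim v g x * Qprim v h x * Derive v x ^ 2 / v x ^ 3).
Proof.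
move=> cv v0 tg th.
apply: (second_derivative_quot (b := Qprim v g) (c := Qprim v h) (u := v)) => //.
- by move=> y; exact: Qprim_is_derive.
- by move=> y; exact: Qprim_is_derive.
- by apply: circ_is_derive_fun; case: tg.
- by apply: circ_is_derive_fun; case: th.
- exact: circ_is_derive_fun.
- by apply: circ_is_derive_fun; exact: circ_Derive.
Qed.

(** The derivative in the direction f of - Q(g) Q(h) / u, the function whose second x-derivative is
    [Gam u g h]. *)
Definition dGam (f g h : R -> R) (x : R) : R :=
  - (dQ f g * Qprim u h x / u x + dQ f h * Qprim u g x / u x
     - Qprim u g x * Qprim u h x * f x / u x ^ 2).

Lemma LC_perturb f g h x : tangent f -> tangent g -> tangent h ->
  Derive (fun e => LC (fadd u (fscal e f)) g h x) 0 = Derive (Derive (dGam f g h)) x.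
Proof.
move=> tf tg th; have [cf _] := tf; have [cg _] := tg; have [ch _] := th.
apply: is_derive_unique.
have D := second_derivative_variation (al := dQ f g) (be := dQ f h)
  (fun y => Qprim_is_derive u y tg) (fun y => Qprim_is_derive u y th)
  (circ_is_derive_fun cg) (circ_is_derive_fun ch)
  (circ_is_derive_fun cf) (circ_is_derive_fun (circ_Derive cf))
  (circ_is_derive_fun cu) (circ_is_derive_fun (circ_Derive cu)) u0 x
  (meanQ0 f tg) (meanQ0 f th) (meanQ_is_derive cf tg) (meanQ_is_derive cf th).
apply: is_derive_ext_loc D.
apply: filter_imp (M1_perturb Mu tf) => e Me; have [ce [e0 _]] := Me.
rewrite (LC_E Me tg th) (Gam_explicit x ce e0 tg th).
rewrite (Qprim_perturb x Me tg) (Qprim_perturb x Me th).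
have E1 y : Derive (fadd u (fscal e f)) y = Derive u y + e * Derive f y.
  apply: is_derive_unique; apply: (is_derive_plus u (fun y => e * f y)).
    exact: circ_is_derive.
  by apply: (is_derive_scal f); exact: circ_is_derive.
have E2 : Derive (Derive (fadd u (fscal e f))) x = Derive (Derive u) x + e * Derive (Derive f) x.
  rewrite (Derive_ext _ _ _ E1).
  apply: is_derive_unique; apply: (is_derive_plus (Derive u) (fun y => e * Derive f y)).
    by apply: circ_is_derive; exact: circ_Derive.
  by apply: (is_derive_scal (Derive f)); apply: circ_is_derive; exact: circ_Derive.
by rewrite E1 E2 /fadd /fscal.
Qed.

Lemma circ_dGam f g h : circle_fun f -> tangent g -> tangent h -> circle_fun (dGam f g h).
Proof.
move=> cf tg th; have [c2 p2] := circ_sq.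
have cg := circ_Qprim u tg; have ch := circ_Qprim u th.
have cc := circ_const.
apply: circ_opp; apply: circ_minus; [apply: circ_plus|]; apply: circ_div => //.
- exact: circ_mult.
- exact: circ_mult.
- by do 2!apply: circ_mult => //.
Qed.

Lemma Qprim_Derive q x : circle_fun q ->
  Qprim u (Derive q) x = q x - RInt (fun x => q x / u x) 0 1 / I.
Proof.
move=> cq; set m := _ / I.
rewrite -(@Qprim_unique u cu u0 (Derive q) (fun x => q x - m)) //.
- exact: tangent_Derive.
- by apply: circ_minus => //; exact: circ_const.
- move=> y; rewrite -[Derive q y]Rminus_0_r; apply: is_derive_minus.
    exact: circ_is_derive.
  exact: is_derive_cst.
- rewrite (@RInt_eq _ (fun x => 1 * (q x / u x) + (- m) * / u x)) => [|y].
    rewrite circ_RInt_lin; [|exact: (circ_div cq cu u0)|exact: (circ_inv cu u0)].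
    by rewrite /m -/I; eqR; field; lra.
  by rewrite /Rdiv; ring.
Qed.

Definition primGam (g h : R -> R) : R -> R :=
  Derive (fun x => - (Qprim u g x * Qprim u h x / u x)).

Lemma circ_primGam g h : tangent g -> tangent h -> circle_fun (primGam g h).
Proof. by move=> tg th; apply/circ_Derive/(circ_Gam_potential cu u0 tg th). Qed.

(** With A = Q(g) Q(h), (A/u)' / u = (1/2) (A/u^2)' + (1/2) A' / u^2; the first term integrates to
    zero. *)
Lemma primGam_mean g h : tangent g -> tangent h ->
  RInt (fun x => primGam g h x / u x) 0 1 / I = - (dQ g h + dQ h g) / 2.
Proof.
move=> tg th; have [c2 p2] := circ_sq; have [cg _] := tg; have [ch _] := th.
have cQg := circ_Qprim u tg; have cQh := circ_Qprim u th.
have E : RInt (fun x => primGam g h x / u x) 0 1 =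
    (- / 2) * RInt (fun x => g x * Qprim u h x / u x ^ 2) 0 1 +
    (- / 2) * RInt (fun x => h x * Qprim u g x / u x ^ 2) 0 1.
  have c1 := circ_dQ cg th; have c3 := circ_dQ ch tg.
  rewrite -circ_RInt_lin //.
  apply: (@circ_RInt_parts (fun x => - (Qprim u g x * Qprim u h x / u x ^ 2) * / 2)).
  - apply: circ_mult; last exact: circ_const.
    by apply: circ_opp; apply: circ_div => //; exact: circ_mult.
  - by apply: (circ_div _ cu u0); exact: circ_primGam.
  - by apply: circ_plus; apply: circ_mult => //; exact: circ_const.
  move=> x; have p := u0 x; rewrite /primGam (Derive_Gam_potential x cu u0 tg th).
  have Dg := Qprim_is_derive u x tg; have Dh := Qprim_is_derive u x th.
  move: Dg Dh; move: (Qprim u g) (Qprim u h) => A B Dg Dh.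
  auto_derive.
    by repeat split; [exists (g x)|exists (h x)|exact: (@circ_ex_derive u x cu)|nra].
  rewrite (is_derive_unique _ _ _ Dg) (is_derive_unique _ _ _ Dh).
  by rewrite -[Derive (fun y => u y) x]/(Derive u x); field; lra.
by rewrite E /dQ; field; lra.
Qed.

Lemma Qprim_Gam g h x : tangent g -> tangent h ->
  Qprim u (Gam u g h) x = primGam g h x + (dQ g h + dQ h g) / 2.
Proof.
move=> tg th; apply: etrans (Qprim_Derive x (circ_primGam tg th)) _.
by rewrite primGam_mean //; field.
Qed.

(** All four terms are second x-derivatives, so they are compared before differentiating. The q(g,
    g) terms cancel, and Q(g)/u is left with -2 q(f, g) + q(g, f) + (q(f, g) + q(g, f)) / 2 = -(3/2)
    (q(f, g) - q(g, f)). *)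
Lemma curvature_diag f g x : tangent f -> tangent g ->
  curvature u f g g x =
  Derive (Derive (fun x => - (3 / 2) * (dQ f g - dQ g f) * (Qprim u g x / u x))) x.
Proof.
move=> tf tg; have [cf _] := tf; have [cg _] := tg.
have tgg := Gam_tangent cu u0 tg tg; have tfg := Gam_tangent cu u0 tf tg.
have cQf := circ_Qprim u tf; have cQg := circ_Qprim u tg.
rewrite /curvature (LC_perturb x tf tg tg) (LC_perturb x tg tf tg).
rewrite (LC_E Mu tg tg) (LC_E Mu tf tg) (LC_E Mu tf tgg) (LC_E Mu tg tfg).
pose k1 := dGam f g g; pose k2 := dGam g f g.
pose k3 x := - (Qprim u f x * Qprim u (Gam u g g) x / u x).
pose k4 x := - (Qprim u g x * Qprim u (Gam u f g) x / u x).
have c1 : circle_fun k1 by exact: circ_dGam.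
have c2 : circle_fun k2 by exact: circ_dGam.
have c3 : circle_fun k3 by exact: (circ_Gam_potential cu u0 tf tgg).
have c4 : circle_fun k4 by exact: (circ_Gam_potential cu u0 tg tfg).
have L k l k' l' : circle_fun k -> circle_fun l -> circle_fun k' -> circle_fun l' ->
    forall x, Derive k x - Derive l x + Derive k' x - Derive l' x =
    Derive (fun x => k x - l x + k' x - l' x) x.
  move=> ck cl ck' cl' y; symmetry; apply: is_derive_unique.
  apply: (is_derive_minus (fun x => k x - l x + k' x) l'); last exact: circ_is_derive.
  apply: (is_derive_plus (fun x => k x - l x) k'); last exact: circ_is_derive.
  by apply: (is_derive_minus k l); exact: circ_is_derive.
rewrite -/k1 -/k2 -[Gam u f (Gam u g g) x]/(Derive (Derive k3) x)
  -[Gam u g (Gam u f g) x]/(Derive (Derive k4) x).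
rewrite L; try exact: circ_Derive.
rewrite (Derive_ext _ (Derive (fun x => k1 x - k2 x + k3 x - k4 x))); last first.
  by move=> y; rewrite L.
congr (Derive (Derive _) x); apply: functional_extensionality => y.
have E3 : k3 y = - (Qprim u f y * (primGam g g y + (dQ g g + dQ g g) / 2) / u y).
  by congr (- (_ * _ / _)); exact: Qprim_Gam.
have E4 : k4 y = - (Qprim u g y * (primGam f g y + (dQ f g + dQ g f) / 2) / u y).
  by congr (- (_ * _ / _)); exact: Qprim_Gam.
rewrite E3 E4 /k1 /k2 /dGam /primGam.
rewrite (Derive_Gam_potential y cu u0 tg tg) (Derive_Gam_potential y cu u0 tf tg).
by have := u0 y => p; field; lra.
Qed.

(** Integrating half of (Q(g)/u)' Q(f)/u by parts antisymmetrises it in f and g. The integral is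
    thus again a multiple of w, which together with the factor w in the curvature makes a square. *)
Lemma G_curvature f g : tangent f -> tangent g ->
  G u (curvature u f g g) f = 3 / 4 * I * (dQ f g - dQ g f) ^ 2.
Proof.
move=> tf tg; have [cf _] := tf; have [cg _] := tg; have [c2 p2] := circ_sq.
have cQf := circ_Qprim u tf; have cQg := circ_Qprim u tg.
set w := dQ f g - dQ g f.
pose k x := - (3 / 2) * w * (Qprim u g x / u x).
have ck : circle_fun k.
  by apply: circ_mult; [exact: circ_const|exact: (circ_div cQg cu u0)].
have -> : curvature u f g g = Derive (Derive k).
  by apply: functional_extensionality => x; exact: curvature_diag.
rewrite (GE cu u0 (tangent_Derive (circ_Derive ck)) tf).
rewrite (Gform_Derive cu u0 (circ_Derive ck) tf).
have E : RInt (fun x => Derive k x * Qprim u f x / u x) 0 1 =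
    (- (3 / 4) * w) * RInt (fun x => g x * Qprim u f x / u x ^ 2) 0 1 +
    (3 / 4 * w) * RInt (fun x => f x * Qprim u g x / u x ^ 2) 0 1.
  have c1 := circ_dQ cg tf; have c3 := circ_dQ cf tg.
  rewrite -circ_RInt_lin //.
  apply: (@circ_RInt_parts (fun x => - (3 / 4) * w * (Qprim u f x * Qprim u g x / u x ^ 2))).
  - apply: circ_mult; first exact: circ_const.
    by apply: circ_div => //; exact: circ_mult.
  - by apply: (circ_div _ cu u0); apply: circ_mult => //; exact: circ_Derive.
  - by apply: circ_plus; apply: circ_mult => //; exact: circ_const.
  move=> x; have p := u0 x; rewrite /k.
  have Df := Qprim_is_derive u x tf; have Dg := Qprim_is_derive u x tg.
  move: Df Dg; move: (Qprim u f) (Qprim u g) => A B Df Dg.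
  have -> : Derive (fun x => - (3 / 2) * w * (B x / u x)) x =
      - (3 / 2) * w * (g x / u x - B x * Derive u x / u x ^ 2).
    apply: is_derive_unique; auto_derive.
      by repeat split; [exists (g x)|exact: (@circ_ex_derive u x cu)|nra].
    rewrite (is_derive_unique _ _ _ Dg).
    by rewrite -[Derive (fun y => u y) x]/(Derive u x); field; lra.
  auto_derive.
    by repeat split; [exists (f x)|exists (g x)|exact: (@circ_ex_derive u x cu)|nra].
  rewrite (is_derive_unique _ _ _ Df) (is_derive_unique _ _ _ Dg).
  by rewrite -[Derive (fun y => u y) x]/(Derive u x); field; lra.
by rewrite E {2}/w /dQ; rewrite /w /dQ; field; lra.
Qed.

Lemma Gform_Cauchy_Schwarz f g : tangent f -> tangent g ->
  0 <= Gform u f f * Gform u g g - Gform u f g ^ 2.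
Proof.
move=> tf tg.
have H a : 0 <= a ^ 2 * Gform u f f + 2 * a * Gform u f g + Gform u g g.
  have [h Eh] : exists h, h = fun x => a * f x + g x by eexists.
  have th : tangent h by rewrite Eh; exact: tangent_lin.
  have L k : tangent k -> Gform u h k = a * Gform u f k + Gform u g k.
    by move=> tk; rewrite Eh; exact: (Gform_lin cu u0).
  have := Gform_ge0 cu u0 th.
  rewrite (L h th) (Gform_sym u f h) (L f tf) (Gform_sym u g h) (L g tg) (Gform_sym u g f).
  by move=> H; apply: Rle_trans H _; apply: Req_le; ring.
have F0 := Gform_ge0 cu u0 tf.
exact: (quadratic_ge0_discr F0 H).
Qed.

Lemma sectional_ge0 f g : tangent f -> tangent g -> 0 <= sectional u f g.
Proof.
move=> tf tg; rewrite /sectional (G_curvature tf tg).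
rewrite (GE cu u0 tf tf) (GE cu u0 tg tg) (GE cu u0 tf tg).
have D := Gform_Cauchy_Schwarz tf tg.
apply: Rmult_le_pos.
  have := pow2_ge_0 (dQ f g - dQ g f) => H; apply: Rmult_le_pos => //; lra.
(* Where the Gram determinant is zero, the convention / 0 = 0 makes the quotient 0. *)
case: D => [D|<-]; first by apply/Rlt_le/Rinv_0_lt_compat.
by rewrite Rinv_0; apply: Rle_refl.
Qed.
End Curvature.

(** * Concavity of the volume along geodesics *)

Section SmoothSlices.
Context (n : nat) (D : ('I_n -> R) -> Prop) (F : ('I_n -> R) -> R).
Context (p : 'I_n -> R) (i j : 'I_n).
Hypotheses (sF : smooth_on D F) (ij : i != j).

(** L records the derivatives already taken, so differentiating a slice along either axis only
    lengthens the list. *)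
Definition slice (L : seq 'I_n) (a b : R) : R := partials L F (upd (upd p i a) j b).

Lemma upd_slice_fst a b t : upd (upd (upd p i a) j b) i t = upd (upd p i t) j b.
Proof. by rewrite upd_comm ?upd_upd // eq_sym. Qed.

Lemma upd_slice_val a b : upd (upd p i a) j b i = a.
Proof. by rewrite upd_other // upd_same. Qed.

Lemma Dt_slice L a b : Dt (slice L) a b = slice (i :: L) a b.
Proof.
rewrite /Dt /slice /= /partial upd_slice_val; apply: Derive_ext => t.
by rewrite upd_slice_fst.
Qed.

Lemma Dx_slice L a b : Derive (slice L a) b = slice (j :: L) a b.
Proof.
rewrite /slice /= /partial upd_same; apply: Derive_ext => t.
by rewrite upd_upd.
Qed.

(** The neighbourhood supplied by [smooth_on] serves all L simultaneously, so its preimage in the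
    plane does too. *)
Lemma slice_locally a b : D (upd (upd p i a) j b) ->
  locally_2d (fun a b => forall L, continuity_2d_pt (slice L) a b /\
    ex_derive (fun z => slice L z b) a /\ ex_derive (slice L a) b) a b.
Proof.
move=> Dab.
have C a' b' : continuous (fun z : R * R => upd (upd p i z.1) j z.2) (a', b').
  apply: continuous_upd; last exact: continuous_snd.
  apply: (continuous_upd (f := fun _ => p)); last exact: continuous_fst.
  exact: continuous_const.
apply/locally_2dP; have [d Hd] := C a b _ (sF Dab); exists d => -[a' b'] /Hd /= H L.
have [cL dL] := H L; split; last split.
- apply/continuity_2d_pt_filterlim.
  exact: (continuous_comp (fun z : R * R => upd (upd p i z.1) j z.2) (partials L F) (a', b')).
- have := dL i; rewrite upd_slice_val; apply: ex_derive_ext => t.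
  by rewrite /slice upd_slice_fst.
- have := dL j; rewrite upd_same; apply: ex_derive_ext => t.
  by rewrite /slice upd_upd.
Qed.

Lemma slice_c1_near L a b : D (upd (upd p i a) j b) -> c1_near (slice L) a b.
Proof.
move=> /slice_locally; apply: locally_2d_impl; apply: locally_2d_forall => a' b' H.
split; first by case: (H L) => _ [].
split; first by case: (H L).
apply: continuity_2d_pt_ext (proj1 (H (i :: L))) => x y.
by rewrite Dt_slice.
Qed.

Lemma slice_comm L a b : D (upd (upd p i a) j b) ->
  slice (i :: j :: L) a b = slice (j :: i :: L) a b.
Proof.
move=> Dab.
have E1 x y : Derive (fun z => Derive (slice L z) y) x = slice (i :: j :: L) x y.
  rewrite (Derive_ext _ (fun z => slice (j :: L) z y)) => [|z]; last exact: Dx_slice.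
  exact: (Dt_slice (j :: L)).
have E2 x y : Derive (fun z => Derive (fun t => slice L t z) x) y = slice (j :: i :: L) x y.
  rewrite (Derive_ext _ (slice (i :: L) x)) => [|z]; last exact: (Dt_slice L).
  exact: Dx_slice.
rewrite -E1 -E2; apply: Schwarz.
- apply: locally_2d_impl (slice_locally Dab); apply: locally_2d_forall => x y H.
  have [_ [d1 d2]] := H L; split=> //; split=> //; split.
    apply: (ex_derive_ext (fun z => slice (j :: L) z y)); last by case: (H (j :: L)) => _ [].
    by move=> z; rewrite Dx_slice.
  apply: (ex_derive_ext (slice (i :: L) x)); last by case: (H (i :: L)) => _ [].
  by move=> z; rewrite -Dt_slice.
- have [c _] := locally_2d_singleton _ _ _ (slice_locally Dab) (i :: j :: L).
  by apply: continuity_2d_pt_ext c => x y; rewrite E1.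
- have [c _] := locally_2d_singleton _ _ _ (slice_locally Dab) (j :: i :: L).
  by apply: continuity_2d_pt_ext c => x y; rewrite E2.
Qed.

Lemma slice_ex_derive L a b : D (upd (upd p i a) j b) -> ex_derive (slice L a) b.
Proof. by move=> /slice_locally/locally_2d_singleton/(_ L) [_ []]. Qed.
End SmoothSlices.

Lemma is_derive_eq (f : R -> R) x l l' : is_derive f x l -> l = l' -> is_derive f x l'.
Proof. by move=> D <-. Qed.

Lemma Rpower_is_derive (v : R -> R) c x : (forall x, 0 < v x) -> circle_fun v ->
  is_derive (fun x => Rpower (v x) c) x (Derive v x * (c * Rpower (v x) (c - 1))).
Proof.
move=> v0 cv; apply: (is_derive_comp (fun y => Rpower y c) v).
  exact: is_derive_Rpower.
exact: circ_is_derive.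
Qed.

(* Up to a total derivative the integrand is -(2/9) v^(-5/3) (f - Q v'/v)^2. *)
Lemma geodesic_concave v f : circle_fun v -> (forall x, 0 < v x) -> tangent f ->
  RInt (fun x => - Gam v f f x * (1 / 3 * Rpower (v x) (1 / 3 - 1)) +
     f x * (f x * (1 / 3 * ((1 / 3 - 1) * Rpower (v x) (1 / 3 - 1 - 1))))) 0 1 <= 0.
Proof.
move=> cv v0 tf; have [cf _] := tf; have cQ := circ_Qprim v tf.
pose P := primGam v f f.
have cP : circle_fun P by exact/circ_Derive/(circ_Gam_potential cv v0 tf tf).
have cR c : circle_fun (fun x => Rpower (v x) c) by exact: circ_Rpower.
pose sq x := Rpower (v x) (1 / 3 - 1 - 1) *
   ((f x - Qprim v f x * Derive v x / v x) * (f x - Qprim v f x * Derive v x / v x)).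
have csq : circle_fun sq.
  have c1 : circle_fun (fun x => f x - Qprim v f x * Derive v x / v x).
    apply: circ_minus => //; apply: circ_div => //; apply: circ_mult => //.
    exact: circ_Derive.
  by apply: circ_mult => //; exact: circ_mult.
have E : RInt (fun x => - Gam v f f x * (1 / 3 * Rpower (v x) (1 / 3 - 1)) +
     f x * (f x * (1 / 3 * ((1 / 3 - 1) * Rpower (v x) (1 / 3 - 1 - 1))))) 0 1 =
   RInt (fun x => (- (2 / 9)) * sq x) 0 1.
  (* Since P' is [Gam v f f], this boundary term moves one derivative from the connection to the
     power of v. *)
  apply: (@circ_RInt_parts (fun x => - (1 / 3) * (Rpower (v x) (1 / 3 - 1) * P x))).
  - by apply: circ_mult; [exact: circ_const|exact: circ_mult].
  - have cG : circle_fun (Gam v f f) by case: (Gam_tangent cv v0 tf tf).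
    apply: circ_plus; first apply: circ_mult.
    + exact: circ_opp.
    + by apply: circ_mult => //; exact: circ_const.
    + do 2!(apply: circ_mult => //); apply: circ_mult; first exact: circ_const.
      by apply: circ_mult => //; exact: circ_const.
  - by apply: circ_mult => //; exact: circ_const.
  move=> x; have p := v0 x.
  have DP : is_derive P x (Gam v f f x) by exact: (circ_is_derive x cP).
  have DR := Rpower_is_derive (1 / 3 - 1) x v0 cv.
  apply: is_derive_eq (is_derive_scal _ x (- (1 / 3)) _ (is_derive_mult _ _ x _ _ DR DP Rmult_comm)) _.
  rewrite /Hierarchy.mult /= /Hierarchy.plus /= /P /primGam.
  by rewrite (Derive_Gam_potential x cv v0 tf tf) /sq; field; lra.
rewrite E circ_RInt_scal //.
have : 0 <= RInt sq 0 1.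
  apply: RInt_ge0; last exact: circ_ex_RInt.
  move=> x; apply: Rmult_le_pos; first exact/Rlt_le/exp_pos.
  exact: Rle_0_sqr.
by lra.
Qed.

Lemma Vol_concave (J : R -> Prop) (u : R -> R -> R) : canonical_geodesic J u ->
  forall t, J t -> ex_derive_n (fun t' => Vol (u t')) 2 t /\
       Derive_n (fun t' => Vol (u t')) 2 t <= 0.
Proof.
move=> [[su Mu] geo] t Jt.
have [tf geo_t] := geo t Jt; have M := Mu t Jt; have [cv [v0 _]] := M.
have c1u L x : c1_near (slice (fun p => u (p (i0 1)) (p (i1 0))) (fun _ => 0) (i0 1) (i1 0) L) t x.
  by apply: (slice_c1_near su).
have cu x : c1_near u t x by exact: (c1u [::] x).
have cut x : c1_near (Dt u) t x.
  apply: c1_near_ext (c1u [:: i0 1] x); apply: locally_2d_forall => a b.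
  by rewrite -Dt_slice.
pose h t x := Rpower (u t x) (1 / 3).
pose k t x := Dt u t x * (1 / 3 * Rpower (u t x) (1 / 3 - 1)).
have Hh : c1_param h t by move=> x _; exact: c1_near_Rpower.
have Hk : c1_param k t.
  move=> x _; apply: c1_near_mult => //.
  apply: c1_near_mult; last exact: c1_near_Rpower.
  by apply: (c1_near_cst (k := fun _ => 1 / 3)) => y; exact: continuous_const.
(* Vol is differentiated at all t' near t, possibly outside J, where u t' need not lie in [M1];
   positivity on [0, 1] comes from continuity and the tube lemma. *)
have upos : locally t (fun t' => forall x, 0 <= x <= 1 -> 0 < u t' x /\ c1_at u t' x).
  apply: (@tube R_UniformSpace (fun t' x => 0 < u t' x /\ c1_at u t' x)) => x _.
  apply/(@locally_2dP (fun t' x => 0 < u t' x /\ c1_at u t' x)).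
  apply: locally_2d_and; last exact: cu.
  by apply: continuity_2d_pt_pos; [case: (c1_near_at (cu x)) => _ []|exact: v0].
have DV : locally t (fun t' => is_derive (fun t => Vol (u t)) t' (RInt (k t') 0 1)).
  apply: filter_imp (filter_and _ _ (c1_param_near Hh) upos) => t' [H1 H2].
  have := c1_param_is_derive (H1 : c1_param h t').
  rewrite (_ : RInt (Dt h t') 0 1 = RInt (k t') 0 1) //.
  apply: RInt_ext => x; rewrite Rmin_left ?Rmax_right; try lra.
  move=> Hx; have [p [du _]] := H2 x (conj (Rlt_le _ _ (proj1 Hx)) (Rlt_le _ _ (proj2 Hx))).
  apply: is_derive_unique; apply: (is_derive_comp (fun y => Rpower y (1 / 3)) (fun t => u t x)).
    exact: is_derive_Rpower.
  exact: Derive_correct.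
have D2 : is_derive (Derive (fun t => Vol (u t))) t (RInt (Dt k t) 0 1).
  apply: (is_derive_ext_loc (fun t => RInt (k t) 0 1)); last exact: c1_param_is_derive.
  by apply: filter_imp DV => t' /is_derive_unique ->.
split; first by eexists; exact: D2.
rewrite /= (is_derive_unique _ _ _ D2).
have := geodesic_concave cv v0 tf.
rewrite (_ : RInt _ 0 1 = RInt (Dt k t) 0 1) //.
apply: RInt_eq => x; symmetry; apply: is_derive_unique.
have [du _] := c1_near_at (cu x); have [dut _] := c1_near_at (cut x).
(* The geodesic equation enters only here, at the time t itself. *)
have -> : - Gam (u t) (velocity u t) (velocity u t) x = Dt (Dt u) t x.
  have := geo_t x; rewrite (LC_E M tf tf) -[Derive_n _ 2 t]/(Dt (Dt u) t x); lra.
have DR : is_derive (fun z => 1 / 3 * Rpower (u z x) (1 / 3 - 1)) t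
    (Dt u t x * (1 / 3 * ((1 / 3 - 1) * Rpower (u t x) (1 / 3 - 1 - 1)))).
  apply: is_derive_eq (is_derive_scal (fun z => Rpower (u z x) (1 / 3 - 1)) t (1 / 3) _
    (is_derive_comp (fun y => Rpower y (1 / 3 - 1)) (fun z => u z x) t _ _
      (is_derive_Rpower (1 / 3 - 1) (v0 x)) (Derive_correct _ _ du))) _.
  by rewrite /Hierarchy.scal /= /Hierarchy.mult /= -/(Dt u t x); ring.
exact: (is_derive_mult _ _ t _ _ (Derive_correct _ _ dut) DR Rmult_comm).
Qed.

(** * The gradient flow of the volume *)

Lemma Rpower_pred x c : 0 < x -> Rpower x (c - 1) = Rpower x c / x.
Proof. by move=> x0; rewrite Rpower_plus Rpower_m1. Qed.

Lemma Vol_is_derive v h : M1 v -> tangent h ->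
  is_derive (fun e => Vol (fadd v (fscal e h))) 0
    (RInt (fun x => h x * (1 / 3 * Rpower (v x) (1 / 3 - 1))) 0 1).
Proof.
move=> [cv [v0 _]] [ch _].
have v00 x : 0 < fadd v (fscal 0 h) x by rewrite fadd_fscal0.
have H : c1_param (fun e x => Rpower (fadd v (fscal e h) x) (1 / 3)) 0.
  by move=> x Hx; apply: c1_near_Rpower => //; exact: (@c1_param_perturb v h 0 cv ch x Hx).
apply: is_derive_eq (c1_param_is_derive H) _.
apply: RInt_eq => x; apply: is_derive_unique.
have D : is_derive (fun e => fadd v (fscal e h) x) 0 (h x).
  by rewrite /fadd /fscal; auto_derive => //; ring.
have := is_derive_comp (fun y => Rpower y (1 / 3)) (fun e => fadd v (fscal e h) x) 0 _ _
  (is_derive_Rpower (1 / 3) (v00 x)) D.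
by rewrite fadd_fscal0.
Qed.

(* [Derive (grad_prim v)] is the velocity -(chi_vv v v')' of the gradient flow. *)
Definition grad_prim (v : R -> R) : R -> R := Derive (fun x => 2 / 3 * Rpower (v x) (1 / 3)).

Lemma grad_primE v x : circle_fun v -> (forall x, 0 < v x) ->
  grad_prim v x = 2 / 9 * (Rpower (v x) (1 / 3 - 1) * Derive v x).
Proof.
move=> cv v0; apply: is_derive_unique.
apply: is_derive_eq (is_derive_scal _ x (2 / 3) _ (Rpower_is_derive (1 / 3) x v0 cv)) _.
by eqR; field.
Qed.

Lemma circ_grad_prim v : circle_fun v -> (forall x, 0 < v x) -> circle_fun (grad_prim v).
Proof.
move=> cv v0; apply: circ_Derive; apply: circ_mult; first exact: circ_const.
exact: circ_Rpower.
Qed.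

(** The differential of Vol is int (1/3) v^(-2/3) h. As h = Q(h)', integration by parts turns it
    into int (2/9) v^(-5/3) v' Q(h), which is G of [Derive (grad_prim v)] with h; definiteness of G
    then identifies X. *)
Lemma Vol_gradient v X : M1 v -> is_gradient Vol v X -> X = Derive (grad_prim v).
Proof.
move=> Mv [tX HX]; have [cv [v0 _]] := Mv.
have cg := circ_grad_prim cv v0; have tg := tangent_Derive cg.
have cR c : circle_fun (fun x => Rpower (v x) c) by exact: circ_Rpower.
have GX h : tangent h -> Gform v X h = Gform v (Derive (grad_prim v)) h.
  move=> th; rewrite (Gform_Derive cv v0 cg th).
  rewrite -(GE cv v0 tX th) (is_derive_uniq (HX h th) (Vol_is_derive Mv th)).
  have [ch _] := th; have cQ := circ_Qprim v th.
  apply: (@circ_RInt_parts (fun x => 1 / 3 * Rpower (v x) (1 / 3 - 1) * Qprim v h x)).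
  - by apply: circ_mult => //; apply: circ_mult => //; exact: circ_const.
  - by apply: circ_mult => //; apply: circ_mult => //; exact: circ_const.
  - by apply: circ_div => //; exact: circ_mult.
  move=> x; have p := v0 x.
  apply: is_derive_eq (is_derive_mult _ _ x _ _
    (is_derive_scal _ x (1 / 3) _ (Rpower_is_derive (1 / 3 - 1) x v0 cv))
    (Qprim_is_derive v x th) Rmult_comm) _.
  rewrite /Hierarchy.plus /= /Hierarchy.mult /= (grad_primE x cv v0).
  by rewrite (Rpower_pred (1 / 3 - 1) p); field; lra.
have tk : tangent (fun x => (-1) * Derive (grad_prim v) x + X x) by exact: tangent_lin.
apply: functional_extensionality => x.
have := Gform_definite cv v0 tk _ x.
move=> H; suff : (-1) * Derive (grad_prim v) x + X x = 0 by lra.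
apply: H; rewrite (Gform_lin cv v0 (-1) tg tX tk).
by rewrite (GX _ tk); ring.
Qed.

(* With y = (2/9) v^(-2/3) w, the integrand is F' - 2 (z 0) Q / v
   - (4/9) v^(1/3) ((Q / v)')^2 for F = 2 Q y / v - Q^2 q / v^2. *)
Lemma gradient_dissipation v w : circle_fun v -> (forall x, 0 < v x) -> tangent w ->
  let Q := Qprim v w in
  let z := Derive (fun x => 2 / 9 * (Rpower (v x) (1 / 3 - 1) * w x)) in
  RInt (fun x => (z x - z 0) * Q x / v x + Q x * (z x - z 0) / v x
     - Q x * Q x * Derive (grad_prim v) x / (v x * v x)) 0 1 <= 0.
Proof.
move=> cv v0 tw Q z; have [cw _] := tw; have cQ : circle_fun Q := circ_Qprim v tw.
pose y x := 2 / 9 * (Rpower (v x) (1 / 3 - 1) * w x).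
have cR : circle_fun (fun x => Rpower (v x) (1 / 3 - 1)) by exact: circ_Rpower.
have cc := circ_const.
have cy : circle_fun y by apply: circ_mult => //; exact: circ_mult.
have cz : circle_fun z by exact: circ_Derive.
have cq := circ_grad_prim cv v0.
have cvv : circle_fun (fun x => v x * v x) by exact: circ_mult.
have vv0 x : 0 < v x * v x by exact: Rmult_lt_0_compat.
(* This is (Q / v)'. *)
pose d x := (w x * v x - Q x * Derive v x) / (v x * v x).
have cd : circle_fun d.
  apply: circ_div => //; apply: circ_minus; first exact: circ_mult.
  by apply: circ_mult => //; exact: circ_Derive.
pose sq x := Rpower (v x) (1 / 3 - 1) * v x * (d x * d x).
have csq : circle_fun sq by apply: circ_mult; exact: circ_mult.
have cQv : circle_fun (fun x => Q x / v x) by exact: circ_div.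
have E : RInt (fun x => (z x - z 0) * Q x / v x + Q x * (z x - z 0) / v x
     - Q x * Q x * Derive (grad_prim v) x / (v x * v x)) 0 1 =
   RInt (fun x => (- 2 * z 0) * (Q x / v x) + (- (4 / 9)) * sq x) 0 1.
  apply: (@circ_RInt_parts (fun x => 2 * Q x * y x / v x - Q x * Q x * grad_prim v x / (v x * v x))).
  - apply: circ_minus; apply: circ_div => //; apply: circ_mult => //; exact: circ_mult.
  - have cz0 : circle_fun (fun x => z x - z 0) by exact: circ_minus.
    apply: circ_minus; first apply: circ_plus; apply: circ_div => //; first exact: circ_mult.
      exact: circ_mult.
    by apply: circ_mult; [exact: circ_mult|exact: circ_Derive].
  - by apply: circ_plus; exact: circ_mult.
  move=> x; have p := v0 x; have Dq := circ_is_derive x cq; have Dv := circ_is_derive x cv.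
  have Dy : is_derive y x (z x) by exact: (circ_is_derive x cy).
  have DQ : is_derive Q x (w x) by exact: Qprim_is_derive.
  have qE := grad_primE x cv v0; have yE : y x = 2 / 9 * (Rpower (v x) (1 / 3 - 1) * w x) by [].
  rewrite /sq /d; move: Dq Dy DQ qE yE; clear -p Dv.
  move: (Rpower (v x) (1 / 3 - 1)) (Derive (grad_prim v) x) (z 0) (z x) (grad_prim v) y Q.
  move=> rho q1 z0 zx q y Q Dq Dy DQ qE yE.
  auto_derive.
    by repeat split; try (by eexists; eassumption); nra.
  rewrite (is_derive_unique _ _ _ Dq) (is_derive_unique _ _ _ Dy) (is_derive_unique _ _ _ DQ).
  by rewrite -[Derive (fun y => v y) x]/(Derive v x) qE yE; field; lra.
(* The constant z 0 disappears because Q / v has zero integral. *)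
rewrite E circ_RInt_lin // (RInt_Qprim cv v0 tw).
have : 0 <= RInt sq 0 1.
  apply: RInt_ge0; last exact: circ_ex_RInt.
  move=> x; apply: Rmult_le_pos; last exact: Rle_0_sqr.
  by apply: Rmult_le_pos; [exact/Rlt_le/exp_pos|exact/Rlt_le/v0].
by lra.
Qed.

(** Even at an end point there are arbitrarily small steps into [0, 1]. Along these the difference
    quotients of a - b vanish, and they already determine its two-sided derivative. *)
Lemma derive_eq_on_segment (a b : R -> R) s l1 l2 : 0 <= s <= 1 ->
  (forall s', 0 <= s' <= 1 -> a s' = b s') -> is_derive a s l1 -> is_derive b s l2 -> l1 = l2.
Proof.
move=> Hs ab Da Db.
have : is_derive (fun s => a s - b s) s (l1 - l2) by exact: is_derive_minus.
move=> /is_derive_Reals D.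
case: (Req_dec (l1 - l2) 0) => [|nz]; first lra.
have [d Hd] := D (Rabs (l1 - l2)) (Rabs_pos_lt _ nz).
have dp := cond_pos d.
(* Step to the right from the left half and to the left from the right half; a step of at most 1/2
   stays inside. *)
have [h [h0 [hd hs]]] : exists h, h <> 0 /\ Rabs h < d /\ 0 <= s + h <= 1.
  case: (Rle_dec s (1 / 2)) => Hs2.
    exists (Rmin (d / 2) (1 / 2)).
    have h1 : 0 < Rmin (d / 2) (1 / 2) by apply: Rmin_pos; lra.
    have h2 := Rmin_l (d / 2) (1 / 2); have h3 := Rmin_r (d / 2) (1 / 2).
    by rewrite Rabs_pos_eq; lra.
  exists (- Rmin (d / 2) (1 / 2)).
  have h1 : 0 < Rmin (d / 2) (1 / 2) by apply: Rmin_pos; lra.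
  have h2 := Rmin_l (d / 2) (1 / 2); have h3 := Rmin_r (d / 2) (1 / 2).
  by rewrite Rabs_Ropp Rabs_pos_eq; lra.
have := Hd h h0 hd; rewrite (ab _ hs) (ab _ Hs) !Rminus_diag /Rdiv Rmult_0_l.
by rewrite Rminus_0_l Rabs_Ropp; lra.
Qed.

Lemma c1_param_Dt_prim h t x : c1_param h t -> 0 <= x <= 1 ->
  Dt (fun t x => prim (h t) x) t x = prim (Dt h t) x.
Proof.
move=> H Hx; apply: is_derive_unique; have Hn := c1_param_near H.
apply: (is_derive_RInt_param h); rewrite ?Rmin_left ?Rmax_right; try lra.
- by apply: filter_imp Hn => t' Ht y Hy; have [] := c1_near_at (Ht y ltac:(lra)).
- by move=> y Hy; have [_ []] := c1_near_at (H y ltac:(lra)).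
- apply: filter_imp Hn => t' Ht; apply: ex_RInt_continuous => y.
  rewrite Rmin_left ?Rmax_right; try lra.
  move=> Hy; have [_ [c _]] := c1_near_at (Ht y ltac:(lra)); exact: continuity_2d_pt_slice c.
Qed.

(** Assumes integrability only, since it is applied at nearby times at which v and A need not be
    periodic. *)
Lemma energy_shift v A c : ex_RInt (fun x => A x * A x / v x) 0 1 ->
  ex_RInt (fun x => A x / v x) 0 1 -> ex_RInt (fun x => / v x) 0 1 ->
  RInt (fun x => / v x) 0 1 <> 0 ->
  energy v (fun x => A x - c) (fun x => A x - c) = energy v A A.
Proof.
move=> I2 I1 I0 n0; rewrite /energy.
have sc (f : R -> R) a : ex_RInt f 0 1 -> ex_RInt (fun x => a * f x) 0 1.
  by move=> If; exact: (@ex_RInt_scal R_NormedModule f 0 1 a If).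
have E1 : RInt (fun x => (A x - c) / v x) 0 1 =
    RInt (fun x => A x / v x) 0 1 + (- c) * RInt (fun x => / v x) 0 1.
  rewrite (@RInt_eq _ (fun x => 1 * (A x / v x) + (- c) * / v x)) => [|x]; last by rewrite /Rdiv; ring.
  by rewrite RInt_lin //; eqR; ring.
have E2 : RInt (fun x => (A x - c) * (A x - c) / v x) 0 1 =
    RInt (fun x => A x * A x / v x) 0 1 + (- 2 * c) * RInt (fun x => A x / v x) 0 1
    + (c * c) * RInt (fun x => / v x) 0 1.
  rewrite (@RInt_eq _ (fun x => 1 * (1 * (A x * A x / v x) + (- 2 * c) * (A x / v x))
    + (c * c) * / v x)) => [|x]; last by rewrite /Rdiv; ring.
  rewrite RInt_lin //; last first.
    by apply: (@ex_RInt_plus R_NormedModule (fun x => 1 * (A x * A x / v x))); exact: sc.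
  by rewrite RInt_lin //; eqR; ring.
by rewrite E1 E2; field.
Qed.

Section EnergyParam.
Variables (v A : R -> R -> R) (t : R).
Hypotheses (Hv : c1_param v t) (HA : c1_param A t).
Hypothesis v0 : forall x, 0 <= x <= 1 -> 0 < v t x.

Lemma energy_c1_param :
  [/\ c1_param (fun t x => A t x * A t x / v t x) t,
      c1_param (fun t x => A t x / v t x) t & c1_param (fun t x => / v t x) t].
Proof.
split=> x Hx.
- by apply: c1_near_div; [apply: c1_near_mult; exact: HA|exact: Hv|exact: v0].
- by apply: c1_near_div; [exact: HA|exact: Hv|exact: v0].
- by apply: c1_near_inv; [exact: Hv|exact: v0].
Qed.

Lemma energy_ex_derive : ex_derive (fun t => energy (v t) (A t) (A t)) t.
Proof.
have [H2 H1 H0] := energy_c1_param.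
have n0 := Rgt_not_eq _ _ (c1_param_RInt_inv_pos Hv v0).
have e2 : ex_derive _ t := ex_intro _ _ (c1_param_is_derive H2).
have e1 : ex_derive _ t := ex_intro _ _ (c1_param_is_derive H1).
have e0 : ex_derive _ t := ex_intro _ _ (c1_param_is_derive H0).
rewrite /energy; apply: (ex_derive_minus (fun t => RInt (fun x => A t x * A t x / v t x) 0 1)) => //.
apply: ex_derive_div => //.
exact: (ex_derive_mult (fun t => RInt (fun x => A t x / v t x) 0 1)).
Qed.

(** With c the constant of Q at time t, frozen, the energy is unchanged near t and meets the
    zero-mean hypotheses of [energy_is_derive]. *)
Lemma energy_shift_near c :
  locally t (fun t => energy (v t) (fun x => A t x - c) (fun x => A t x - c) =
                      energy (v t) (A t) (A t)).
Proof.
have [H2 H1 H0] := energy_c1_param.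
have P : locally t (fun t => 0 < RInt (fun x => / v t x) 0 1).
  have C := ex_derive_continuous _ _ (ex_intro _ _ (c1_param_is_derive H0)).
  have p := c1_param_RInt_inv_pos Hv v0.
  move/filterlim_locally: C => /(_ (mkposreal _ p)); apply: filter_imp => t' /ball_R /=.
  by move=> /Rabs_def2; lra.
apply: filter_imp (filter_and _ _ P (filter_and _ _ (c1_param_near H2)
  (filter_and _ _ (c1_param_near H1) (c1_param_near H0)))) => t' [p [K2 [K1 K0]]].
apply: energy_shift; [exact: (c1_param_ex_RInt K2)|exact: (c1_param_ex_RInt K1)|
  exact: (c1_param_ex_RInt K0)|lra].
Qed.
End EnergyParam.

Lemma is_derive_flow_rhs (c : R) (a r1 r2 b : R -> R) s la l1 l2 lb :
  is_derive a s la -> is_derive r1 s l1 -> is_derive r2 s l2 -> is_derive b s lb ->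
  is_derive (fun s => 2 / 9 * ((a s * (c * r2 s)) * a s + r1 s * b s)) s
    (2 / 9 * ((la * (c * r2 s) + a s * (c * l2)) * a s + (a s * (c * r2 s)) * la
              + (l1 * b s + r1 s * lb))).
Proof.
move=> Da D1 D2 Db; auto_derive; first by repeat split; eexists; eassumption.
rewrite (is_derive_unique _ _ _ Da) (is_derive_unique _ _ _ D1) (is_derive_unique _ _ _ D2)
  (is_derive_unique _ _ _ Db).
ring.
Qed.

(** * Two-parameter families of gradient flow lines *)

Section GradientFlow.
Variables (J : R -> Prop) (u : R -> R -> R -> R).
Hypothesis fam : gradient_flow_family J u.

Let kt : 'I_3 := i0 2.
Let ks : 'I_3 := i1 1.
Let kx : 'I_3 := i2 0.

Let F (p : 'I_3 -> R) := u (p kt) (p ks) (p kx).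
Let D (p : 'I_3 -> R) := J (p kt) /\ 0 <= p ks <= 1.

Let sF : smooth_on D F. Proof. by case: fam. Qed.

(** The partial derivatives of u as functions of (t, s, x), the head of L being the outermost. The
    slices in the three coordinate planes all reduce to it, so facts found in one plane can be used
    in another. *)
Definition jet (L : seq 'I_3) (t s x : R) : R :=
  partials L F (fun i => if i == kt then t else if i == ks then s else x).

Lemma jet_tx L t s x : slice F (upd (fun _ => 0) ks s) kt kx L t x = jet L t s x.
Proof.
by congr (partials L F _); apply: functional_extensionality; case=> -[|[|[|//]]] ?.
Qed.

Lemma jet_sx L t s x : slice F (upd (fun _ => 0) kt t) ks kx L s x = jet L t s x.
Proof.
by congr (partials L F _); apply: functional_extensionality; case=> -[|[|[|//]]] ?.
Qed.

Lemma jet_ts L t s x : slice F (upd (fun _ => 0) kx x) kt ks L t s = jet L t s x.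
Proof.
by congr (partials L F _); apply: functional_extensionality; case=> -[|[|[|//]]] ?.
Qed.

Section At.
Variables t s : R.
Hypotheses (Jt : J t) (s01 : 0 <= s <= 1).

Lemma jet_c1_tx L x : c1_near (fun t x => jet L t s x) t x.
Proof.
apply: c1_near_ext (@slice_c1_near _ D F (upd (fun _ => 0) ks s) kt kx sF isT L t x _).
  by apply: locally_2d_forall => a b; exact: jet_tx.
by [].
Qed.

Lemma jet_c1_sx L x : c1_near (fun s x => jet L t s x) s x.
Proof.
apply: c1_near_ext (@slice_c1_near _ D F (upd (fun _ => 0) kt t) ks kx sF isT L s x _).
  by apply: locally_2d_forall => a b; exact: jet_sx.
by [].
Qed.

Lemma jet_comm_ts L x : jet (kt :: ks :: L) t s x = jet (ks :: kt :: L) t s x.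
Proof.
rewrite -!jet_ts.
by apply: (@slice_comm _ D F (upd (fun _ => 0) kx x) kt ks sF isT).
Qed.

Lemma jet_comm_sx L x : jet (ks :: kx :: L) t s x = jet (kx :: ks :: L) t s x.
Proof.
rewrite -!jet_sx.
by apply: (@slice_comm _ D F (upd (fun _ => 0) kt t) ks kx sF isT).
Qed.

Lemma jet_ex_derive_x L x : ex_derive (jet L t s) x.
Proof.
apply: (ex_derive_ext (slice F (upd (fun _ => 0) kt t) ks kx L s)).
  by move=> y; exact: jet_sx.
by apply: (@slice_ex_derive _ D F (upd (fun _ => 0) kt t) ks kx sF isT).
Qed.
End At.

Lemma jet_Dt L t s x : Dt (fun t x => jet L t s x) t x = jet (kt :: L) t s x.
Proof.
rewrite -jet_tx -(@Dt_slice _ F (upd (fun _ => 0) ks s) kt kx isT).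
by apply: Derive_ext => z; rewrite jet_tx.
Qed.

Lemma jet_Ds L t s x : Dt (fun s x => jet L t s x) s x = jet (ks :: L) t s x.
Proof.
rewrite -jet_sx -(@Dt_slice _ F (upd (fun _ => 0) kt t) ks kx isT).
by apply: Derive_ext => z; rewrite jet_sx.
Qed.

Lemma jet_Dx L t s : Derive (jet L t s) = jet (kx :: L) t s.
Proof.
apply: functional_extensionality => x.
rewrite -jet_sx -(@Dx_slice _ F (upd (fun _ => 0) kt t) ks kx).
by apply: Derive_ext => z; rewrite jet_sx.
Qed.

Lemma jet_is_derive_x L t s x : J t -> 0 <= s <= 1 ->
  is_derive (jet L t s) x (jet (kx :: L) t s x).
Proof. by move=> Jt Hs; rewrite -jet_Dx; apply/Derive_correct/jet_ex_derive_x. Qed.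

Lemma jet_is_derive_s L t s x : J t -> 0 <= s <= 1 ->
  is_derive (fun s => jet L t s x) s (jet (ks :: L) t s x).
Proof.
by move=> Jt Hs; rewrite -jet_Ds; exact: (c1_at_is_derive (c1_near_at (jet_c1_sx Jt Hs L x))).
Qed.

Lemma jet_smooth1 L t s : J t -> 0 <= s <= 1 -> smooth1 (jet L t s).
Proof.
move=> Jt Hs; apply: (@smooth1_stable (fun f => exists L, f = jet L t s)); last by exists L.
move=> _ [L' ->]; split=> [x|]; first exact: jet_ex_derive_x.
by exists (kx :: L'); exact: jet_Dx.
Qed.

Lemma flow_M1 t s : J t -> 0 <= s <= 1 -> M1 (u t s).
Proof. by move=> Jt Hs; case: fam => _ H; case: (H t s Jt Hs). Qed.

Lemma velocityE t s : velocity (u t) s = jet [:: ks] t s.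
Proof. by apply: functional_extensionality => x; rewrite -(jet_Ds [::]). Qed.

(** Periodicity and unit mass of u, known for s in [0, 1], are differentiated in s. *)
Lemma flow_tangent t s : J t -> 0 <= s <= 1 -> tangent (jet [:: ks] t s).
Proof.
move=> Jt Hs; split; first split.
- exact: jet_smooth1.
- move=> x.
  apply: (@derive_eq_on_segment (fun s => jet [::] t s (x + 1)) (fun s => jet [::] t s x) s) => //.
  + by move=> s' Hs'; have [[_ per] _] := flow_M1 Jt Hs'; exact: per.
  + exact: jet_is_derive_s.
  + exact: jet_is_derive_s.
- have H : c1_param (fun s x => jet [::] t s x) s by move=> x _; exact: jet_c1_sx.
  apply: (@derive_eq_on_segment (fun s => RInt (jet [::] t s) 0 1) (fun _ => 1) s) => //.
  + by move=> s' Hs'; have [_ [_ I1]] := flow_M1 Jt Hs'; exact: I1.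
  + apply: is_derive_eq (c1_param_is_derive H) _.
    by apply: RInt_eq => x; exact: (jet_Ds [::]).
  + exact: is_derive_cst.
Qed.

Lemma flow_eq t s x : J t -> 0 <= s <= 1 ->
  jet [:: kt] t s x = Derive (grad_prim (u t s)) x.
Proof.
move=> Jt Hs; case: fam => _ H; case: (H t s Jt Hs) => M HX.
rewrite -(Vol_gradient M HX) -(jet_Dt [::]) //.
Qed.

Lemma Rpower_comp_is_derive (k : R -> R) c y dk : is_derive k y dk -> 0 < k y ->
  is_derive (fun y => Rpower (k y) c) y (dk * (c * Rpower (k y) (c - 1))).
Proof.
move=> Dk k0; apply: (is_derive_comp (fun y => Rpower y c) k) => //.
exact: is_derive_Rpower.
Qed.

Lemma flow_eq_explicit t s x : J t -> 0 <= s <= 1 ->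
  jet [:: kt] t s x =
  2 / 9 * ((jet [:: kx] t s x * ((1 / 3 - 1) * Rpower (u t s x) (1 / 3 - 1 - 1))) * jet [:: kx] t s x
           + Rpower (u t s x) (1 / 3 - 1) * jet [:: kx; kx] t s x).
Proof.
move=> Jt Hs; rewrite flow_eq //; have [cv [v0 _]] := flow_M1 Jt Hs.
have -> : grad_prim (u t s) =
    fun x => 2 / 9 * (Rpower (jet [::] t s x) (1 / 3 - 1) * jet [:: kx] t s x).
  by apply: functional_extensionality => y; rewrite grad_primE // -jet_Dx.
apply: is_derive_unique.
apply: is_derive_eq (is_derive_scal _ x (2 / 9) _ (is_derive_mult _ _ x _ _
  (Rpower_comp_is_derive (1 / 3 - 1) (jet_is_derive_x [::] x Jt Hs) (v0 x))
  (jet_is_derive_x [:: kx] x Jt Hs) Rmult_comm)) _.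
by rewrite /Hierarchy.plus /= /Hierarchy.mult /=.
Qed.

(* The flow equation differentiated in s; as it only holds for s in [0, 1], the
   derivatives at the end points are compared one-sidedly. *)
Lemma variation_eq t s x : J t -> 0 <= s <= 1 ->
  jet [:: kt; ks] t s x =
  Derive (Derive (fun x => 2 / 9 * (Rpower (u t s x) (1 / 3 - 1) * jet [:: ks] t s x))) x.
Proof.
move=> Jt Hs; have [cv [v0 _]] := flow_M1 Jt Hs.
pose rho c y := Rpower (jet [::] t s y) c.
have Drho c y : is_derive (rho c) y (jet [:: kx] t s y * (c * rho (c - 1) y)).
  exact: (Rpower_comp_is_derive c (jet_is_derive_x [::] y Jt Hs) (v0 y)).
have E1 : Derive (fun x => 2 / 9 * (rho (1 / 3 - 1) x * jet [:: ks] t s x)) = fun y =>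
    2 / 9 * (jet [:: kx] t s y * ((1 / 3 - 1) * rho (1 / 3 - 1 - 1) y) * jet [:: ks] t s y
     + rho (1 / 3 - 1) y * jet [:: kx; ks] t s y).
  apply: functional_extensionality => y; apply: is_derive_unique.
  exact: (is_derive_scal _ y (2 / 9) _ (is_derive_mult _ _ y _ _ (Drho (1 / 3 - 1) y)
    (jet_is_derive_x [:: ks] y Jt Hs) Rmult_comm)).
have E2 : Derive (Derive (fun x => 2 / 9 * (rho (1 / 3 - 1) x * jet [:: ks] t s x))) x =
   2 / 9 * (jet [:: kx; kx] t s x * ((1 / 3 - 1) * rho (1 / 3 - 1 - 1) x) * jet [:: ks] t s x
     + jet [:: kx] t s x * ((1 / 3 - 1) * (jet [:: kx] t s x * ((1 / 3 - 1 - 1) * rho (1 / 3 - 1 - 1 - 1) x)))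
         * jet [:: ks] t s x
     + 2 * (jet [:: kx] t s x * ((1 / 3 - 1) * rho (1 / 3 - 1 - 1) x) * jet [:: kx; ks] t s x)
     + rho (1 / 3 - 1) x * jet [:: kx; kx; ks] t s x).
  rewrite E1; apply: is_derive_unique.
  have D1 := Drho (1 / 3 - 1) x; have D2 := Drho (1 / 3 - 1 - 1) x.
  have D3 := jet_is_derive_x [:: kx] x Jt Hs; have D4 := jet_is_derive_x [:: ks] x Jt Hs.
  have D5 := jet_is_derive_x [:: kx; ks] x Jt Hs.
  move: D1 D2 D3 D4 D5.
  move: (rho (1 / 3 - 1 - 1 - 1) x) (rho (1 / 3 - 1)) (rho (1 / 3 - 1 - 1)).
  move: (jet [:: kx; kx] t s x) (jet [:: kx; kx; ks] t s x) (jet [:: kx; ks] t s)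
    (jet [:: kx] t s) (jet [:: ks] t s) => a b c d e r3 r1 r2 D1 D2 D3 D4 D5.
  auto_derive; first by repeat split; eexists; eassumption.
  rewrite (is_derive_unique _ _ _ D1) (is_derive_unique _ _ _ D2) (is_derive_unique _ _ _ D3)
    (is_derive_unique _ _ _ D4) (is_derive_unique _ _ _ D5).
  by ring.
apply: etrans _ (esym E2).
rewrite jet_comm_ts //.
apply: (@derive_eq_on_segment (fun s => jet [:: kt] t s x) (fun s =>
  2 / 9 * ((jet [:: kx] t s x * ((1 / 3 - 1) * Rpower (jet [::] t s x) (1 / 3 - 1 - 1))) * jet [:: kx] t s x
           + Rpower (jet [::] t s x) (1 / 3 - 1) * jet [:: kx; kx] t s x)) s) => //.
- by move=> s' Hs'; exact: flow_eq_explicit.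
- exact: jet_is_derive_s.
have D0 := jet_is_derive_s [::] x Jt Hs.
have D1 := Rpower_comp_is_derive (1 / 3 - 1) D0 (v0 x).
have D2 := Rpower_comp_is_derive (1 / 3 - 1 - 1) D0 (v0 x).
have D3 : is_derive (fun s => jet [:: kx] t s x) s (jet [:: kx; ks] t s x).
  by rewrite -jet_comm_sx //; exact: jet_is_derive_s.
have D4 : is_derive (fun s => jet [:: kx; kx] t s x) s (jet [:: kx; kx; ks] t s x).
  have -> : jet [:: kx; kx; ks] t s x = jet [:: ks; kx; kx] t s x.
    rewrite jet_comm_sx // -!(jet_Dx (_ :: [:: _])); apply: Derive_ext => y.
    by rewrite jet_comm_sx.
  exact: jet_is_derive_s.
apply: is_derive_eq (is_derive_flow_rhs (1 / 3 - 1) D3 D1 D2 D4) _.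
by rewrite /rho; eqR; ring.
Qed.

Let w (t s : R) := jet [:: ks] t s.
Let E (t s : R) := energy (u t s) (prim (w t s)) (prim (w t s)).

Lemma G_energy t s : J t -> 0 <= s <= 1 ->
  G (u t s) (velocity (u t) s) (velocity (u t) s) = E t s.
Proof.
move=> Jt Hs; have [cv [v0 _]] := flow_M1 Jt Hs; have tw := flow_tangent Jt Hs.
rewrite velocityE (GE cv v0 tw tw) (Gform_shift cv v0 0 0 tw tw) /E /energy -/(w t s).
have S : (fun x => prim (w t s) x - 0) = prim (w t s).
  by apply: functional_extensionality => x; rewrite Rminus_0_r.
have S1 : (fun x => (prim (w t s) x - 0) / u t s x) = fun x => prim (w t s) x / u t s x.
  by apply: functional_extensionality => x; rewrite Rminus_0_r.
have S2 : (fun x => (prim (w t s) x - 0) * (prim (w t s) x - 0) / u t s x) =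
    fun x => prim (w t s) x * prim (w t s) x / u t s x.
  by apply: functional_extensionality => x; rewrite Rminus_0_r.
by rewrite S1 S2.
Qed.

(** After the shift that turns the primitive of w into Q at time t, [energy_is_derive] produces
    exactly the integral estimated in [gradient_dissipation]. *)
Lemma energy_decay t s : J t -> 0 <= s <= 1 ->
  exists l, l <= 0 /\ is_derive (fun t => E t s) t l.
Proof.
move=> Jt Hs; have [cv [v0 _]] := flow_M1 Jt Hs; have tw := flow_tangent Jt Hs.
have cw : circle_fun (w t s) by case: tw.
pose c := RInt (fun x => prim (w t s) x / u t s x) 0 1 / RInt (fun x => / u t s x) 0 1.
have QE x : prim (w t s) x - c = Qprim (u t s) (w t s) x by rewrite QprimE.
have Hv : c1_param (fun t => u t s) t by move=> x _; exact: (jet_c1_tx Jt Hs [::]).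
have Hw : c1_param (fun t => w t s) t by move=> x _; exact: (jet_c1_tx Jt Hs [:: ks]).
have HA : c1_param (fun t => prim (w t s)) t by exact: (c1_param_prim Hw).
have HAc : c1_param (fun t x => prim (w t s) x - c) t.
  move=> x Hx; apply: c1_near_minus; first exact: HA.
  by apply: (c1_near_cst (k := fun _ => c)) => y; exact: continuous_const.
have A0 : RInt (fun x => (prim (w t s) x - c) / u t s x) 0 1 = 0.
  rewrite (@RInt_eq _ (fun x => Qprim (u t s) (w t s) x / u t s x)) => [|x].
    exact: RInt_Qprim.
  by rewrite QE.
have DE := energy_is_derive Hv HAc HAc (fun x _ => v0 x) A0 A0.
have DE' := is_derive_ext_loc _ _ _ _
  (energy_shift_near Hv HA (fun x _ => v0 x) c) DE.
eexists; split; last exact: DE'.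
have := gradient_dissipation cv v0 tw.
pose z := Derive (fun x => 2 / 9 * (Rpower (u t s x) (1 / 3 - 1) * w t s x)).
have cz : circle_fun z.
  by apply/circ_Derive/circ_mult; [exact: circ_const|apply: circ_mult => //; exact: circ_Rpower].
cbv zeta; rewrite -/z; set r := RInt _ 0 1 => Hr; set r' := RInt _ 0 1; have -> // : r' = r.
apply: RInt_ext => x; rewrite Rmin_left ?Rmax_right; try lra.
move=> Hx; have Hx' : 0 <= x <= 1 by lra.
(* The variation equation says w_t = z', and the primitive of z' from 0 is z x - z 0. *)
have DA : Dt (fun t x => prim (w t s) x - c) t x = z x - z 0.
  have -> : Dt (fun t x => prim (w t s) x - c) t x = prim (Dt (fun t => w t s) t) x.
    rewrite -(c1_param_Dt_prim Hw Hx'); apply: is_derive_unique.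
    rewrite -[Dt _ t x]Rminus_0_r; apply: is_derive_minus; last exact: is_derive_cst.
    exact: (c1_at_is_derive (c1_near_at (HA x Hx'))).
  have -> : Dt (fun t => w t s) t = Derive z.
    apply: functional_extensionality => y.
    exact: (etrans (jet_Dt [:: ks] t s y) (variation_eq y Jt Hs)).
  rewrite /prim; apply: RInt_Derive => y _; first exact: circ_ex_derive.
  by apply: circ_continuous; exact: circ_Derive.
have Dv : Dt (fun t => u t s) t x = Derive (grad_prim (u t s)) x.
  by rewrite -flow_eq // -(jet_Dt [::]).
by rewrite DA Dv QE.
Qed.

Lemma energy_continuous t s : J t -> 0 <= s <= 1 -> continuous (E t) s.
Proof.
move=> Jt Hs; have [cv [v0 _]] := flow_M1 Jt Hs.
apply: (@ex_derive_continuous _ _ (E t)).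
apply: (@energy_ex_derive (u t) (fun s => prim (w t s)) s) => //.
- by move=> x _; exact: (jet_c1_sx Jt Hs [::]).
- have Hw : c1_param (w t) s by move=> x _; exact: (jet_c1_sx Jt Hs [:: ks]).
  exact: (c1_param_prim Hw).
Qed.

Lemma energy_mono s t1 t2 : is_interval J -> 0 <= s <= 1 -> J t1 -> J t2 -> t1 <= t2 ->
  E t2 s <= E t1 s.
Proof.
move=> IJ Hs J1 J2 H12.
have Jt t : t1 <= t <= t2 -> J t by exact: IJ.
have DE t : t1 <= t <= t2 -> is_derive (fun t => E t s) t (Derive (fun t => E t s) t).
  by move=> /Jt J'; have [l [_ D']] := energy_decay J' Hs; apply: Derive_correct; exists l.
have [|t Ht|c [Hc]] := MVT_gen (fun t => E t s) t1 t2 (Derive (fun t => E t s)).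
- by rewrite Rmin_left ?Rmax_right // => t Ht; apply: DE; lra.
- apply/continuity_pt_filterlim.
  apply: (@ex_derive_continuous _ _ (fun t => E t s)); eexists; apply: DE.
  by move: Ht; rewrite Rmin_left ?Rmax_right.
move: Hc; rewrite Rmin_left ?Rmax_right // => Hc.
have [l [l0 /is_derive_unique ->]] := energy_decay (Jt c Hc) Hs.
by nra.
Qed.

Lemma gradient_flow_contracts : is_interval J ->
  (forall s t1 t2, 0 <= s <= 1 -> J t1 -> J t2 -> t1 <= t2 ->
     G (u t2 s) (velocity (u t2) s) (velocity (u t2) s)
     <= G (u t1 s) (velocity (u t1) s) (velocity (u t1) s)) /\
  (forall t1 t2, J t1 -> J t2 -> t1 <= t2 -> path_length (u t2) <= path_length (u t1)).
Proof.
move=> IJ; split=> [s t1 t2 Hs J1 J2 H12|t1 t2 J1 J2 H12].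
  by rewrite !G_energy //; exact: energy_mono.
have I t : J t -> ex_RInt (fun s => sqrt (G (u t s) (velocity (u t) s) (velocity (u t) s))) 0 1.
  move=> Jt; apply: (ex_RInt_ext (fun s => sqrt (E t s))).
    move=> s; rewrite Rmin_left ?Rmax_right; try lra.
    by move=> Hs; rewrite G_energy //; lra.
  apply: ex_RInt_continuous => s; rewrite Rmin_left ?Rmax_right; try lra.
  (* Continuity of the energy in s makes both lengths proper integrals, so that they can be compared
     pointwise. *)
  move=> Hs; apply: (continuous_comp (E t) sqrt); first exact: energy_continuous.
  exact: continuous_sqrt.
apply: RInt_le; [lra|exact: I|exact: I|].
move=> s Hs; have Hs' : 0 <= s <= 1 by lra.
by apply: sqrt_le_1_alt; rewrite !G_energy //; exact: energy_mono.
Qed.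
End GradientFlow.

Theorem theorem1p2 :
  (* (1) Vol is geodesically concave *)
  (forall (J : R -> Prop) (u : R -> R -> R),
     is_interval J -> canonical_geodesic J u ->
     forall t, J t ->
       ex_derive_n (fun t' => Vol (u t')) 2 t /\
       Derive_n (fun t' => Vol (u t')) 2 t <= 0) /\
  (* (2) the gradient flow of Vol decreases the distance *)
  (forall (J : R -> Prop) (u : R -> R -> R -> R),
     is_interval J -> gradient_flow_family J u ->
     (forall s t1 t2, 0 <= s <= 1 -> J t1 -> J t2 -> t1 <= t2 ->
        G (u t2 s) (velocity (u t2) s) (velocity (u t2) s)
        <= G (u t1 s) (velocity (u t1) s) (velocity (u t1) s)) /\
     (forall t1 t2, J t1 -> J t2 -> t1 <= t2 ->
        path_length (u t2) <= path_length (u t1))) /\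
  (* (3) the sectional curvature is non-negative *)
  (forall u f g : R -> R,
     M1 u -> tangent f -> tangent g -> lin_indep f g ->
     0 <= sectional u f g).
Proof.
split; last split.
- by move=> J u _ geo t Jt; exact: (Vol_concave geo Jt).
- by move=> J u IJ fam; exact: (gradient_flow_contracts fam IJ).
- by move=> u f g Mu tf tg _; exact: sectional_ge0.
Qed.
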